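(* For each $\theta\in[0,2\pi)$ there exists a two-parameter family $u_{\alpha,J}$, $(\alpha,J)\in[0,1]\times[0,\tfrac{1}{3\sqrt3}]$, of $\theta$-special Legendrian immersions $\mathbb{R}^2\to S^5(1)\subset\mathbb{C}^3$ with the following properties: (i) The immersion $u_{\alpha,J}$ is invariant under the one-parameter subgroup of $\mathrm{SU}(3)$ generated by $A=i\,\mathrm{diag}(1,\alpha,-1-\alpha)\in su(3)$. (ii) For $\alpha=1$ or $J=\tfrac{1}{3\sqrt3}$ these immersions all describe Clifford tori, but otherwise all the immersions are geometrically distinct. (iii) The family $u_{\alpha,J}$ contains all $\theta$-special Legendrian immersions of the form $u(s,t)=e^{Bs}z(t)$, with $B\in u(3)$ and $z:\mathbb{R}\to S^5(1)$, which cover a torus.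
   Context: $S^5(1)$ is the unit sphere in $\mathbb{C}^3$. Let $\alpha_\theta=\operatorname{Re}(e^{i\theta}dz^1\wedge dz^2\wedge dz^3)$, let $X$ be the Euler (radial) vector field, and $\alpha_{\theta,N}=\iota_X\alpha_\theta$. An immersion of an oriented surface into $S^5(1)$ is $\theta$-special Legendrian if $\alpha_{\theta,N}$ pulls back to the Riemannian volume form of the induced metric (equivalently, the cone over it is calibrated by $\alpha_\theta$). Such immersions are minimal and Legendrian. ''Clifford tori'' refers to the generalized Clifford tori $T_\vartheta=\{z\in\mathbb{C}^3: |z_1|^2=|z_2|^2=|z_3|^2=\tfrac13,\ \sum_j\arg z_j=\vartheta\}$, which are flat minimal Legendrian tori in $S^5(1)$. ''Geometrically distinct'' means that the immersed surfaces are not the same up to isometries of $S^5(1)$ and reparametrization. An immersion of $\mathbb{R}^2$ covers a torus if it is doubly periodic with respect to some lattice in $\mathbb{R}^2$. *)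

(* Defs.v *)
From HB Require Import structures.
From mathcomp Require Import all_boot all_order all_algebra.
From mathcomp Require Import complex.
From mathcomp Require Import all_classical all_reals all_analysis.

Set Implicit Arguments.
Unset Strict Implicit.
Unset Printing Implicit Defensive.

Import Order.TTheory GRing.Theory Num.Theory.
Import numFieldNormedType.Exports.

Local Open Scope classical_set_scope.
Local Open Scope ring_scope.
Local Open Scope complex_scope.

(* Limit of the exponential series for the entrywise topology of matrices. *)
Definition expmx (K : numFieldType) (n : nat) (B : 'M[K]_n.+1) : 'M[K]_n.+1 :=
  lim (series (fun k : nat => (k`!%:R)^-1 *: B ^+ k) @ \oo).

Section Smooth.
Context {R : realType} {V W : normedModType R}.

(* f is C^k: directional derivatives up to order k, along constant vectors,
   exist and are continuous. *)
Fixpoint is_Ck (k : nat) (f : V -> W) : Prop :=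
  continuous f /\
  (if k is k'.+1 then
     forall v : V, (forall x, derivable f x v) /\ is_Ck k' ('D_v f)
   else True).

Definition smooth (f : V -> W) : Prop := forall k, is_Ck k f.

End Smooth.

Section Surfaces.
Context {R : realType}.

Definition cexp (a : R) : R[i] := cos a +i* sin a.

(* The real inner product of C^3 = R^6. *)
Definition rdot (x y : 'cV[R[i]]_3) : R :=
  complex.Re (\sum_j x j 0 * (y j 0)^*).

Definition S5 : set 'cV[R[i]]_3 := [set x | rdot x x = 1].

(* Riemannian (great-circle) distance of the unit sphere. *)
Definition S5dist (x y : 'cV[R[i]]_3) : R := acos (rdot x y).

(* The values of g outside the sphere are irrelevant. *)
Definition isometry_S5 (g : 'cV[R[i]]_3 -> 'cV[R[i]]_3) : Prop :=
  g @` S5 = S5 /\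
  (forall x y, S5 x -> S5 y -> S5dist (g x) (g y) = S5dist x y).

Local Notation plane := (R * R)%type.

Definition smooth_map (u : plane -> 'cV[R[i]]_3) : Prop :=
  forall j, smooth (fun p => complex.Re (u p j 0)) /\
            smooth (fun p => complex.Im (u p j 0)).

(* The differential of u at p, applied to v; it is taken over the reals, hence
   on real and imaginary parts. *)
Definition du (u : plane -> 'cV[R[i]]_3) (p v : plane) : 'cV[R[i]]_3 :=
  \col_j ('D_v (fun q => complex.Re (u q j 0)) p
          +i* 'D_v (fun q => complex.Im (u q j 0)) p).

Definition immersion_S5 (u : plane -> 'cV[R[i]]_3) : Prop :=
  [/\ smooth_map u, (forall p, S5 (u p)) &
      forall p v, du u p v = 0 -> v = 0].

Definition induced_metric (u : plane -> 'cV[R[i]]_3) (p v w : plane) : R :=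
  rdot (du u p v) (du u p w).

(* sqrt(EG - F^2) ds /\ dt: the plane carries its standard orientation. *)
Definition volume_form (u : plane -> 'cV[R[i]]_3) (p v w : plane) : R :=
  let g := induced_metric u p in
  let e1 : plane := (1, 0) in
  let e2 : plane := (0, 1) in
  Num.sqrt (g e1 e1 * g e2 e2 - g e1 e2 ^+ 2) * (v.1 * w.2 - v.2 * w.1).

(* alpha_theta = Re (e^{i theta} dz^1 /\ dz^2 /\ dz^3), where
   (dz^1 /\ dz^2 /\ dz^3)(a, b, c) is the determinant with columns a, b, c. *)
Definition alpha (theta : R) (a b c : 'cV[R[i]]_3) : R :=
  complex.Re (cexp theta * \det (\matrix_(i < 3, j < 3) ([:: a; b; c]`_j) i 0)).

(* Contraction of alpha_theta at x with the Euler field, whose value at x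
   is x. *)
Definition alphaN (theta : R) (x v w : 'cV[R[i]]_3) : R := alpha theta x v w.

Definition special_legendrian (theta : R) (u : plane -> 'cV[R[i]]_3) : Prop :=
  immersion_S5 u /\
  forall p v w, alphaN theta (u p) (du u p v) (du u p w) = volume_form u p v w.

Definition diffeo (phi : plane -> plane) : Prop :=
  smooth phi /\
  exists psi : plane -> plane, [/\ smooth psi, cancel phi psi & cancel psi phi].

Definition geometrically_same (u v : plane -> 'cV[R[i]]_3) : Prop :=
  exists g phi, [/\ isometry_S5 g, diffeo phi & forall p, v p = g (u (phi p))].

Definition covers_torus (u : plane -> 'cV[R[i]]_3) : Prop :=
  exists a b : plane, a.1 * b.2 - a.2 * b.1 != 0 /\
    forall p, u (p + a) = u p /\ u (p + b) = u p.

(* The a j are arguments of the z_j, each defined modulo 2 pi, so that the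
   torus only depends on vartheta modulo 2 pi. *)
Definition clifford_torus (vartheta : R) : set 'cV[R[i]]_3 :=
  [set z : 'cV[R[i]]_3 |
           (forall j, `|z j 0| ^+ 2 = 3%:R^-1) /\
           exists a : 'I_3 -> R,
             (forall j, z j 0 = `|z j 0| * cexp (a j)) /\
             \sum_j a j = vartheta].

Definition describes_clifford_torus (u : plane -> 'cV[R[i]]_3) : Prop :=
  covers_torus u /\
  exists g vartheta, isometry_S5 g /\ g @` range u = clifford_torus vartheta.

Definition one_param_subgroup (A : 'M[R[i]]_3) : set 'M[R[i]]_3 :=
  range (fun s : R => expmx (s%:C *: A)).

(* The surface u is mapped by each element of G to itself, up to
   reparametrization. *)
Definition invariant_under (G : set 'M[R[i]]_3) (u : plane -> 'cV[R[i]]_3) :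
  Prop :=
  forall g, G g -> exists2 phi, diffeo phi & forall p, g *m u p = u (phi p).

(* The Lie algebra u(3). *)
Definition skew_hermitian (B : 'M[R[i]]_3) : Prop :=
  forall i j, B i j = - (B j i)^*.

Definition genA (a : R) : 'M[R[i]]_3 :=
  'i%C *: diag_mx (\row_j ([:: 1; a; - 1 - a]`_j)%:C).

Definition Jmax : R := (3%:R * Num.sqrt 3%:R)^-1.

Definition in_range (a J : R) : Prop := (0 <= a <= 1) /\ (0 <= J <= Jmax).

End Surfaces.

(* Main.v *)
(* Let a = (1, al, -1 - al), let c be the cross product of a and (1, 1, 1), and
   let eta = - i e^(- i theta).  A surface e^(sA) z(t) whose profile solves
   z_j' = eta c_j conj(z_k z_l) is conformal and theta-special Legendrian as soon
   as z is a unit vector with sum_j a_j |z_j|^2 = 0; both quantities are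
   conserved, and so is the imaginary part of conj(eta) z_1 z_2 z_3, which is J.
   The member u_(al, J) is the one with |z_j|^2 = 1/3 at time 0.

   Distinctness: an isometry of the sphere is the restriction of a real linear
   isometry G, so that v = G u o phi also holds for second derivatives.  The
   metric is E (ds^2 + dt^2), and the normal part of u_ss has squared norm C / E,
   where C depends only on (al, J); hence E(v) = r E(u o phi) with r constant.
   Along the s-line through a point where E is not critical, E is constant and
   |E_t| is a function of E, so phi preserves the direction of this line; comparing
   second and third derivatives along it recovers al, then r = 1, then J.

   Classification: diagonalise B and let y be the profile in an eigenbasis, with
   eigenvalues i b_j.  Invariance of the calibration along e^(sB) gives
   sum_j b_j = 0, whence b = lam a up to a permutation.  Equality in the calibration
   inequality gives y' = mu (i b y) + nu n with nu > 0, where n_j is again a multiple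
   of conj(y_k y_l); periodicity makes the primitives of mu and nu into a change of
   parameters which turns y into a solution of the equation above.  Writing
   |y_j|^2 = 1/3 + c_j gamma, one has gamma'' = - 6 E gamma, so gamma vanishes
   somewhere, and a diagonal unitary matrix, possibly composed with complex
   conjugation and with a reversal of time, brings the solution to u_(al, J). *)

Require Import Defs.
From HB Require Import structures.
From mathcomp Require Import all_boot all_order all_algebra.
From mathcomp Require Import fingroup perm.
From mathcomp Require Import complex.
From mathcomp Require Import all_classical all_reals all_analysis.
From mathcomp Require Import ring lra.

Set Implicit Arguments.
Unset Strict Implicit.
Unset Printing Implicit Defensive.

Import Order.TTheory GRing.Theory Num.Theory.
Import numFieldNormedType.Exports.

Local Open Scope classical_set_scope.
Local Open Scope ring_scope.
Local Open Scope complex_scope.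

(** The profile equation is quadratic in six real coordinates. Local solutions come from Picard
    iteration with a step that depends on the coefficients alone; since the unit sphere is
    invariant, the same step can be repeated forever and solutions live on the whole line. The
    Clifford cases are explicit. For [J = Jmax] the real part of [cubic] vanishes at the start, the
    moduli stay constant and the phases are linear in time. For [al = 1] the third coefficient of
    the field is zero, so [z_3] is constant and the equation is linear in [(z_1, conj z_2)]; an
    element of SU(2) turns its solution into a linear torus. In the rigidity argument the
    coefficient of the second fundamental form scales by the cube of [r]. This makes [r] constant
    unless the coefficient is zero, which happens only at [al = J = 0], so that this point is
    recognised directly. In the classification, periodicity gives the speed [nu] a positive lower
    bound; without such a bound the new time might cover only part of the line. The function [gamma]
    must vanish because a strictly concave function on the line cannot stay positive. *)

Local Notation Re := complex.Re.
Local Notation Im := complex.Im.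

(** * Directional calculus and C^k maps *)

Section DirectionalCalculus.
Context {R : realType} {V : normedModType R}.
Implicit Types (f g : V -> R) (p v : V).

(** Both difference quotients coincide. Directional derivatives are thereby reduced to one real
    variable, where the chain rule is available. *)
Lemma is_derive_line (f : V -> R) p v d :
  is_derive p v f d <-> is_derive (0 : R) 1 (fun t : R => f (t *: v + p)) d.
Proof.
have E : (fun h : R => h^-1 *: ((f \o shift p) (h *: v) - f p)) =
   (fun h : R => h^-1 *: (((fun t : R => f (t *: v + p)) \o shift 0) (h *: 1)
       - (fun t : R => f (t *: v + p)) 0)).
  by apply/funext => h /=; rewrite addr0 scale0r add0r [_%:A]mulr1.
split=> -[D1 D2]; split.
- by move: D1; rewrite /derivable E.
- by rewrite -D2 /derive E.
- by rewrite /derivable E.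
- by rewrite -D2 /derive E.
Qed.

Lemma is_derive_comp1 (h : V -> R) (g : R -> R) p v (h' g' : R) :
  is_derive p v h h' -> is_derive (h p) 1 g g' ->
  is_derive p v (fun x => g (h x)) (g' * h').
Proof.
move=> /is_derive_line Hh Hg; apply/is_derive_line.
by apply: (@is_derive1_comp _ g (fun t : R => h (t *: v + p)));
  rewrite /= ?scale0r ?add0r.
Qed.

Lemma is_deriveDf f g p v a b : is_derive p v f a -> is_derive p v g b ->
  is_derive p v (fun x => f x + g x) (a + b).
Proof. by move=> Hf Hg; exact: is_deriveD. Qed.

Lemma is_deriveMf f g p v a b : is_derive p v f a -> is_derive p v g b ->
  is_derive p v (fun x => f x * g x) (f p * b + g p * a).
Proof. by move=> Hf Hg; exact: is_deriveM. Qed.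

Lemma is_deriveNf f p v a : is_derive p v f a ->
  is_derive p v (fun x => - f x) (- a).
Proof. by move=> Hf; exact: is_deriveN. Qed.

Lemma is_deriveZf (c : R) f p v (a : R) : is_derive p v f a ->
  is_derive p v (fun x => c * f x) (c * a).
Proof.
move=> H; have := is_deriveMf (is_derive_cst c p v) H.
by rewrite /= mulr0 addr0.
Qed.

Lemma is_derive_unique f p v a b : is_derive p v f a -> is_derive p v f b ->
  a = b.
Proof. by move=> [_ <-] [_ <-]. Qed.

Lemma is_derive_ext f g p v a b : f =1 g -> a = b -> is_derive p v f a ->
  is_derive p v g b.
Proof. by move=> /funext -> ->. Qed.

End DirectionalCalculus.

Section CkCalculus.
Context {R : realType} {V : normedModType R}.
Implicit Types (f g : V -> R).

Lemma Ck_continuous (W : normedModType R) k (f : V -> W) : is_Ck k f -> continuous f.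
Proof. by case: k => [|k] []. Qed.

Lemma Ck_pred (W : normedModType R) k (f : V -> W) : is_Ck k.+1 f -> is_Ck k f.
Proof.
elim: k f => [|k IH] f [cf H]; split => // v.
have [H1 H2] := H v; split => //; exact: IH.
Qed.

Lemma CkS_derive k f : continuous f ->
  (forall v, exists2 g, is_Ck k g & forall x, is_derive x v f (g x)) ->
  is_Ck k.+1 f.
Proof.
move=> cf H; split=> // v; have [g Hg fg] := H v.
have -> : 'D_v f = g by apply/funext => x; have [_ ->] := fg x.
by split=> // x; have [] := fg x.
Qed.

Lemma CkS_inv k f v : is_Ck k.+1 f ->
  (forall x, is_derive x v f ('D_v f x)) /\ is_Ck k ('D_v f).
Proof. by move=> [cf /(_ v)[H1 H2]]; split => // x; exact: derivableP. Qed.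

Lemma Ck_cst k (W : normedModType R) (c : W) : is_Ck k (cst c : V -> W).
Proof.
elim: k c => [|k IH] c; split => //; try exact: cst_continuous.
move=> v; split; first by move=> x; exact: derivable_cst.
have -> : 'D_v (cst c : V -> W) = cst 0 by apply/funext => x; rewrite derive_cst.
exact: IH.
Qed.

Lemma Ck_add k f g : is_Ck k f -> is_Ck k g -> is_Ck k (fun x => f x + g x).
Proof.
elim: k f g => [|k IH] f g Hf Hg.
  split=> // x; apply: continuousD; exact: (Ck_continuous (k := 0)).
apply: CkS_derive.
  move=> x; apply: continuousD; exact: (Ck_continuous (k := k.+1)).
move=> v; have [Df Cf] := CkS_inv v Hf; have [Dg Cg] := CkS_inv v Hg.
exists (fun x => 'D_v f x + 'D_v g x); first exact: IH.
by move=> x; exact: is_deriveDf.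
Qed.

Lemma Ck_mul k f g : is_Ck k f -> is_Ck k g -> is_Ck k (fun x => f x * g x).
Proof.
elim: k f g => [|k IH] f g Hf Hg.
  split=> // x; apply: continuousM; exact: (Ck_continuous (k := 0)).
apply: CkS_derive.
  move=> x; apply: continuousM; exact: (Ck_continuous (k := k.+1)).
move=> v; have [Df Cf] := CkS_inv v Hf; have [Dg Cg] := CkS_inv v Hg.
exists (fun x => f x * 'D_v g x + g x * 'D_v f x).
  by apply: Ck_add; apply: IH => //; exact: Ck_pred.
by move=> x; exact: is_deriveMf.
Qed.

Lemma Ck_scale k c f : is_Ck k f -> is_Ck k (fun x => c * f x).
Proof. by move=> Hf; apply: Ck_mul => //; exact: Ck_cst. Qed.

Lemma Ck_opp k f : is_Ck k f -> is_Ck k (fun x => - f x).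
Proof.
move=> Hf; rewrite (_ : (fun _ => _) = (fun x => -1 * f x)).
  exact: Ck_scale.
by apply/funext => x; rewrite mulN1r.
Qed.

Lemma Ck_sub k f g : is_Ck k f -> is_Ck k g -> is_Ck k (fun x => f x - g x).
Proof. by move=> Hf Hg; apply: Ck_add => //; exact: Ck_opp. Qed.

(** The derivative [- f' / f ^ 2] is again built from [1 / f], so the induction runs on [k] with [f]
    fixed. *)
Lemma Ck_inv k f : (forall x, f x != 0) -> is_Ck k f ->
  is_Ck k (fun x => (f x)^-1).
Proof.
move=> f0; elim: k => [|k IH] Hf.
  split=> // x; apply: continuousV => //; exact: (Ck_continuous (k := 0)).
apply: CkS_derive.
  move=> x; apply: continuousV => //; exact: (Ck_continuous (k := k.+1)).
move=> v; have [Df Cf] := CkS_inv v Hf.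
exists (fun x => - ((f x)^-1 * (f x)^-1 * 'D_v f x)).
  apply: Ck_opp; apply: Ck_mul => //.
  by apply: Ck_mul; apply: IH; exact: Ck_pred.
move=> x; have D := is_derive_comp1 (Df x)
  (@is_deriveV R id (f x) 1 1 (f0 x) (is_derive_id _ _)).
apply: (is_derive_ext _ _ D).
  by [].
by rewrite -[_%:A]/(_ * _) mulr1 expr2 invfM mulNr.
Qed.

End CkCalculus.

Section CkMore.
Context {R : realType} {V : normedModType R}.

Lemma Ck_comp1 k (h : V -> R) (g : R -> R) : is_Ck k h -> is_Ck k g ->
  is_Ck k (fun x => g (h x)).
Proof.
have cont j (h1 : V -> R) (g1 : R -> R) : is_Ck j h1 -> is_Ck j g1 ->
    continuous (fun x => g1 (h1 x)).
  move=> H1 H2 x; have c1 := Ck_continuous H1 (x := x).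
  have c2 := Ck_continuous H2 (x := h1 x).
  exact: (continuous_comp c1 c2).
elim: k h g => [|k IH] h g Hh Hg; first by split => //; exact: (cont _ _ _ Hh Hg).
apply: CkS_derive; first exact: (cont _ _ _ Hh Hg).
move=> v; have [Dh Ch] := CkS_inv v Hh; have [Dg Cg] := CkS_inv (1 : R) Hg.
exists (fun x => 'D_1 g (h x) * 'D_v h x).
  by apply: Ck_mul => //; exact: (IH _ _ (Ck_pred Hh) Cg).
by move=> x; exact: is_derive_comp1.
Qed.

Lemma Ck_pair k (f g : V -> R) : is_Ck k f -> is_Ck k g ->
  is_Ck k (fun x => (f x, g x)).
Proof.
have cont j (f1 g1 : V -> R) : is_Ck j f1 -> is_Ck j g1 ->
    continuous (fun x => (f1 x, g1 x)).
  move=> H1 H2 x; have c1 := Ck_continuous H1 (x := x).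
  have c2 := Ck_continuous H2 (x := x).
  exact: (cvg_pair c1 c2).
elim: k f g => [|k IH] f g Hf Hg; first by split => //; exact: (cont _ _ _ Hf Hg).
split; first exact: (cont _ _ _ Hf Hg).
move=> v; have [Df Cf] := CkS_inv v Hf; have [Dg Cg] := CkS_inv v Hg.
have key x : (fun h : R => h^-1 *: (((fun x => (f x, g x)) \o shift x) (h *: v) - (f x, g x)))
    @ 0^' --> (('D_v f x, 'D_v g x) : (R * R)%type).
  have [df _] := Df x; have [dg _] := Dg x.
  exact: (cvg_pair df dg).
split; first by move=> x; apply/cvg_ex; eexists; exact: key.
rewrite (_ : 'D_v _ = fun x => ('D_v f x, 'D_v g x)); first exact: IH.
by apply/funext => x; apply: cvg_lim => //; exact: key.
Qed.

End CkMore.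

(** * Quadratic differential equations *)

Section RealLine.
Context {R : realType}.
Implicit Types (f g : R -> R) (a b t : R).

Lemma is_derive_near f g t d (e : R) : 0 < e -> (forall s, `|s - t| < e -> f s = g s) ->
  is_derive t 1 g d -> is_derive t 1 f d.
Proof.
move=> e0 fg Hg; apply: (@near_eq_is_derive _ _ _ g) => //.
apply/nbhs_ballP; exists e => // s; rewrite /ball /= distrC => ts.
by rewrite fg.
Qed.

(** Meant for the limit of the Picard iterates, where a quadratic bound on the remainder is what the
    estimates deliver. *)
Lemma is_derive_quad f t d (e M : R) : 0 < e ->
  (forall h, `|h| < e -> `|f (t + h) - f t - h * d| <= M * h ^+ 2) ->
  is_derive t 1 f d.
Proof.
move=> e0 H.
suff key : (fun h : R => h^-1 *: ((f \o shift t) (h *: 1) - f t)) @ 0^' --> d.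
  by split; [apply/cvg_ex; exists d | exact/cvg_lim].
(* The hypothesis at [h = e / 2] forces the sign of [M]. *)
have M0 : 0 <= M.
  have := H (e / 2); rewrite ger0_norm; last by rewrite divr_ge0 ?ltW.
  rewrite ltr_pdivrMr // mulr_natr mulr2n ltrDl => /(_ e0) /(le_trans (normr_ge0 _)).
  by rewrite pmulr_lge0 // exprn_gt0 // divr_gt0.
apply/cvgrPdist_le => eps eps0; near=> h.
have h0 : h != 0 by near: h; exact: nbhs_dnbhs_neq.
rewrite distrC /= [h%:A]mulr1 (addrC h).
have -> : h^-1 *: (f (t + h) - f t) - d = h^-1 * (f (t + h) - f t - h * d).
  by rewrite mulrBr mulKf.
rewrite normrM normfV -ler_pdivlMl ?invr_gt0 ?normr_gt0 // invrK.
apply: (le_trans (H _ _)).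
  near: h; apply: dnbhs0_lt; exact: e0.
rewrite -real_normK ?num_real // expr2 mulrCA ler_wpM2l //.
have : `|h| < eps / (M + 1).
  by near: h; apply: dnbhs0_lt; rewrite divr_gt0 // ltr_pwDr.
rewrite ltr_pdivlMr ?ltr_pwDr // mulrDr mulr1 => hM.
rewrite mulrC; apply: ltW; apply: le_lt_trans hM; rewrite lerDl //.
Unshelve. all: by end_near. Qed.

Lemma is_derive_continuous f d : (forall t, is_derive t 1 f (d t)) -> continuous f.
Proof.
move=> H t; apply/differentiable_continuous; rewrite -derivable1_diffP.
by have [] := H t.
Qed.

(** The interval is written with [min] and [max] so that forward and backward times are treated
    together. *)
Lemma mvt_norm_le f (d : R -> R) a b (M : R) :
  (forall s, Num.min a b <= s <= Num.max a b -> is_derive s 1 f (d s)) ->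
  (forall s, Num.min a b <= s <= Num.max a b -> `|d s| <= M) ->
  `|f b - f a| <= M * `|b - a|.
Proof.
wlog ab : a b / a <= b.
  move=> W Hd HM; have [ab|/ltW ba] := leP a b; first exact: W.
  by rewrite distrC (distrC b); apply: W => // s; rewrite minC maxC; [exact: Hd|exact: HM].
move: ab; rewrite le_eqVlt => /predU1P[->|ab].
  by rewrite !subrr normr0 mulr0.
have [-> ->] : Num.min a b = a /\ Num.max a b = b.
  by split; [apply: min_l|apply: max_r]; exact: ltW.
move=> Hd HM.
have Hd' x : x \in `]a, b[ -> is_derive x 1 f (d x).
  by rewrite in_itv /= => /andP[x1 x2]; apply: Hd; rewrite !ltW.
have cf : {within `[a, b], continuous f}.
  apply: derivable_within_continuous => x; rewrite in_itv /= => xab.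
  by have [] := Hd x xab.
have [c cab ->] := MVT ab Hd' cf.
move: cab; rewrite in_itv /= => /andP[c1 c2].
by rewrite normrM ler_wpM2r // HM // !ltW.
Qed.

Lemma is_derive0_const f a b :
  (forall s, Num.min a b <= s <= Num.max a b -> is_derive s 1 f 0) -> f b = f a.
Proof.
move=> H; apply/eqP; rewrite -subr_eq0 -normr_le0.
have := @mvt_norm_le f (fun _ => 0) a b 0 H.
by rewrite mul0r; apply => s _; rewrite normr0.
Qed.

Lemma le_geom_err a b C : (forall n, a <= b + C * 2^-1 ^+ n) -> a <= b.
Proof.
move=> H; have cv : (fun n => b + C * 2^-1 ^+ n) @ \oo --> b + C * 0.
  apply: cvgD; first exact: cvg_cst.
  apply: cvgM; first exact: cvg_cst.
  by apply: cvg_expr; rewrite ger0_norm ?invr_ge0 // invf_lt1 // ltr1n.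
rewrite mulr0 addr0 in cv.
by apply: (cvgr_to_ge cv); near=> n; exact: H.
Unshelve. all: by end_near. Qed.

(** With [w n] the sum of all increments allowed from [n] on, the intervals [[u n - w n, u n + w n]]
    are nested; the limit is the supremum of their left ends. *)
Lemma geom_cauchy_lim (u : nat -> R) :
  (forall n, `|u n.+1 - u n| <= 2^-1 ^+ n) ->
  exists l, forall n, `|l - u n| <= 2 * 2^-1 ^+ n.
Proof.
move=> H.
pose w n : R := 2 * 2^-1 ^+ n.
have wS n : w n = w n.+1 + 2^-1 ^+ n by rewrite /w exprS; lra.
have w0 n : 0 <= w n by rewrite mulr_ge0 // exprn_ge0 // invr_ge0.
have aS n k : u n - w n <= u (n + k)%N - w (n + k)%N.
  elim: k => [|k]; first by rewrite addn0.
  move/le_trans; apply; rewrite addnS (wS (n + k)%N).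
  by have := H (n + k)%N; rewrite ler_norml => /andP[? ?]; lra.
have bS n k : u (n + k)%N + w (n + k)%N <= u n + w n.
  elim: k => [|k IH]; first by rewrite addn0.
  apply: le_trans IH; rewrite addnS (wS (n + k)%N).
  by have := H (n + k)%N; rewrite ler_norml => /andP[? ?]; lra.
have ab n m : u n - w n <= u m + w m.
  have := aS n m; have := bS m n; rewrite addnC.
  by have := w0 (n + m)%N; lra.
pose A := range (fun n => u n - w n).
have hA m : ubound A (u m + w m) by move=> _ [n _ <-].
have sA : has_sup A by split; [exists (u 0%N - w 0%N); exists 0%N | exists (u 0%N + w 0%N)].
exists (sup A) => n.
have h1 : u n - w n <= sup A by apply: ub_le_sup; [exact: (proj2 sA)|exists n].
have h2 : sup A <= u n + w n by apply: ge_sup; [exact: (proj1 sA)|exact: hA].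
by rewrite -/(w n) ler_norml; apply/andP; split; lra.
Qed.

End RealLine.

Lemma between_trans (R : realDomainType) (c t r s : R) :
  Num.min c t <= r <= Num.max c t -> Num.min c r <= s <= Num.max c r ->
  Num.min c t <= s <= Num.max c t.
Proof.
by case: (leP c t) => ct; case: (leP c r) => cr /andP[? ?] /andP[? ?];
  apply/andP; split; lra.
Qed.

Lemma between_dist (R : realDomainType) (c t r : R) :
  Num.min c t <= r <= Num.max c t -> `|r - c| <= `|t - c|.
Proof.
by case: (leP c t) => ct /andP[? ?]; [rewrite !ger0_norm|rewrite !ler0_norm]; lra.
Qed.

Section QuadraticODE.
Context {R : realType} {I : finType}.
(* The i-th component of the field is the sum of the [m * x_j * x_k] over the triples
   [(m, j, k)] in [T i]. *)
Variable T : I -> seq (R * I * I).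

Definition qfield (x : I -> R) (i : I) : R :=
  \sum_(m <- T i) m.1.1 * (x m.1.2 * x m.2).

(** A bound and a Lipschitz constant of the field on the cube [|x_j| <= 2]: a product of two
    coordinates is at most [4] there and varies by at most [4 e] when each coordinate varies by [e].
    The summand [1] keeps it positive for the zero field. *)
Definition qbound : R := 4 * (1 + \sum_i \sum_(m <- T i) `|m.1.1|).

Let qbound_i i : 4 * \sum_(m <- T i) `|m.1.1| <= qbound.
Proof.
rewrite ler_wpM2l // (bigD1 i) //= addrCA lerDl addr_ge0 //.
by apply: sumr_ge0 => j _; apply: sumr_ge0.
Qed.

Lemma qbound_gt0 : 0 < qbound.
Proof.
rewrite mulr_gt0 // ltr_wpDr //.
by apply: sumr_ge0 => j _; apply: sumr_ge0.
Qed.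

Lemma qfield_lip (x y : I -> R) e i : 0 <= e -> (forall j, `|x j| <= 2) ->
  (forall j, `|y j| <= 2) -> (forall j, `|x j - y j| <= e) ->
  `|qfield x i - qfield y i| <= qbound * e.
Proof.
move=> e0 x2 y2 xy.
apply: (@le_trans _ _ ((4 * \sum_(m <- T i) `|m.1.1|) * e)); last first.
  by rewrite ler_wpM2r.
rewrite -sumrB -mulrA mulr_suml mulr_sumr.
apply: (le_trans (ler_norm_sum _ _ _)); apply: ler_sum => -[[c j] k] _ /=.
rewrite -mulrBr normrM mulrCA ler_wpM2l //.
have -> : x j * x k - y j * y k = x j * (x k - y k) + y k * (x j - y j) by ring.
apply: (le_trans (ler_normD _ _)); rewrite !normrM.
have -> : 4 * e = 2 * e + 2 * e by ring.
by apply: lerD; apply: ler_pM.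
Qed.

Lemma qfield_bound (x : I -> R) i : (forall j, `|x j| <= 2) ->
  `|qfield x i| <= qbound.
Proof.
move=> x2; apply: le_trans (qbound_i i).
rewrite mulr_sumr; apply: (le_trans (ler_norm_sum _ _ _)).
apply: ler_sum => -[[c j] k] _ /=.
rewrite normrM mulrC ler_wpM2r // normrM (_ : 4 = 2 * 2 :> R); last by ring.
by apply: ler_pM.
Qed.

Definition solves (a b : R) (y : R -> I -> R) : Prop :=
  forall t, a < t < b -> forall i, is_derive t 1 (y^~ i) (qfield (y t) i).

(** Chosen so that [qbound * qstep = 1 / 2]: one integration over this time halves distances, and a
    curve starting in the unit cube moves by at most [1 / 2]. *)
Definition qstep : R := (2 * qbound)^-1.

Lemma qstep_gt0 : 0 < qstep.
Proof. by rewrite invr_gt0 mulr_gt0 // qbound_gt0. Qed.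

(** Two bounded solutions differ by at most [2]; each use of the Lipschitz bound over a time [qstep]
    halves this estimate. *)
Lemma solves_eq_near (a b : R) (y1 y2 : R -> I -> R) (c t : R) :
  solves a b y1 -> solves a b y2 ->
  (forall s i, a < s < b -> `|y1 s i| <= 1) ->
  (forall s i, a < s < b -> `|y2 s i| <= 1) ->
  a < c < b -> a < t < b -> y1 c = y2 c -> `|t - c| <= qstep -> y1 t = y2 t.
Proof.
move=> S1 S2 B1 B2 cab tab E tc.
have tob r : Num.min c t <= r <= Num.max c t -> a < r < b.
  move: cab tab => /andP[? ?] /andP[? ?]; rewrite ge_min le_max.
  by move=> /andP[/orP[?|?] /orP[?|?]]; apply/andP; split; lra.
have key n r : Num.min c t <= r <= Num.max c t ->
    forall i, `|y1 r i - y2 r i| <= 2 * 2^-1 ^+ n.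
  elim: n r => [|n IH] r rct i.
    rewrite expr0 mulr1 (le_trans (ler_normB _ _)) // -[2]/(1+1) lerD //.
      exact/B1/tob.
    exact/B2/tob.
  have sub s : Num.min c r <= s <= Num.max c r -> Num.min c t <= s <= Num.max c t.
    exact: between_trans rct.
  have Hd s : Num.min c r <= s <= Num.max c r ->
    is_derive s 1 (fun s => y1 s i - y2 s i) (qfield (y1 s) i - qfield (y2 s) i).
    move=> /sub/tob sab; apply: is_deriveDf; first exact: S1.
    apply: is_deriveNf; exact: S2.
  have HM s : Num.min c r <= s <= Num.max c r ->
     `|qfield (y1 s) i - qfield (y2 s) i| <= qbound * (2 * 2^-1 ^+ n).
    move=> /sub srt; have sab := tob _ srt; apply: qfield_lip.
    - by rewrite mulr_ge0 // exprn_ge0 // invr_ge0.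
    - by move=> j; apply: (le_trans (B1 _ _ sab)); rewrite ler1n.
    - by move=> j; apply: (le_trans (B2 _ _ sab)); rewrite ler1n.
    - by move=> j; exact: IH.
  have := mvt_norm_le Hd HM; rewrite {1}E subrr subr0 => /le_trans; apply.
  have rc : `|r - c| <= qstep.
    exact: le_trans (between_dist rct) tc.
  apply: (@le_trans _ _ (qbound * (2 * 2^-1 ^+ n) * qstep)).
    rewrite ler_wpM2l // mulr_ge0 ?(ltW qbound_gt0) //.
  rewrite /qstep exprS; have := qbound_gt0; move: qbound (2^-1 ^+ n) => K u K0.
  by rewrite le_eqVlt; apply/orP; left; apply/eqP; field; rewrite gt_eqF.
apply/funext => i; apply/eqP; rewrite -subr_eq0 -normr_le0.
apply: (@le_geom_err _ _ 0 2) => n; rewrite add0r; apply: key.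
by rewrite ge_min le_max !lexx !orbT.
Qed.

Lemma solves_unique (a b : R) (y1 y2 : R -> I -> R) (c : R) :
  solves a b y1 -> solves a b y2 ->
  (forall s i, a < s < b -> `|y1 s i| <= 1) ->
  (forall s i, a < s < b -> `|y2 s i| <= 1) ->
  a < c < b -> y1 c = y2 c -> forall t, a < t < b -> y1 t = y2 t.
Proof.
move=> S1 S2 B1 B2 cab E.
suff H (n : nat) t : a < t < b -> `|t - c| <= n%:R * qstep -> y1 t = y2 t.
  move=> t tab; apply: (H (Num.truncn (`|t - c| / qstep)).+1) => //.
  rewrite -ler_pdivrMr ?qstep_gt0 //; apply/ltW.
  exact: truncnS_gt.
elim: n t => [|n IH] t tab.
  by rewrite mul0r normr_le0 subr_eq0 => /eqP ->.
(* A division of the way from [c] to [t]: [t'] is within [n] steps of [c] and within one step of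
   [t]. *)
move=> tc; pose t' := c + (t - c) * (n%:R / n.+1%:R).
have n1 : 0 < n.+1%:R :> R by rewrite ltr0n.
have n0 : 0 <= n%:R :> R by rewrite ler0n.
have nn : n.+1%:R = 1 + n%:R :> R by rewrite -natr1 addrC.
have q01 : 0 <= (n%:R / n.+1%:R : R) < 1.
  by rewrite divr_ge0 ?(ltW n1) //= ltr_pdivrMr // mul1r nn ltrDr.
have t'ab : a < t' < b.
  rewrite /t'; move: q01 cab tab; set q := _ / _ => /andP[q0 q1] /andP[? ?] /andP[? ?].
  by apply/andP; split; nra.
apply: (solves_eq_near S1 S2 B1 B2 t'ab tab).
  apply: IH => //; rewrite /t' addrC addKr normrM (ger0_norm (proj1 (andP q01))).
  rewrite mulrA ler_pdivrMr //; apply: le_trans (ler_wpM2r n0 tc) _.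
  by rewrite le_eqVlt; apply/orP; left; apply/eqP; ring.
rewrite /t' (_ : t - _ = (t - c) / n.+1%:R); last first.
  by rewrite nn; field; rewrite -nn gt_eqF.
by rewrite normrM (ger0_norm (x := n.+1%:R^-1)) ?invr_ge0 ?(ltW n1) // ler_pdivrMr // mulrC.
Qed.

Lemma solves_shift (a b c : R) (y : R -> I -> R) : solves a b y ->
  solves (a + c) (b + c) (fun t => y (t - c)).
Proof.
move=> S t /andP[t1 t2] i.
have -> : qfield (y (t - c)) i = qfield (y (t - c)) i * 1 by rewrite mulr1.
apply: (is_derive_comp1 (h := fun t => t - c) (g := fun s => y s i)).
  by apply: is_derive_shift.
by apply: S; apply/andP; split; lra.
Qed.

Lemma solves_sub (a b a' b' : R) y : a <= a' -> b' <= b -> solves a b y ->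
  solves a' b' y.
Proof. by move=> ? ? S t /andP[? ?]; apply: S; apply/andP; split; lra. Qed.

Definition poly_prim (q : {poly R}) : {poly R} :=
  \poly_(k < (size q).+1) (if k is j.+1 then q`_j / j.+1%:R else 0).

Lemma deriv_poly_prim q : (poly_prim q)^`()%R = q.
Proof.
apply/polyP => k; rewrite coef_deriv coef_poly /= ltnS.
have [h|h] := ltnP k (size q); first by rewrite -[LHS]mulr_natr divfK // pnatr_eq0.
by rewrite mul0rn nth_default.
Qed.

Lemma poly_prim0 q : (poly_prim q).[0] = 0.
Proof. by rewrite horner_coef0 coef_poly. Qed.

(* For a quadratic field the Picard iterates are polynomials in time. *)
Fixpoint picard (x0 : I -> R) (n : nat) (i : I) : {poly R} :=
  (x0 i)%:P +
  (if n is m.+1 then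
     poly_prim (\sum_(m' <- T i) m'.1.1 *: (picard x0 m m'.1.2 * picard x0 m m'.2))
   else 0).

Let P x0 n t i := (picard x0 n i).[t].

Let P0 x0 n i : P x0 n 0 i = x0 i.
Proof. by case: n => [|n]; rewrite /P /= hornerD hornerC ?poly_prim0 ?horner0 addr0. Qed.

Let P_derive x0 n (t : R) i : is_derive t 1 (fun s => P x0 n.+1 s i) (qfield (P x0 n t) i).
Proof.
have := is_derive_poly (picard x0 n.+1 i) t.
rewrite /= derivD derivC add0r deriv_poly_prim => H.
apply: is_derive_eq => //; rewrite horner_sum; apply: eq_bigr => m _.
by rewrite hornerZ hornerM.
Qed.

(** By induction the previous iterate stays in the cube of radius [2], so the speed of the next one
    is at most [qbound]. *)
Let step_near x0 n (t s : R) i : (forall j, `|x0 j| <= 1) -> `|t| <= qstep ->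
  Num.min 0 t <= s <= Num.max 0 t -> `|P x0 n s i - x0 i| <= 1.
Proof.
move=> x01 tq; elim: n s i => [|n IH] s i st.
  by rewrite /P /= addr0 hornerC subrr normr0.
rewrite -(P0 x0 n.+1 i).
have HM r : Num.min 0 s <= r <= Num.max 0 s -> `|qfield (P x0 n r) i| <= qbound.
  move=> /(between_trans st) rt; apply: qfield_bound => j.
  have -> : P x0 n r j = (P x0 n r j - x0 j) + x0 j by rewrite subrK.
  by rewrite (le_trans (ler_normD _ _)) // -[2]/(1+1) lerD // IH.
apply: (le_trans (mvt_norm_le (fun r _ => P_derive x0 n r i) HM)).
apply: (@le_trans _ _ (qbound * qstep)).
  rewrite ler_wpM2l ?(ltW qbound_gt0) //; apply: le_trans tq.
  by have := between_dist st; rewrite !subr0.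
rewrite /qstep; have := qbound_gt0; move: qbound => K K0.
by rewrite invfM mulrCA mulfV ?gt_eqF // mulr1 invf_le1 // ler1n.
Qed.

Let step_bound x0 n (t s : R) i : (forall j, `|x0 j| <= 1) -> `|t| <= qstep ->
  Num.min 0 t <= s <= Num.max 0 t -> `|P x0 n s i| <= 2.
Proof.
move=> x01 tq st; have -> : P x0 n s i = (P x0 n s i - x0 i) + x0 i by rewrite subrK.
by rewrite (le_trans (ler_normD _ _)) // -[2]/(1+1) lerD //; exact: step_near st.
Qed.

Let step_contr x0 n (t : R) i : (forall j, `|x0 j| <= 1) -> `|t| <= qstep ->
  `|P x0 n.+1 t i - P x0 n t i| <= 2^-1 ^+ n.
Proof.
move=> x01; elim: n t i => [|n IH] t i tq.
  rewrite {2}/P /= addr0 hornerC expr0; apply: (step_near _ _ x01 tq).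
  by rewrite ge_min le_max !lexx !orbT.
pose D r := qfield (P x0 n.+1 r) i - qfield (P x0 n r) i.
have Hd r : Num.min 0 t <= r <= Num.max 0 t ->
    is_derive r 1 (fun s => P x0 n.+2 s i - P x0 n.+1 s i) (D r).
  move=> _; apply: is_deriveDf; first exact: P_derive.
  by apply: is_deriveNf; exact: P_derive.
have HM r : Num.min 0 t <= r <= Num.max 0 t -> `|D r| <= qbound * 2^-1 ^+ n.
  move=> rt; apply: qfield_lip => [|j|j|j].
  - by rewrite exprn_ge0 // invr_ge0.
  - exact: step_bound rt.
  - exact: step_bound rt.
  - by apply: IH; apply: le_trans tq; have := between_dist rt; rewrite !subr0.
have := mvt_norm_le Hd HM; rewrite !P0 subrr !subr0 => /le_trans; apply.
apply: (@le_trans _ _ (qbound * 2^-1 ^+ n * qstep)).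
  by rewrite ler_wpM2l // mulr_ge0 ?(ltW qbound_gt0) // exprn_ge0 // invr_ge0.
rewrite /qstep exprS; have := qbound_gt0; move: qbound (2^-1 ^+ n) => K u K0.
by rewrite le_eqVlt; apply/orP; left; apply/eqP; field; rewrite gt_eqF.
Qed.

(** The limit is differentiated without an integral equation: the mean value inequality bounds the
    remainder of each iterate along its tangent, and the bound passes to the limit. *)
Lemma picard_local (x0 : I -> R) : (forall j, `|x0 j| <= 1) ->
  exists2 y, solves (- qstep) qstep y & y 0 = x0.
Proof.
move=> x01.
(* Outside the step interval the value is a dummy [0], so that the limit can be chosen for every
   [t]. *)
have Hl t i : exists l, `|t| <= qstep -> forall n, `|l - P x0 n t i| <= 2 * 2^-1 ^+ n.
  have [tq|tq] := leP `|t| qstep; last by exists 0.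
  have [l Hl] := geom_cauchy_lim (fun n => step_contr n i x01 tq).
  by exists l.
pose y t i := projT1 (cid (Hl t i)).
have Hy t i : `|t| <= qstep -> forall n, `|y t i - P x0 n t i| <= 2 * 2^-1 ^+ n.
  exact: (projT2 (cid (Hl t i))).
have q0 := qstep_gt0; have K0 := qbound_gt0.
have yP n t i : `|t| <= qstep -> `|P x0 n t i - y t i| <= 2 * 2^-1 ^+ n.
  by move=> tq; rewrite distrC; exact: Hy.
have Pb n t i : `|t| <= qstep -> `|P x0 n t i| <= 2.
  by move=> tq; apply: (step_bound _ _ x01 tq); rewrite ge_min le_max !lexx !orbT.
have yb t i : `|t| <= qstep -> `|y t i| <= 2.
  move=> tq; apply: (@le_geom_err _ _ _ 2) => n.
  rewrite -(subrK (P x0 n t i) (y t i)) (le_trans (ler_normD _ _)) // addrC.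
  by rewrite lerD // ?Pb // Hy.
have btw t s r : `|t| <= qstep -> `|s| <= qstep ->
    Num.min t s <= r <= Num.max t s -> `|r| <= qstep.
  rewrite !ler_norml; move: q0; move: qstep => q q0 /andP[? ?] /andP[? ?].
  by case: (leP t s) => ? /andP[? ?]; apply/andP; split; lra.
have Plip n t s i : `|t| <= qstep -> `|s| <= qstep ->
    `|P x0 n s i - P x0 n t i| <= qbound * `|s - t|.
  move=> tq sq; case: n => [|n].
    by rewrite /P /= !addr0 !hornerC subrr normr0 mulr_ge0 // ltW.
  apply: (mvt_norm_le (fun r _ => P_derive x0 n r i)) => r rts.
  by apply: qfield_bound => j; apply: Pb; exact: btw rts.
exists y; last first.
  apply/funext => i; apply/eqP; rewrite -subr_eq0 -normr_le0.
  apply: (@le_geom_err _ _ 0 2) => n; rewrite add0r -(P0 x0 n i).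
  by apply: Hy; rewrite normr0 ltW.
move=> t; rewrite -ltr_norml => tq i.
apply: (@is_derive_quad _ _ _ _ (qstep - `|t|) (qbound * qbound)).
  by rewrite subr_gt0.
move=> h; rewrite ltrBrDr => hq.
have thq : `|t + h| <= qstep.
  by rewrite (le_trans (ler_normD _ _)) // addrC ltW.
apply: (@le_geom_err _ _ _ (qbound * `|h| * 2 + 4)) => n.
(* The iterate minus the expected linear growth at [t]; its derivative is of order [h] up to an
   error of order [2^-n]. *)
pose g s := P x0 n.+1 s i - s * qfield (y t) i.
have Hd r : Num.min t (t + h) <= r <= Num.max t (t + h) ->
    is_derive r 1 g (qfield (P x0 n r) i - qfield (y t) i).
  move=> _; apply: is_deriveDf; first exact: P_derive.
  apply: is_deriveNf.
  have := is_deriveMf (is_derive_id r 1) (is_derive_cst (qfield (y t) i) r 1).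
  by rewrite /= mulr0 add0r mulr1.
have HM r : Num.min t (t + h) <= r <= Num.max t (t + h) ->
    `|qfield (P x0 n r) i - qfield (y t) i| <=
      qbound * (qbound * `|h| + 2 * 2^-1 ^+ n).
  move=> rt; have rq := btw _ _ _ (ltW tq) thq rt.
  apply: qfield_lip => [|j|j|j].
  - by rewrite addr_ge0 // mulr_ge0 ?(ltW K0) // exprn_ge0 // invr_ge0.
  - exact: Pb.
  - exact/yb/ltW.
  - rewrite -(subrK (P x0 n t j) (P x0 n r j)) -addrA.
    apply: (le_trans (ler_normD _ _)); apply: lerD; last exact/yP/ltW.
    apply: (le_trans (Plip n t r j (ltW tq) rq)); rewrite ler_wpM2l ?(ltW K0) //.
    by have := between_dist rt; rewrite [t + h - t]addrC addKr.
have := mvt_norm_le Hd HM; rewrite [t + h - t]addrC addKr /g => key.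
have -> : y (t + h) i - y t i - h * qfield (y t) i =
   (P x0 n.+1 (t + h) i - (t + h) * qfield (y t) i -
      (P x0 n.+1 t i - t * qfield (y t) i)) +
   ((y (t + h) i - P x0 n.+1 (t + h) i) + (P x0 n.+1 t i - y t i)) by ring.
apply: (le_trans (ler_normD _ _)).
have e1 := Hy _ i thq n.+1; have e2 := yP n.+1 _ i (ltW tq).
apply: (le_trans (lerD key (le_trans (ler_normD _ _) (lerD e1 e2)))).
rewrite -(real_normK (num_real h)) exprS.
have := exprn_ge0 n (ltac:(lra) : 0 <= 2^-1 :> R); move: (2^-1 ^+ n) => u u0.
have := normr_ge0 h; move: `|h| => k k0.
rewrite -subr_ge0.
have -> : qbound * qbound * k ^+ 2 + (qbound * k * 2 + 4) * u -
  (qbound * (qbound * k + 2 * u) * k + (2 * (2^-1 * u) + 2 * (2^-1 * u))) = 2 * u.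
  by field.
by rewrite mulr_ge0.
Qed.

Section Global.
Variable Inv : (I -> R) -> Prop.
Hypothesis Inv_le1 : forall x, Inv x -> forall i, `|x i| <= 1.
Hypothesis Inv_flow : forall (a b c : R) y, a < c < b -> solves a b y ->
  Inv (y c) -> forall t, a < t < b -> Inv (y t).

Lemma solves_local c x0 : Inv x0 ->
  exists2 y, solves (c - qstep) (c + qstep) y & y c = x0.
Proof.
move=> Ix; have [y Sy y0] := picard_local (Inv_le1 Ix).
exists (fun t => y (t - c)); last by rewrite subrr.
by have := solves_shift (c := c) Sy; rewrite addrC (addrC qstep).
Qed.

Lemma solves_unique_Inv (a b c : R) y1 y2 : a < c < b ->
  solves a b y1 -> solves a b y2 -> Inv (y1 c) -> y1 c = y2 c ->
  forall t, a < t < b -> y1 t = y2 t.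
Proof.
move=> cab S1 S2 Ic E; apply: (solves_unique S1 S2 _ _ cab E) => s i sab.
  exact/Inv_le1/(Inv_flow cab S1 Ic).
by apply/Inv_le1/(Inv_flow cab S2) => //; rewrite -E.
Qed.

Lemma solves_near (a b : R) y1 y2 t (e : R) : 0 < e ->
  (forall s, `|s - t| < e -> y1 s = y2 s) -> a < t < b ->
  solves a b y2 -> forall i, is_derive t 1 (y1^~ i) (qfield (y1 t) i).
Proof.
move=> e0 E tab S i; rewrite E ?subrr ?normr0 //.
apply: (is_derive_near e0 (g := fun s => y2 s i)); last exact: S.
by move=> s se; rewrite E.
Qed.

(** Restarting at distance [qstep / 2] before each end gains [qstep / 2] beyond it; uniqueness on
    the overlaps allows the three pieces to be glued. *)
Lemma solves_extend tau y : qstep <= tau -> solves (- tau) tau y -> Inv (y 0) ->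
  exists2 y', solves (- (tau + qstep / 2)) (tau + qstep / 2) y' & y' 0 = y 0.
Proof.
have q0 := qstep_gt0; set q := qstep in q0 * => qt Sy I0.
pose t1 := tau - q / 2.
have I0' : - tau < 0 < tau by apply/andP; split; lra.
have t10 : 0 < t1 by rewrite /t1; lra.
have b1 : - tau < t1 < tau by rewrite /t1; apply/andP; split; lra.
have b2 : - tau < - t1 < tau by rewrite /t1; apply/andP; split; lra.
have [yp Sp yp1] := solves_local t1 (Inv_flow I0' Sy I0 b1).
have [ym Sm ym1] := solves_local (- t1) (Inv_flow I0' Sy I0 b2).
rewrite -/q in Sp Sm.
pose y' t := if t1 <= t then yp t else if t <= - t1 then ym t else y t.
have Ep t : t1 - q < t < tau -> - tau < t < tau -> y t = yp t.
  move=> /andP[? ?] /andP[? ?].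
  have c1 : Num.max (t1 - q) (- tau) < t1 < tau.
    by rewrite /t1 gt_max -andbA; apply/and3P; split; lra.
  apply: (solves_unique_Inv c1).
  - by apply: solves_sub Sy; rewrite // le_max lexx orbT.
  - by apply: solves_sub Sp; rewrite /t1 ?le_max ?lexx //; lra.
  - exact: (Inv_flow I0' Sy I0 b1).
  - by rewrite yp1.
  - by rewrite gt_max -andbA; apply/and3P; split; lra.
have Em t : - tau < t < - t1 + q -> - tau < t < tau -> y t = ym t.
  move=> /andP[? ?] /andP[? ?].
  have c1 : - tau < - t1 < Num.min (- t1 + q) tau.
    by rewrite /t1 lt_min; apply/and3P; split; lra.
  apply: (solves_unique_Inv c1).
  - by apply: solves_sub Sy; rewrite // ge_min lexx orbT.
  - by apply: solves_sub Sm; rewrite /t1 ?ge_min ?lexx //; lra.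
  - exact: (Inv_flow I0' Sy I0 b2).
  - by rewrite ym1.
  - by rewrite lt_min; apply/and3P; split; lra.
have Ey t : - tau < t < tau -> y' t = y t.
  move=> tt; rewrite /y'; case: ifPn => [h|_].
    by rewrite Ep //; case/andP: tt => ? ?; apply/andP; split; lra.
  case: ifPn => // h; rewrite Em //.
  by case/andP: tt => ? ?; apply/andP; split; lra.
exists y'; last by rewrite Ey.
move=> t /andP[ta tb].
have [tt|] := boolP (- tau < t < tau).
  apply: (@solves_near (- tau) tau y' y t (Num.min (tau - t) (t + tau))) => //.
    by case/andP: tt => ? ?; rewrite lt_min; apply/andP; split; lra.
  move=> s; rewrite lt_min !ltr_norml => /andP[/andP[? ?] /andP[? ?]].
  by apply: Ey; apply/andP; split; lra.
rewrite negb_and -!leNgt => /orP[h|h].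
  apply: (@solves_near (- t1 - q) (- t1 + q) y' ym t (- t1 - t)) => //.
  - by rewrite /t1; lra.
  - move=> s; rewrite ltr_norml => /andP[? ?].
    rewrite /y' ifF; last by apply/negbTE; rewrite -ltNge; lra.
    by rewrite ifT //; lra.
  - by rewrite /t1; apply/andP; split; lra.
apply: (@solves_near (t1 - q) (t1 + q) y' yp t (t - t1)) => //.
- by rewrite /t1; lra.
- move=> s; rewrite ltr_norml => /andP[? ?].
  by rewrite /y' ifT //; lra.
- by rewrite /t1; apply/andP; split; lra.
Qed.

Lemma solves_global x0 : Inv x0 ->
  exists2 y : R -> I -> R,
    (forall (t : R) i, is_derive t 1 (y^~ i) (qfield (y t) i)) & y 0 = x0.
Proof.
move=> Ix; have q0 := qstep_gt0.
pose tau n : R := qstep + n%:R * (qstep / 2).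
have tau1 n : qstep <= tau n by rewrite lerDl mulr_ge0 // ltW // divr_gt0.
have Hn n : exists y, solves (- tau n) (tau n) y /\ y 0 = x0.
  elim: n => [|n [y [Sy y0]]].
    rewrite /tau mul0r addr0; have [y] := solves_local 0 Ix.
    by rewrite sub0r add0r => ? ?; exists y; split.
  have Iy : Inv (y 0) by rewrite y0.
  have [y' Sy' y0'] := solves_extend (tau1 n) Sy Iy.
  exists y'; rewrite y0' y0; split => //.
  suff -> : tau n.+1 = tau n + qstep / 2 by [].
  by rewrite /tau -natr1; ring.
have [Y HY] := choice Hn.
(* The margin [1] lets the branch chosen at [t] serve on a whole neighbourhood of [t]. *)
have big (t : R) : exists n, `|t| + 1 < tau n.
  exists (Num.truncn ((`|t| + 1) / (qstep / 2))).+1.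
  rewrite /tau ltr_wpDl ?(ltW q0) // -ltr_pdivrMr ?divr_gt0 //.
  exact: truncnS_gt.
have [N HN] := choice big.
have same n m (t : R) : `|t| < tau n -> `|t| < tau m -> Y n t = Y m t.
  move=> tn tm; have [Sn Yn] := HY n; have [Sm Ym] := HY m.
  pose r := Num.min (tau n) (tau m).
  have r0 : - r < 0 < r.
    by rewrite oppr_lt0 andbb lt_min !(lt_le_trans q0).
  apply: (solves_unique_Inv r0).
  - by apply: solves_sub Sn; rewrite ?lerN2 ge_min lexx.
  - by apply: solves_sub Sm; rewrite ?lerN2 ge_min lexx orbT.
  - by rewrite Yn.
  - by rewrite Yn Ym.
  - by rewrite -ltr_norml lt_min tn.
exists (fun t => Y (N t) t); last by have [] := HY (N 0).
move=> t; have [Sn _] := HY (N t).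
apply: (@solves_near (- tau (N t)) (tau (N t)) _ (Y (N t)) t 1) => //.
  move=> s st; apply: same.
    by apply: lt_trans (HN s); rewrite ltrDl.
  apply: lt_trans (HN t); rewrite -(subrK t s) addrC.
  by rewrite (le_lt_trans (ler_normD _ _)) // ltrD2l.
by rewrite -ltr_norml; apply: lt_trans (HN t); rewrite ltrDl.
Qed.

Lemma solution_unique (y1 y2 : R -> I -> R) c :
  (forall (t : R) i, is_derive t 1 (y1^~ i) (qfield (y1 t) i)) ->
  (forall (t : R) i, is_derive t 1 (y2^~ i) (qfield (y2 t) i)) ->
  Inv (y1 c) -> y1 c = y2 c -> forall t, y1 t = y2 t.
Proof.
move=> S1 S2 Ic E t; pose r := `|c| + `|t| + 1.
have rc : - r < c < r.
  by rewrite -ltr_norml /r; have := normr_ge0 t; lra.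
apply: (solves_unique_Inv rc _ _ Ic E); try by move=> s _ i.
by rewrite -ltr_norml /r; have := normr_ge0 c; lra.
Qed.

End Global.
End QuadraticODE.

(** * Primitives of continuous functions on the line *)

Section Primitive.
Context {R : realType}.

(** The integrals from [-n] are primitives on growing intervals; subtracting their value at [0]
    makes them agree on overlaps. *)
Lemma continuous_primitive (f : R -> R) : continuous f ->
  exists F : R -> R, forall t : R, is_derive t 1 F (f t).
Proof.
move=> cf.
have intf a b : lebesgue_measure.-integrable `[a, b] (EFin \o f).
  apply: continuous_compact_integrable; first exact: segment_compact.
  exact: continuous_subspaceT.
pose G n x := (\int[lebesgue_measure]_(t in [set` `[- n%:R, x]]) (f t))%R.
have HG (n : nat) (t : R) : `|t| < n%:R -> is_derive t 1 (G n) (f t).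
  rewrite ltr_norml => /andP[t1 t2].
  have [] := continuous_FTC1_closed t2 (intf (- n%:R) n%:R) t1 (cf t).
  by rewrite derive1E => d1 d2; split.
pose N (t : R) := (Num.truncn `|t|).+2.
have HN (t : R) : `|t| + 1 < (N t)%:R.
  by rewrite /N -natr1 ltrD2r; exact: truncnS_gt.
have HN' (t : R) : `|t| < (N t)%:R by apply: lt_trans (HN t); rewrite ltrDl.
have same n m (t : R) : `|t| < n%:R -> `|t| < m%:R -> G n t - G n 0 = G m t - G m 0.
  move=> tn tm.
  have H : G n t - G m t = G n 0 - G m 0.
    apply: (@is_derive0_const _ (fun t => G n t - G m t)) => s st.
    have sle : `|s| <= `|t| by have := between_dist st; rewrite !subr0.
    rewrite -(subrr (f s)); apply: is_deriveDf; first exact/HG/(le_lt_trans sle).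
    by apply: is_deriveNf; exact/HG/(le_lt_trans sle).
  by move: (G n t) (G n 0) (G m t) (G m 0) H => x y u v; lra.
exists (fun t => G (N t) t - G (N t) 0) => t.
apply: (is_derive_near ltr01 (g := fun s => G (N t) s - G (N t) 0)).
  move=> s st; apply: same => //; apply: lt_trans (HN t).
  by rewrite -(subrK t s) addrC (le_lt_trans (ler_normD _ _)) // ltrD2l.
rewrite -[f t]addr0; apply: is_deriveDf; first exact: HG.
Qed.

End Primitive.

(** * Smoothness of coordinates and of trigonometric functions *)

Section SmoothFunctions.
Context {R : realType}.

Lemma Ck_id k : is_Ck k (id : R -> R).
Proof.
case: k => [|k]; first by split => // x; exact: cvg_id.
apply: CkS_derive; first by move=> x; exact: cvg_id.
move=> v; exists (cst v); first exact: Ck_cst.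
by move=> x; exact: is_derive_id.
Qed.

Lemma is_derive_fst (p v : R * R) : is_derive p v fst v.1.
Proof.
apply/is_derive_line.
have -> : (fun t : R => (t *: v + p).1) = (fun t : R => t * v.1 + p.1) by [].
have := is_deriveDf (is_deriveMf (is_derive_id (0 : R) 1) (is_derive_cst v.1 (0 : R) 1))
  (is_derive_cst p.1 (0 : R) 1).
by rewrite mulr0 add0r addr0 mulr1.
Qed.

Lemma is_derive_snd (p v : R * R) : is_derive p v snd v.2.
Proof.
apply/is_derive_line.
have -> : (fun t : R => (t *: v + p).2) = (fun t : R => t * v.2 + p.2) by [].
have := is_deriveDf (is_deriveMf (is_derive_id (0 : R) 1) (is_derive_cst v.2 (0 : R) 1))
  (is_derive_cst p.2 (0 : R) 1).
by rewrite mulr0 add0r addr0 mulr1.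
Qed.

Lemma Ck_fst k : is_Ck k (fst : R * R -> R).
Proof.
have cf : continuous (fst : R * R -> R) by move=> x; exact: cvg_fst.
case: k => [|k]; first by split.
apply: CkS_derive => // v; exists (cst v.1); first exact: Ck_cst.
by move=> x; exact: is_derive_fst.
Qed.

Lemma Ck_snd k : is_Ck k (snd : R * R -> R).
Proof.
have cf : continuous (snd : R * R -> R) by move=> x; exact: cvg_snd.
case: k => [|k]; first by split.
apply: CkS_derive => // v; exists (cst v.2); first exact: Ck_cst.
by move=> x; exact: is_derive_snd.
Qed.

Lemma is_derive_along (f : R -> R) (t v d : R) : is_derive t 1 f d ->
  is_derive t v f (d * v).
Proof.
by move=> H; exact: (is_derive_comp1 (h := id) (is_derive_id t v) H).
Qed.

Lemma CkS_derive1 k (f d : R -> R) : (forall t : R, is_derive t 1 f (d t)) ->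
  is_Ck k d -> is_Ck k.+1 f.
Proof.
move=> H Hd; apply: CkS_derive; first exact: is_derive_continuous.
move=> v; exists (fun t => d t * v).
  by apply: Ck_mul => //; exact: Ck_cst.
by move=> x; exact: is_derive_along.
Qed.

Lemma Ck_cos_sin k : is_Ck k (@cos R) /\ is_Ck k (@sin R).
Proof.
elim: k => [|k [IHc IHs]].
  by split; split => //; [exact: continuous_cos|exact: continuous_sin].
split.
  by apply: (@CkS_derive1 _ _ (fun t => - sin t)) => //; exact: Ck_opp.
exact: (@CkS_derive1 _ _ cos).
Qed.

End SmoothFunctions.

(** * Exponentials of diagonalizable matrices *)

Section MatrixExponential.

(** The powers of [B] are combinations of the fixed rank-one projections [E j] with coefficients
    [d j ^+ k], so the matrix series converges as soon as the scalar ones do. *)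
Lemma expmx_diagonalizable (K : numFieldType) n (P Q : 'M[K]_n.+1) (d e : 'I_n.+1 -> K) :
  Q *m P = 1%:M ->
  (forall j eps, 0 < eps -> exists N, forall m, (N <= m)%N ->
     `|e j - \sum_(0 <= k < m) (k`!%:R)^-1 * d j ^+ k| < eps) ->
  expmx (P *m diag_mx (\row_j d j) *m Q) = P *m diag_mx (\row_j e j) *m Q.
Proof.
move=> QP He; set B := _ *m _ *m Q.
pose E j : 'M[K]_n.+1 := P *m delta_mx j j *m Q.
have diagE (f : 'I_n.+1 -> K) : P *m diag_mx (\row_j f j) *m Q = \sum_j f j *: E j.
  rewrite diag_mx_sum_delta mulmx_sumr mulmx_suml; apply: eq_bigr => j _.
  by rewrite mxE -scalemxAr -scalemxAl.
have BX k : B ^+ k = \sum_j d j ^+ k *: E j.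
  rewrite -(diagE (fun j => d j ^+ k)); elim: k => [|k IH].
    rewrite expr0 (_ : diag_mx _ = 1%:M) ?mulmx1; last first.
      by apply/matrixP => i j; rewrite !mxE.
    by have /mulmx1C -> := QP.
  rewrite exprS IH -[_ * _]/(_ *m _) /B !mulmxA -[_ *m Q *m P]mulmxA QP mulmx1.
  rewrite -[P *m _ *m diag_mx _]mulmxA mulmx_diag; congr (_ *m diag_mx _ *m _).
  by apply/rowP => j; rewrite !mxE exprS.
pose s j (m : nat) := \sum_(0 <= k < m) (k`!%:R)^-1 * d j ^+ k.
have serE : series (fun k : nat => (k`!%:R)^-1 *: B ^+ k) = fun m => \sum_j s j m *: E j.
  apply/funext => m; rewrite /series /= /s.
  under eq_bigr => k _ do rewrite BX scaler_sumr.
  rewrite exchange_big /=; apply: eq_bigr => j _.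
  by rewrite scaler_suml; apply: eq_bigr => k _; rewrite scalerA.
rewrite diagE /expmx serE; apply: cvg_lim => //.
apply: cvg_big => //=; first exact: add_continuous.
move=> j _; apply: cvgZr_tmp; apply/cvgrPdist_lt => eps eps0.
by have [N HN] := He j eps eps0; exists N => // m; exact: HN.
Qed.

Context {R : realType}.

Lemma cexp_series (b : R) (eps : R[i]) : 0 < eps -> exists N, forall m, (N <= m)%N ->
  `|cexp b - \sum_(0 <= k < m) (k`!%:R)^-1 * ('i%C * b%:C) ^+ k| < eps.
Proof.
move=> eps0.
have termE k : (k`!%:R)^-1 * ('i%C * b%:C) ^+ k = (cos_coeff b k +i* sin_coeff b k :> R[i]).
  have -> : (k`!%:R : R[i])^-1 = ((k`!%:R : R)^-1)%:C.
    by rewrite -(rmorph_nat (real_complex R)) -fmorphV.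
  rewrite exprMn -rmorphXn /= mulrCA -rmorphM /= /cos_coeff /sin_coeff /=.
  (* With [k = o + 2 h], the power of [i] is [(-1) ^ h] or [(-1) ^ h i] according to the parity
     [o]. *)
  rewrite -(odd_double_half k); move: (k./2) (odd k) => h o.
  rewrite exprD -mul2n exprM sqr_i mul2n oddD odd_double oddb addbF.
  rewrite half_bit_double.
  have -> : (o + h.*2).-1./2 = if o then h else (h.*2).-1./2.
    by case: o => //=; rewrite doubleK.
  have -> : (-1) ^+ h = ((-1) ^+ h : R)%:C by rewrite rmorphXn rmorphN1.
  rewrite -exprnP; case: o; rewrite ?expr1 ?expr0 /=;
  move: (_`!%:R^-1) (b ^+ _) ((-1) ^+ h) => w v u.
    by apply/eqP; rewrite eq_complex /=; apply/andP; split; apply/eqP; ring.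
  rewrite !mul0r mul1r; apply/eqP; rewrite eq_complex /=.
  by apply/andP; split; apply/eqP; ring.
have sumE m : \sum_(0 <= k < m) (k`!%:R)^-1 * ('i%C * b%:C) ^+ k =
    series (cos_coeff b) m +i* series (sin_coeff b) m :> R[i].
  rewrite /series /=; elim: m => [|m IH]; first by rewrite !big_geq.
  by rewrite !big_nat_recr //= IH termE.
(* In the order of [R[i]], a positive [eps] is real. *)
have e0 : 0 < complex.Re eps by move: eps0; rewrite ltcE /= => /andP[].
have e2 : 0 < complex.Re eps / 2 by rewrite divr_gt0.
have /cvgrPdist_lt /(_ _ e2) [N1 _ H1] : series (cos_coeff b) @ \oo --> cos b.
  by rewrite unlock; exact: is_cvg_series_cos_coeff.
have /cvgrPdist_lt /(_ _ e2) [N2 _ H2] : series (sin_coeff b) @ \oo --> sin b.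
  by rewrite unlock; exact: is_cvg_series_sin_coeff.
exists (maxn N1 N2) => m; rewrite geq_max => /andP[m1 m2].
have {}H1 := H1 m m1; have {}H2 := H2 m m2; rewrite /= in H1 H2.
rewrite sumE /cexp.
set c := cos b - _ in H1; set s := sin b - _ in H2.
have -> : (cos b +i* sin b) - (series (cos_coeff b) m +i* series (sin_coeff b) m) =
   c%:C + 'i%C * s%:C by rewrite (complexE (_ - _)).
apply: le_lt_trans (ler_normD _ _) _; rewrite normrM.
rewrite !normc_def /= !expr0n /= !expr1n !addr0 !add0r sqrtr1 mul1r !sqrtr_sqr.
rewrite -rmorphD /= ltcE /= eq_sym; have -> : complex.Im eps = 0.
  by move: eps0; rewrite ltcE /= => /andP[/eqP].
by rewrite eqxx /= [ltRHS]splitr ltrD.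
Qed.

Lemma expmx_diag_cexp n (P Q : 'M[R[i]]_n.+1) (b : 'I_n.+1 -> R) (s : R) :
  Q *m P = 1%:M ->
  expmx (s%:C *: (P *m diag_mx (\row_j ('i%C * (b j)%:C)) *m Q)) =
  P *m diag_mx (\row_j cexp (b j * s)) *m Q.
Proof.
move=> QP; rewrite scalemxAl scalemxAr.
have -> : s%:C *: diag_mx (\row_j ('i%C * (b j)%:C)) =
    diag_mx (\row_j ('i%C * (b j * s)%:C)) :> 'M[R[i]]_n.+1.
  apply/matrixP => i j; rewrite !mxE; case: eqP => _; last by rewrite !mulr0n mulr0.
  by rewrite !mulr1n rmorphM /=; ring.
apply: expmx_diagonalizable => // j eps eps0; exact: cexp_series.
Qed.

End MatrixExponential.

(** * Complex numbers and vectors *)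

Section ComplexParts.
Local Open Scope ring_scope.
Context {R : realType}.
Implicit Types (x y : R[i]) (a : R).

Lemma ReDc x y : Re (x + y) = Re x + Re y. Proof. by case: x; case: y. Qed.
Lemma ImDc x y : Im (x + y) = Im x + Im y. Proof. by case: x; case: y. Qed.
Lemma ReNc x : Re (- x) = - Re x. Proof. by case: x. Qed.
Lemma ImNc x : Im (- x) = - Im x. Proof. by case: x. Qed.
Lemma ReMc x y : Re (x * y) = Re x * Re y - Im x * Im y.
Proof. by case: x; case: y. Qed.
Lemma ImMc x y : Im (x * y) = Re x * Im y + Im x * Re y.
Proof. by case: x; case: y => a b c d /=. Qed.
Lemma ReJc x : Re x^* = Re x. Proof. by case: x. Qed.
Lemma ImJc x : Im x^* = - Im x. Proof. by case: x. Qed.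

Definition cpartE := (ReDc, ImDc, ReNc, ImNc, ReMc, ImMc, ReJc, ImJc).

Lemma ceq x y : Re x = Re y -> Im x = Im y -> x = y.
Proof. by case: x; case: y => /= a b c d -> ->. Qed.

(** The squared modulus as a real number, whereas the norm of a complex number is itself an element
    of [R[i]]. *)
Definition nsq x : R := Re x ^+ 2 + Im x ^+ 2.

Lemma nsq_ge0 x : 0 <= nsq x.
Proof. by rewrite addr_ge0 // sqr_ge0. Qed.

Lemma nsqM x y : nsq (x * y) = nsq x * nsq y.
Proof. by rewrite /nsq !cpartE; ring. Qed.

Lemma nsqJ x : nsq x^* = nsq x.
Proof. by rewrite /nsq !cpartE; ring. Qed.

Lemma conjMc x y : (x * y)^* = x^* * y^*.
Proof. by apply: ceq; rewrite !cpartE; ring. Qed.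

Lemma nsqR (a : R) : nsq a%:C = a ^+ 2.
Proof. by rewrite /nsq /= expr0n addr0. Qed.

Lemma nsq_i : nsq ('i%C : R[i]) = 1.
Proof. by rewrite /nsq /= expr0n expr1n add0r. Qed.

Lemma ReZ (a : R) (z : R[i]) : Re (a%:C * z) = a * Re z.
Proof. by rewrite cpartE /= mul0r subr0. Qed.

Lemma conj_real (a : R) : (a%:C)^* = a%:C.
Proof. by apply: ceq; rewrite !cpartE /= ?oppr0. Qed.

Lemma conj_i : ('i%C : R[i])^* = - 'i%C.
Proof. by apply: ceq; rewrite !cpartE /= ?oppr0. Qed.

Lemma conjKc (z : R[i]) : (z^*)^* = z.
Proof. by apply: ceq; rewrite !cpartE ?opprK. Qed.

Lemma mulii : 'i%C * 'i%C = -1 :> R[i].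
Proof. by rewrite -expr2 sqr_i. Qed.

Lemma conjDc x y : (x + y)^* = x^* + y^*.
Proof. by apply: ceq; rewrite !cpartE ?opprD. Qed.

Lemma conjNc (x : R[i]) : (- x)^* = - x^*.
Proof. by apply: ceq; rewrite !cpartE. Qed.

Lemma nsqE x : x * x^* = (nsq x)%:C.
Proof. by apply: ceq; rewrite !cpartE /= /nsq; ring. Qed.

Lemma nsq_normE x : `|x| = (Num.sqrt (nsq x))%:C.
Proof. by rewrite normc_def. Qed.

Lemma nsq_eq0 x : nsq x = 0 -> x = 0.
Proof.
move/eqP; rewrite paddr_eq0 ?sqr_ge0 // !sqrf_eq0 => /andP[/eqP h1 /eqP h2].
exact: ceq.
Qed.

Lemma cexpD a b : cexp (a + b) = cexp a * cexp b :> R[i].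
Proof. by apply: ceq; rewrite !cpartE /= ?cosD ?sinD; ring. Qed.

Lemma cexp0 : cexp 0 = 1 :> R[i].
Proof. by apply: ceq; rewrite /= ?cos0 ?sin0. Qed.

Lemma cexpN a : cexp (- a) = (cexp a)^* :> R[i].
Proof. by apply: ceq; rewrite !cpartE /= ?cosN ?sinN. Qed.

Lemma nsq_cexp a : nsq (cexp a) = 1.
Proof. by rewrite /nsq /= cos2Dsin2. Qed.

Lemma cexpJ a : cexp a * (cexp a)^* = 1 :> R[i].
Proof. by rewrite nsqE nsq_cexp. Qed.

Lemma nsq1_cexp x : nsq x = 1 -> exists a, x = cexp a.
Proof.
move=> h; have h1 : -1 <= Re x <= 1.
  by rewrite -ler_norml -(@ler_pXn2r _ 2) ?nnegrE // expr1n real_normK ?num_real // -h lerDl sqr_ge0.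
have c1 := acosK h1; have s1 := sin_acos h1.
have : Im x ^+ 2 = sin (acos (Re x)) ^+ 2.
  move: h; rewrite /nsq s1 => h.
  by rewrite sqr_sqrtr; have := sqr_ge0 (Im x); lra.
move/eqP; rewrite eqf_sqr => /orP[/eqP e|/eqP e].
  by exists (acos (Re x)); apply: ceq; rewrite /= ?c1.
by exists (- acos (Re x)); apply: ceq; rewrite /= ?cosN ?sinN ?c1.
Qed.

End ComplexParts.

Section ComplexDerivative.
Local Open Scope ring_scope.
Context {R : realType} {V : normedModType R}.
Implicit Types (f g : V -> R[i]) (p v : V).

(** A real derivative of a complex function: the field involves conjugation, which is not
    holomorphic. *)
Definition cder p v f (d : R[i]) : Prop :=
  is_derive p v (fun q => Re (f q)) (Re d) /\ is_derive p v (fun q => Im (f q)) (Im d).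

Lemma cder_eq p v f d d' : d = d' -> cder p v f d -> cder p v f d'.
Proof. by move=> ->. Qed.

Lemma cder_ext p v f g d : f =1 g -> cder p v f d -> cder p v g d.
Proof. by move=> /funext ->. Qed.

Lemma cder_unique p v f d d' : cder p v f d -> cder p v f d' -> d = d'.
Proof.
by move=> [a b] [a' b']; apply: ceq; [apply: is_derive_unique a a'|apply: is_derive_unique b b'].
Qed.

Lemma cder_cst p v c : cder p v (fun _ => c) 0.
Proof. by split; exact: is_derive_cst. Qed.

Lemma cderD p v f g a b : cder p v f a -> cder p v g b ->
  cder p v (fun q => f q + g q) (a + b).
Proof.
move=> [f1 f2] [g1 g2]; split.
  by apply: is_derive_ext (is_deriveDf f1 g1); [move=> q|]; rewrite ReDc.
by apply: is_derive_ext (is_deriveDf f2 g2); [move=> q|]; rewrite ImDc.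
Qed.

Lemma cderM p v f g a b : cder p v f a -> cder p v g b ->
  cder p v (fun q => f q * g q) (f p * b + g p * a).
Proof.
move=> [f1 f2] [g1 g2]; split.
  apply: is_derive_ext (is_deriveDf (is_deriveMf f1 g1) (is_deriveNf (is_deriveMf f2 g2))).
    by move=> q; rewrite ReMc.
  by rewrite !cpartE; ring.
apply: is_derive_ext (is_deriveDf (is_deriveMf f1 g2) (is_deriveMf f2 g1)).
  by move=> q; rewrite ImMc.
by rewrite !cpartE; ring.
Qed.

Lemma cderJ p v f a : cder p v f a -> cder p v (fun q => (f q)^*) a^*.
Proof.
move=> [f1 f2]; split; first by apply: is_derive_ext f1; [move=> q|]; rewrite ReJc.
by apply: is_derive_ext (is_deriveNf f2); [move=> q|]; rewrite ImJc.
Qed.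

Lemma cderZ p v c f a : cder p v f a -> cder p v (fun q => c * f q) (c * a).
Proof.
by move=> H; apply: cder_eq (cderM (cder_cst p v c) H); rewrite mulr0 addr0.
Qed.

Lemma cderN p v f a : cder p v f a -> cder p v (fun q => - f q) (- a).
Proof.
move=> H; apply: cder_eq (cder_ext _ (cderZ (-1) H)); first by rewrite mulN1r.
by move=> q; rewrite mulN1r.
Qed.

Lemma cderR p v (h : V -> R) a : is_derive p v h a -> cder p v (fun q => (h q)%:C) a%:C.
Proof. by move=> H; split => //=; exact: is_derive_cst. Qed.

Lemma cder_comp p v (h : V -> R) (f : R -> R[i]) a b :
  is_derive p v h a ->
  (is_derive (h p) 1 (fun s => Re (f s)) (Re b) /\
   is_derive (h p) 1 (fun s => Im (f s)) (Im b)) ->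
  cder p v (fun q => f (h q)) (b * a%:C).
Proof.
move=> H [f1 f2]; split.
  by apply: is_derive_ext (is_derive_comp1 H f1); rewrite // !cpartE /= mulr0 subr0.
by apply: is_derive_ext (is_derive_comp1 H f2); rewrite // !cpartE /= mulr0 add0r.
Qed.

Lemma cder_cexp p v (h : V -> R) a : is_derive p v h a ->
  cder p v (fun q => cexp (h q)) ('i%C * a%:C * cexp (h p)).
Proof.
move=> H; apply: cder_eq (cder_comp (b := 'i%C * cexp (h p)) H _); first by ring.
split; rewrite !cpartE /=.
  by apply: (is_derive_ext (f := cos) _ _ (is_derive_cos _)) => //; ring.
by apply: (is_derive_ext (f := sin) _ _ (is_derive_sin _)) => //; ring.
Qed.

End ComplexDerivative.

Section Vectors.
Local Open Scope ring_scope.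
Context {R : realType}.
Implicit Types (x y z w : 'cV[R[i]]_3).

Definition o0 : 'I_3 := @Ordinal 3 0 isT.
Definition o1 : 'I_3 := @Ordinal 3 1 isT.
Definition o2 : 'I_3 := @Ordinal 3 2 isT.

Lemma sum3 (A : nmodType) (F : 'I_3 -> A) : \sum_j F j = F o0 + F o1 + F o2.
Proof.
rewrite !big_ord_recl big_ord0 addr0 addrA.
by congr (F _ + F _ + F _); apply/val_inj.
Qed.

Lemma ord3P (P : 'I_3 -> Prop) : P o0 -> P o1 -> P o2 -> forall j, P j.
Proof.
move=> h0 h1 h2 [[|[|[|//]]] h].
- by rewrite (_ : Ordinal h = o0) //; apply/val_inj.
- by rewrite (_ : Ordinal h = o1) //; apply/val_inj.
- by rewrite (_ : Ordinal h = o2) //; apply/val_inj.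
Qed.

Definition vec3 (a b c : R[i]) : 'cV[R[i]]_3 := \col_(j < 3) ([:: a; b; c]`_j).

Lemma vec3_0 a b c : vec3 a b c o0 0 = a. Proof. by rewrite mxE. Qed.
Lemma vec3_1 a b c : vec3 a b c o1 0 = b. Proof. by rewrite mxE. Qed.
Lemma vec3_2 a b c : vec3 a b c o2 0 = c. Proof. by rewrite mxE. Qed.
Definition v3E := (vec3_0, vec3_1, vec3_2).

Lemma vec3P x y : x o0 0 = y o0 0 -> x o1 0 = y o1 0 -> x o2 0 = y o2 0 -> x = y.
Proof.
by move=> h0 h1 h2; apply/matrixP => j k; rewrite [k]ord1; move: j; apply: ord3P.
Qed.

Lemma rdotE x y : rdot x y =
  Re (x o0 0) * Re (y o0 0) + Im (x o0 0) * Im (y o0 0) +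
  (Re (x o1 0) * Re (y o1 0) + Im (x o1 0) * Im (y o1 0)) +
  (Re (x o2 0) * Re (y o2 0) + Im (x o2 0) * Im (y o2 0)).
Proof. by rewrite /rdot sum3 !cpartE; ring. Qed.

Lemma rdotH x y : rdot x y =
  Re (x o0 0 * (y o0 0)^* + x o1 0 * (y o1 0)^* + x o2 0 * (y o2 0)^*).
Proof. by rewrite rdotE !cpartE; ring. Qed.

Lemma rdotC x y : rdot x y = rdot y x.
Proof. by rewrite !rdotE; ring. Qed.

Lemma rdotDl x y z : rdot (x + y) z = rdot x z + rdot y z.
Proof. by rewrite !rdotE !mxE !cpartE; ring. Qed.

Lemma rdotZl (a : R) x y : rdot (a%:C *: x) y = a * rdot x y.
Proof. by rewrite !rdotE !mxE !cpartE /=; ring. Qed.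

Lemma rdotDr x y z : rdot z (x + y) = rdot z x + rdot z y.
Proof. by rewrite rdotC rdotDl !(rdotC z). Qed.

Lemma rdotZr (a : R) x y : rdot x (a%:C *: y) = a * rdot x y.
Proof. by rewrite rdotC rdotZl rdotC. Qed.

Lemma rdotNl x y : rdot (- x) y = - rdot x y.
Proof. by rewrite !rdotE !mxE !cpartE; ring. Qed.

Lemma rdotNr x y : rdot x (- y) = - rdot x y.
Proof. by rewrite rdotC rdotNl rdotC. Qed.

Lemma rdot_ge0 x : 0 <= rdot x x.
Proof. by rewrite rdotE -!expr2 !addr_ge0 ?sqr_ge0. Qed.

Lemma rdot_eq0 x : rdot x x = 0 -> x = 0.
Proof.
have E : rdot x x = nsq (x o0 0) + nsq (x o1 0) + nsq (x o2 0).
  by rewrite rdotE -!expr2.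
have [n0 n1 n2] := And3 (nsq_ge0 (x o0 0)) (nsq_ge0 (x o1 0)) (nsq_ge0 (x o2 0)).
rewrite {}E => E; have [h0 h1 h2] : [/\ nsq (x o0 0) = 0, nsq (x o1 0) = 0 & nsq (x o2 0) = 0].
  by split; lra.
move: h0 h1 h2 => /nsq_eq0 h0 /nsq_eq0 h1 /nsq_eq0 h2.
by apply: vec3P; rewrite mxE.
Qed.

Lemma S5E x : S5 x <-> nsq (x o0 0) + nsq (x o1 0) + nsq (x o2 0) = 1.
Proof. by rewrite /S5 /= rdotE /nsq -!expr2. Qed.

Definition det3 x y z : R[i] :=
  x o0 0 * (y o1 0 * z o2 0 - y o2 0 * z o1 0) -
  x o1 0 * (y o0 0 * z o2 0 - y o2 0 * z o0 0) +
  x o2 0 * (y o0 0 * z o1 0 - y o1 0 * z o0 0).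

Lemma det3E x y z : \det (\matrix_(i < 3, j < 3) ([:: x; y; z]`_j) i 0) = det3 x y z.
Proof.
rewrite (expand_det_col _ o0) sum3 !mxE /= /cofactor.
have d2 (M : 'M[R[i]]_2) : \det M = M 0 0 * M 1 1 - M 1 0 * M 0 1.
  rewrite (expand_det_col _ 0) !big_ord_recl big_ord0 addr0 /cofactor !det_mx11 !mxE /=.
  rewrite expr0 expr1 mul1r mulN1r mulrN; congr (_ * M _ _ - M _ _ * M _ _);
    exact/val_inj.
rewrite !d2 !mxE /= /det3.
rewrite (_ : lift o0 0 = o1); last exact/val_inj.
rewrite (_ : lift o0 1 = o2); last exact/val_inj.
rewrite (_ : lift o1 0 = o0); last exact/val_inj.
rewrite (_ : lift o1 1 = o2); last exact/val_inj.
rewrite (_ : lift o2 0 = o0); last exact/val_inj.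
rewrite (_ : lift o2 1 = o1); last exact/val_inj.
rewrite /= addn0 expr0 mul1r expr1 mulN1r mulrN.
rewrite (_ : (-1) ^+ 2 = 1); last by rewrite sqrrN expr1n.
by rewrite mul1r; ring.
Qed.

Lemma alphaE theta x y z : alpha theta x y z = Re (cexp theta * det3 x y z).
Proof. by rewrite /alpha det3E. Qed.

Lemma det3_antisym x y z (a b c d : R[i]) :
  det3 x (a *: y + b *: z) (c *: y + d *: z) = (a * d - b * c) * det3 x y z.
Proof.
rewrite /det3 !mxE; move: (x o0 0) (x o1 0) (x o2 0) (y o0 0) (y o1 0) (y o2 0).
by move: (z o0 0) (z o1 0) (z o2 0) => *; ring.
Qed.

End Vectors.

Section VectorDerivative.
Local Open Scope ring_scope.
Context {R : realType} {V : normedModType R}.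
Implicit Types (f g : V -> 'cV[R[i]]_3) (p v : V).

Definition vder p v f (d : 'cV[R[i]]_3) : Prop :=
  forall j, cder p v (fun q => f q j 0) (d j 0).

Lemma vder_eq p v f d d' : d = d' -> vder p v f d -> vder p v f d'.
Proof. by move=> ->. Qed.

Lemma vder_ext p v f g d : f =1 g -> vder p v f d -> vder p v g d.
Proof. by move=> /funext ->. Qed.

Lemma vder_unique p v f d d' : vder p v f d -> vder p v f d' -> d = d'.
Proof.
by move=> h h'; apply/matrixP => j k; rewrite [k]ord1; exact: cder_unique (h j) (h' j).
Qed.

Lemma vderD p v f g a b : vder p v f a -> vder p v g b ->
  vder p v (fun q => f q + g q) (a + b).
Proof.
move=> hf hg j; rewrite mxE; apply: cder_ext (cderD (hf j) (hg j)) => q.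
by rewrite mxE.
Qed.

Lemma vder_mulmx p v (M : 'M[R[i]]_3) f a : vder p v f a ->
  vder p v (fun q => M *m f q) (M *m a).
Proof.
move=> hf j; rewrite mxE sum3.
apply: cder_ext (cderD (cderD (cderZ (M j o0) (hf o0)) (cderZ (M j o1) (hf o1)))
  (cderZ (M j o2) (hf o2))) => q.
by rewrite mxE sum3.
Qed.

Lemma vder_scale p v (h : V -> R) f a b : is_derive p v h a -> vder p v f b ->
  vder p v (fun q => (h q)%:C *: f q) ((h p)%:C *: b + a%:C *: f p).
Proof.
move=> hh hf j; rewrite !mxE [_%:C * f p j 0]mulrC.
by apply: cder_ext (cderM (cderR hh) (hf j)) => q; rewrite mxE.
Qed.

Lemma vder_vec3 p v (a b c : V -> R[i]) da db dc :
  cder p v a da -> cder p v b db -> cder p v c dc ->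
  vder p v (fun q => vec3 (a q) (b q) (c q)) (vec3 da db dc).
Proof.
move=> ha hb hc; apply: ord3P.
- by rewrite v3E; apply: cder_ext ha => q; rewrite v3E.
- by rewrite v3E; apply: cder_ext hb => q; rewrite v3E.
- by rewrite v3E; apply: cder_ext hc => q; rewrite v3E.
Qed.

Lemma vder_rdot p v f g a b : vder p v f a -> vder p v g b ->
  is_derive p v (fun q => rdot (f q) (g q)) (rdot (f p) b + rdot a (g p)).
Proof.
move=> hf hg.
have [f0 f0'] := hf o0; have [f1 f1'] := hf o1; have [f2 f2'] := hf o2.
have [g0 g0'] := hg o0; have [g1 g1'] := hg o1; have [g2 g2'] := hg o2.
have D := is_deriveDf (is_deriveDf
  (is_deriveDf (is_deriveMf f0 g0) (is_deriveMf f0' g0'))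
  (is_deriveDf (is_deriveMf f1 g1) (is_deriveMf f1' g1')))
  (is_deriveDf (is_deriveMf f2 g2) (is_deriveMf f2' g2')).
apply: is_derive_ext D; first by move=> q; rewrite rdotE.
by rewrite !rdotE; ring.
Qed.

End VectorDerivative.

Local Open Scope ring_scope.
Lemma du_vder (R : realType) (u : R * R -> 'cV[R[i]]_3) p v d :
  vder p v u d -> du u p v = d.
Proof.
move=> h; apply/matrixP => j k; rewrite [k]ord1 mxE.
by have [[_ ->] [_ ->]] := h j; case: (d j 0).
Qed.

(** * The profile equation and its orbit surfaces *)

Section CrossField.
Local Open Scope ring_scope.
Context {R : realType}.
Variables (eta : R[i]) (c0 c1 c2 : R).
Hypothesis c_sum : c0 + c1 + c2 = 0.

Definition crossfield (z : 'cV[R[i]]_3) : 'cV[R[i]]_3 :=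
  vec3 (eta * c0%:C * (z o1 0 * z o2 0)^*)
       (eta * c1%:C * (z o2 0 * z o0 0)^*)
       (eta * c2%:C * (z o0 0 * z o1 0)^*).

Definition is_flow (z : R -> 'cV[R[i]]_3) : Prop :=
  forall t : R, vder t 1 z (crossfield (z t)).

Let I := ('I_3 * bool)%type.

(** The field in six real coordinates: [(j, false)] stands for the real part and [(j, true)] for the
    imaginary part of [z_j]. *)
Let coef (i : I) : seq (R * I * I) :=
  let k := [:: o1; o2; o0]`_(i.1 : 'I_3) in
  let l := [:: o2; o0; o1]`_(i.1 : 'I_3) in
  let c := [:: c0; c1; c2]`_(i.1 : 'I_3) in
  let p := c * Re eta in let q := c * Im eta in
  if i.2 then
    [:: (q, (k, false), (l, false)); (- q, (k, true), (l, true));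
        (- p, (k, false), (l, true)); (- p, (k, true), (l, false))]
  else
    [:: (p, (k, false), (l, false)); (- p, (k, true), (l, true));
        (q, (k, false), (l, true)); (q, (k, true), (l, false))].

Let dec (x : I -> R) : 'cV[R[i]]_3 := \col_j (x (j, false) +i* x (j, true)).
Let enc (z : 'cV[R[i]]_3) (i : I) : R := if i.2 then Im (z i.1 0) else Re (z i.1 0).

Let encK z : dec (enc z) = z.
Proof. by apply/matrixP => j k; rewrite [k]ord1 mxE /enc /=; case: (z j 0). Qed.

Let decK x : enc (dec x) = x.
Proof. by apply/funext => -[j []]; rewrite /enc /= mxE. Qed.

Let fieldE x : qfield coef x = enc (crossfield (dec x)).
Proof.
apply/funext => -[j b]; move: j; apply: ord3P; case: b;
rewrite /qfield !big_cons big_nil /enc /crossfield /= !v3E !mxE !cpartE /=; ring.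
Qed.

Let flow_qfield (z : R -> 'cV[R[i]]_3) (a b : R) :
  (forall t : R, a < t < b -> vder t 1 z (crossfield (z t))) <->
  solves coef a b (fun t => enc (z t)).
Proof.
split=> H t tab => [[j [|]]|j].
- by rewrite fieldE encK; have [_] := H t tab j.
- by rewrite fieldE encK; have [] := H t tab j.
- have [h1 h2] := (H t tab (j, false), H t tab (j, true)).
  by rewrite !fieldE encK in h1 h2.
Qed.

Let Inv (x : I -> R) := rdot (dec x) (dec x) = 1.

(** Even the Hermitian product vanishes, being [conj(eta) z_1 z_2 z_3] times the sum of the
    coefficients. This makes the unit sphere invariant, which is what global existence requires. *)
Lemma rdot_crossfield (z : 'cV[R[i]]_3) : rdot z (crossfield z) = 0.
Proof.
rewrite rdotH /crossfield !v3E !conjMc !conjKc !conj_real.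
rewrite (_ : _ + _ = eta^* * (z o0 0 * z o1 0 * z o2 0) * (c0 + c1 + c2)%:C); last first.
  by rewrite !rmorphD /=; ring.
by rewrite c_sum mulr0.
Qed.

Let Inv_le1 x : Inv x -> forall i, `|x i| <= 1.
Proof.
rewrite /Inv rdotE !mxE /= -!expr2 => h.
have H (k : I) : `|x k| ^+ 2 <= 1.
  rewrite real_normK ?num_real // -h.
  have [s0 s1] := (sqr_ge0 (x (o0, false)), sqr_ge0 (x (o0, true))).
  have [s2 s3] := (sqr_ge0 (x (o1, false)), sqr_ge0 (x (o1, true))).
  have [s4 s5] := (sqr_ge0 (x (o2, false)), sqr_ge0 (x (o2, true))).
  by case: k => j b; move: j; apply: ord3P; case: b; lra.
by move=> i; rewrite -(@ler_pXn2r _ 2) ?nnegrE // expr1n.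
Qed.

Let Inv_flow (a b c : R) y : a < c < b -> solves coef a b y ->
  Inv (y c) -> forall t, a < t < b -> Inv (y t).
Proof.
move=> cab S; rewrite /Inv => <- t tab.
have H : forall s : R, a < s < b -> vder s 1 (dec \o y) (crossfield ((dec \o y) s)).
  apply/flow_qfield; rewrite (_ : (fun t => _) = y) //.
  by apply/funext => s /=; rewrite decK.
apply: (@is_derive0_const _ (fun t => rdot (dec (y t)) (dec (y t)))) => s sct.
have sab : a < s < b.
  move: sct cab tab; case: (leP c t) => ct /andP[? ?] /andP[? ?] /andP[? ?];
  by apply/andP; split; lra.
have := vder_rdot (H s sab) (H s sab).
by rewrite /= rdot_crossfield rdotC rdot_crossfield addr0.
Qed.

Lemma flow_exists (z0 : 'cV[R[i]]_3) : S5 z0 -> exists2 z, is_flow z & z 0 = z0.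
Proof.
move=> h; have I0 : Inv (enc z0) by rewrite /Inv encK.
have [y Sy y0] := solves_global Inv_le1 Inv_flow I0.
exists (dec \o y); last by rewrite /= y0 encK.
move=> t; have /flow_qfield H : solves coef (t - 1) (t + 1) (fun t => enc (dec (y t))).
    rewrite (_ : (fun t => _) = y); first by move=> s _ i.
    by apply/funext => s; rewrite decK.
by apply: H; apply/andP; split; lra.
Qed.

Lemma flow_unique (y z : R -> 'cV[R[i]]_3) c : is_flow y -> is_flow z ->
  S5 (y c) -> y c = z c -> forall t, y t = z t.
Proof.
move=> Hy Hz Sc E t; rewrite -[y t]encK -[z t]encK; congr dec.
have sol w : is_flow w -> forall (s : R) i, is_derive s 1 (fun t => enc (w t) i)
    (qfield coef (enc (w s)) i).
  move=> Hw s i.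
  have /flow_qfield H : forall r : R, s - 1 < r < s + 1 -> vder r 1 w (crossfield (w r)).
    by move=> r _; exact: Hw.
  by apply: H; apply/andP; split; lra.
apply: (@solution_unique _ _ coef Inv Inv_le1 Inv_flow (fun t => enc (y t)) (fun t => enc (z t)) c).
- exact: sol.
- exact: sol.
- by rewrite /Inv encK.
- by rewrite E.
Qed.

Lemma flow_S5 (z : R -> 'cV[R[i]]_3) c : is_flow z -> S5 (z c) -> forall t, S5 (z t).
Proof.
move=> Hz Sc t; rewrite /S5 /= -Sc.
apply: (@is_derive0_const _ (fun t => rdot (z t) (z t))) => s _.
by have := vder_rdot (Hz s) (Hz s); rewrite rdot_crossfield rdotC rdot_crossfield addr0.
Qed.

End CrossField.

Section ComplexCk.
Local Open Scope ring_scope.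
Context {R : realType} {V : normedModType R}.
Implicit Types (f g : V -> R[i]).

Definition cCk k f : Prop :=
  is_Ck k (fun q => Re (f q)) /\ is_Ck k (fun q => Im (f q)).

Lemma cCk_ext k f g : f =1 g -> cCk k f -> cCk k g.
Proof. by move=> /funext ->. Qed.

Lemma cCk_cst k (c : R[i]) : cCk k (fun _ : V => c).
Proof. by split; exact: Ck_cst. Qed.

Lemma cCk_add k f g : cCk k f -> cCk k g -> cCk k (fun q => f q + g q).
Proof.
move=> [f1 f2] [g1 g2]; split.
  by under eq_fun do rewrite ReDc; exact: Ck_add.
by under eq_fun do rewrite ImDc; exact: Ck_add.
Qed.

Lemma cCk_mul k f g : cCk k f -> cCk k g -> cCk k (fun q => f q * g q).
Proof.
move=> [f1 f2] [g1 g2]; split.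
  by under eq_fun do rewrite ReMc; apply: Ck_sub; exact: Ck_mul.
by under eq_fun do rewrite ImMc; apply: Ck_add; exact: Ck_mul.
Qed.

Lemma cCk_conj k f : cCk k f -> cCk k (fun q => (f q)^*).
Proof.
move=> [f1 f2]; split; first by under eq_fun do rewrite ReJc.
by under eq_fun do rewrite ImJc; exact: Ck_opp.
Qed.

Lemma cCk_cexp k (h : V -> R) : is_Ck k h -> cCk k (fun q => cexp (h q)).
Proof.
move=> H; have [Hc Hs] := @Ck_cos_sin R k.
by split; [exact: (Ck_comp1 H Hc)|exact: (Ck_comp1 H Hs)].
Qed.

Lemma cCk_comp1 k (h : V -> R) (f : R -> R[i]) : is_Ck k h ->
  is_Ck k (fun q => Re (f q)) /\ is_Ck k (fun q => Im (f q)) ->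
  cCk k (fun q => f (h q)).
Proof.
move=> H [f1 f2]; split.
  exact: (Ck_comp1 (g := fun q => Re (f q)) H f1).
exact: (Ck_comp1 (g := fun q => Im (f q)) H f2).
Qed.

End ComplexCk.

Lemma cCkS_derive1 (R : realType) k (f d : R -> R[i]) :
  (forall t : R, cder t 1 f (d t)) -> cCk k d -> cCk k.+1 f.
Proof.
move=> H [d1 d2]; split.
  by apply: (CkS_derive1 (d := fun t => Re (d t))) => // t; have [] := H t.
by apply: (CkS_derive1 (d := fun t => Im (d t))) => // t; have [] := H t.
Qed.

Lemma cder_continuous (R : realType) (f d : R -> R[i]) :
  (forall t : R, cder t 1 f (d t)) -> cCk 0 f.
Proof.
move=> H; split; split=> //.
  by apply: (is_derive_continuous (d := fun t => Re (d t))) => t; have [] := H t.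
by apply: (is_derive_continuous (d := fun t => Im (d t))) => t; have [] := H t.
Qed.

Lemma smooth_mapP (R : realType) (u : R * R -> 'cV[R[i]]_3) :
  smooth_map u <-> forall k j, cCk k (fun p => u p j 0).
Proof.
split=> [H k j|H j]; first by have [h1 h2] := H j; split.
by split=> k; have [] := H k j.
Qed.

(** * Diagonal rotations and orbit surfaces *)

Section TorusFamily.
Local Open Scope ring_scope.
Context {R : realType}.
Implicit Types (w : 'cV[R[i]]_3) (al : R).

(** For [a = (1, al, -1 - al)] the coefficients are [a_3 - a_2], [a_1 - a_3], [a_2 - a_1]. They are
    orthogonal to [(1, 1, 1)] and to [a], whence the conservation of the norm and of [moment]. *)
Definition crossA al (eta : R[i]) w :=
  crossfield eta (- (1 + 2 * al)) (2 + al) (al - 1) w.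

Definition is_flowA al (eta : R[i]) (z : R -> 'cV[R[i]]_3) :=
  is_flow eta (- (1 + 2 * al)) (2 + al) (al - 1) z.

Definition torus_gen al w : 'cV[R[i]]_3 :=
  vec3 ('i%C * w o0 0) ('i%C * al%:C * w o1 0) ('i%C * (- 1 - al)%:C * w o2 0).

Definition torus_rot al (s : R) w : 'cV[R[i]]_3 :=
  vec3 (cexp s * w o0 0) (cexp (al * s) * w o1 0) (cexp ((- 1 - al) * s) * w o2 0).

Definition orbit_surf al (z : R -> 'cV[R[i]]_3) (p : R * R) := torus_rot al p.1 (z p.2).

Lemma crossA_sum0 al : - (1 + 2 * al) + (2 + al) + (al - 1) = 0.
Proof. by ring. Qed.

Lemma expmx_genA al s w : expmx (s%:C *: genA al) *m w = torus_rot al s w.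
Proof.
pose b (j : 'I_3) : R := [:: 1; al; -1 - al]`_j.
have -> : genA al = 1%:M *m diag_mx (\row_j ('i%C * (b j)%:C)) *m 1%:M.
  rewrite mul1mx mulmx1 /genA; apply/matrixP => i j; rewrite !mxE /b.
  by case: eqP => _; rewrite ?mulr1n // !mulr0n mulr0.
rewrite expmx_diag_cexp ?mul1mx // mulmx1; apply: vec3P; rewrite !v3E mul_diag_mx !mxE /b /=.
- by rewrite mul1r.
- by [].
- by [].
Qed.

Lemma torus_rotD al s t w : torus_rot al (s + t) w = torus_rot al s (torus_rot al t w).
Proof. by apply: vec3P; rewrite !v3E ?mulrDr !cexpD mulrA. Qed.

Lemma torus_rot0 al w : torus_rot al 0 w = w.
Proof. by apply: vec3P; rewrite !v3E ?mulr0 cexp0 mul1r. Qed.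

Lemma torus_rot_gen al s w : torus_rot al s (torus_gen al w) = torus_gen al (torus_rot al s w).
Proof. by apply: vec3P; rewrite !v3E; ring. Qed.

(** The weights have zero sum, so the conjugate of the product of two phases is the third phase. *)
Lemma torus_rot_cross al eta s w :
  torus_rot al s (crossA al eta w) = crossA al eta (torus_rot al s w).
Proof.
apply: vec3P; rewrite /crossA /crossfield /torus_rot !v3E !conjMc -!cexpN.
- rewrite (_ : cexp s = cexp (- (al * s)) * cexp (- ((-1 - al) * s))).
    by ring.
  by rewrite -cexpD; congr cexp; ring.
- rewrite (_ : cexp (al * s) = cexp (- ((-1 - al) * s)) * cexp (- s)).
    by ring.
  by rewrite -cexpD; congr cexp; ring.
- rewrite (_ : cexp ((-1 - al) * s) = cexp (- s) * cexp (- (al * s))).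
    by ring.
  by rewrite -cexpD; congr cexp; ring.
Qed.

Lemma flow_cCk eta c0 c1 c2 (z : R -> 'cV[R[i]]_3) : is_flow eta c0 c1 c2 z ->
  forall k j, cCk k (fun t => z t j 0).
Proof.
move=> H; elim=> [|k IH] j.
  by apply: (cder_continuous (d := fun t => crossfield eta c0 c1 c2 (z t) j 0)) => t; exact: (H t j).
apply: (cCkS_derive1 (d := fun t => crossfield eta c0 c1 c2 (z t) j 0)); first by move=> t; exact: (H t j).
move: j; apply: ord3P; under eq_fun do rewrite v3E;
by apply: cCk_mul; [exact: cCk_cst|apply: cCk_conj; exact: cCk_mul].
Qed.

Lemma orbit_smooth al (z : R -> 'cV[R[i]]_3) :
  (forall k j, cCk k (fun t => z t j 0)) -> smooth_map (orbit_surf al z).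
Proof.
move=> H; apply/smooth_mapP => k.
have S (b : R) : is_Ck k (fun p : R * R => b * p.1) by apply: Ck_scale; exact: Ck_fst.
have Z j : cCk k (fun p : R * R => z p.2 j 0).
  by apply: (cCk_comp1 (f := fun t => z t j 0) (@Ck_snd R k)); exact: H.
apply: ord3P; rewrite /orbit_surf /torus_rot; under eq_fun do rewrite v3E.
- by apply: cCk_mul => //; apply: cCk_cexp; exact: Ck_fst.
- by apply: cCk_mul => //; apply: cCk_cexp; exact: S.
- by apply: cCk_mul => //; apply: cCk_cexp; exact: S.
Qed.

(** The parameters [s] and [t] are arbitrary functions because the rigidity argument differentiates
    a surface composed with a change of parameters. *)
Lemma vder_orbit (V : normedModType R) al eta z (s t : V -> R) p v ds dt :
  is_flowA al eta z -> is_derive p v s ds -> is_derive p v t dt ->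
  vder p v (fun q => torus_rot al (s q) (z (t q)))
    (ds%:C *: torus_gen al (torus_rot al (s p) (z (t p))) +
     dt%:C *: crossA al eta (torus_rot al (s p) (z (t p)))).
Proof.
move=> Hz Hs Ht.
have Z j : cder p v (fun q => z (t q) j 0) (crossA al eta (z (t p)) j 0 * dt%:C).
  by apply: (cder_comp (f := fun t => z t j 0) Ht); have := Hz (t p) j.
rewrite -torus_rot_cross; apply: vder_eq; last first.
  apply: vder_vec3.
  - by apply: cderM (Z o0); exact: cder_cexp Hs.
  - by apply: cderM (Z o1); exact: (cder_cexp (is_deriveZf al Hs)).
  - by apply: cderM (Z o2); exact: (cder_cexp (is_deriveZf (-1 - al) Hs)).
by apply: vec3P; rewrite !mxE /= ?rmorphM /=; ring.
Qed.

End TorusFamily.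

(** * Inner products of the frame and conserved quantities *)

Section GramIdentities.
Local Open Scope ring_scope.
Context {R : realType}.
Variables (al : R) (eta : R[i]).
Hypothesis eta1 : nsq eta = 1.
Implicit Types (w : 'cV[R[i]]_3).

Local Notation A := (torus_gen al).
Local Notation F := (crossA al eta).

(** Up to a factor [i], the Hermitian product of [w] with the generator at [w]; its vanishing is the
    Legendrian condition in that direction. *)
Definition moment w : R :=
  nsq (w o0 0) + al * nsq (w o1 0) + (- 1 - al) * nsq (w o2 0).

(** The squared length of the generator at [w], which becomes the conformal factor of the induced
    metric. *)
Definition energy w : R :=
  nsq (w o0 0) + al ^+ 2 * nsq (w o1 0) + (1 + al) ^+ 2 * nsq (w o2 0).

(* In the notation of the statement, [cubic w] is [i e^(i theta) z1 z2 z3] when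
   [eta = - i e^(- i theta)]. *)
Definition cubic w : R[i] := eta^* * (w o0 0 * w o1 0 * w o2 0).

Lemma rdot_nsq w : rdot w w = nsq (w o0 0) + nsq (w o1 0) + nsq (w o2 0).
Proof. by rewrite rdotE -!expr2. Qed.

Lemma rdot_gen_gen w : rdot (A w) (A w) = energy w.
Proof. by rewrite rdot_nsq /torus_gen /energy !v3E !nsqM /nsq /=; ring. Qed.

Lemma rdot_self_gen w : rdot w (A w) = 0.
Proof. by rewrite rdotE /torus_gen !v3E !cpartE /=; ring. Qed.

Lemma rdot_self_cross w : rdot w (F w) = 0.
Proof. exact: rdot_crossfield (crossA_sum0 al) w. Qed.

Lemma rdot_gen_cross w : rdot (A w) (F w) = 0.
Proof.
rewrite rdotH /crossA /crossfield /torus_gen !v3E !conjMc !conjKc !conj_real.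
by rewrite [X in Re X](_ : _ = 0) //; ring.
Qed.

(** Lagrange's identity for the real vectors with entries [|w_j|] and [a_j |w_j|], whose scalar
    product is [moment w]. *)
Lemma rdot_cross_cross w : S5 w -> moment w = 0 -> rdot (F w) (F w) = energy w.
Proof.
move=> /S5E h1 h2; rewrite rdot_nsq /crossA /crossfield !v3E !nsqM !nsqJ !nsqM !nsqR eta1.
have -> : energy w = (nsq (w o0 0) + nsq (w o1 0) + nsq (w o2 0)) * energy w -
    moment w ^+ 2 by rewrite h1 h2 expr0n subr0 mul1r.
rewrite /energy /moment.
by move: (nsq _) (nsq _) (nsq _) => *; ring.
Qed.

(** The vector [F w] is [i eta] times the conjugate of the complex cross product of [w] and [A w],
    so the determinant is [i eta] times a squared norm. *)
Lemma det3_frame w : S5 w -> moment w = 0 ->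
  det3 w (A w) (F w) = 'i%C * eta * (energy w)%:C.
Proof.
move=> h1 h2; rewrite -rdot_cross_cross // rdot_nsq.
rewrite /crossA /crossfield !v3E !nsqM !nsqJ !nsqM !nsqR eta1 !mul1r /det3 /torus_gen !v3E.
rewrite !conjMc.
have E j k : (nsq (w j 0) * nsq (w k 0))%:C =
    (w j 0 * w k 0) * ((w j 0)^* * (w k 0)^*).
  by rewrite rmorphM /= -!nsqE; ring.
have P (a b : R) : (a + b)%:C = a%:C + b%:C by rewrite rmorphD.
have M (a b : R) : (a * b)%:C = a%:C * b%:C by rewrite rmorphM.
rewrite !P !(M (_ ^+ 2)) !E !expr2 !M !P.
have N (a : R) : (- a)%:C = - a%:C by rewrite rmorphN.
rewrite !N !P !M.
move: (w o0 0) (w o1 0) (w o2 0) => x y z.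
move: (x^*) (y^*) (z^*) => x' y' z'.
by ring.
Qed.

Lemma nsq_rot s w : [/\ nsq (torus_rot al s w o0 0) = nsq (w o0 0),
  nsq (torus_rot al s w o1 0) = nsq (w o1 0) &
  nsq (torus_rot al s w o2 0) = nsq (w o2 0)].
Proof. by rewrite /torus_rot !v3E !nsqM !nsq_cexp !mul1r. Qed.

Lemma S5_rot s w : S5 w -> S5 (torus_rot al s w).
Proof. by move=> /S5E h; apply/S5E; have [-> -> ->] := nsq_rot s w. Qed.

Lemma moment_rot s w : moment (torus_rot al s w) = moment w.
Proof. by rewrite /moment; have [-> -> ->] := nsq_rot s w. Qed.

Lemma energy_rot s w : energy (torus_rot al s w) = energy w.
Proof. by rewrite /energy; have [-> -> ->] := nsq_rot s w. Qed.

Lemma cubic_rot s w : cubic (torus_rot al s w) = cubic w.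
Proof.
rewrite /cubic /torus_rot !v3E.
have E : cexp s * cexp (al * s) * cexp ((- 1 - al) * s) = 1 :> R[i].
  by rewrite -!cexpD -[RHS]cexp0; congr cexp; ring.
by rewrite -[w o0 0 * w o1 0 * w o2 0]mul1r -E; ring.
Qed.

Lemma is_derive_nsq (V : normedModType R) (p v : V) (f : V -> R[i]) d : cder p v f d ->
  is_derive p v (fun q => nsq (f q)) (2 * (Re (f p) * Re d + Im (f p) * Im d)).
Proof.
move=> [h1 h2]; apply: is_derive_ext (is_deriveDf (is_deriveMf h1 h1) (is_deriveMf h2 h2)).
  by move=> q; rewrite /nsq !expr2.
by ring.
Qed.

Lemma flow_nsq (z : R -> 'cV[R[i]]_3) (t : R) : is_flowA al eta z ->
  [/\ is_derive t 1 (fun t => nsq (z t o0 0)) (- (1 + 2 * al) * (2 * Re (cubic (z t)))),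
      is_derive t 1 (fun t => nsq (z t o1 0)) ((2 + al) * (2 * Re (cubic (z t)))) &
      is_derive t 1 (fun t => nsq (z t o2 0)) ((al - 1) * (2 * Re (cubic (z t))))].
Proof.
move=> H; split.
- apply: is_derive_ext (is_derive_nsq (H t o0)) => //.
  by rewrite /cubic /crossfield !v3E !cpartE /=; ring.
- apply: is_derive_ext (is_derive_nsq (H t o1)) => //.
  by rewrite /cubic /crossfield !v3E !cpartE /=; ring.
- apply: is_derive_ext (is_derive_nsq (H t o2)) => //.
  by rewrite /cubic /crossfield !v3E !cpartE /=; ring.
Qed.

Lemma flow_moment (z : R -> 'cV[R[i]]_3) (s t : R) : is_flowA al eta z ->
  moment (z t) = moment (z s).
Proof.
move=> H; apply: (@is_derive0_const _ (fun t => moment (z t))) => r _.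
have [h0 h1 h2] := flow_nsq r H.
apply: is_derive_ext (is_deriveDf (is_deriveDf h0 (is_deriveZf al h1))
  (is_deriveZf (-1 - al) h2)) => //.
by ring.
Qed.

Lemma flow_cubic (z : R -> 'cV[R[i]]_3) (t : R) : is_flowA al eta z ->
  cder t 1 (fun t => cubic (z t))
    (- (1 + 2 * al) * (nsq (z t o1 0) * nsq (z t o2 0)) +
     (2 + al) * (nsq (z t o2 0) * nsq (z t o0 0)) +
     (al - 1) * (nsq (z t o0 0) * nsq (z t o1 0)))%:C.
Proof.
move=> H.
apply: cder_eq (cderZ eta^* (cderM (cderM (H t o0) (H t o1)) (H t o2))).
rewrite /crossfield !v3E !conjMc.
have E j k : (nsq (z t j 0) * nsq (z t k 0))%:C =
    (z t j 0 * z t k 0) * ((z t j 0)^* * (z t k 0)^*).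
  by rewrite rmorphM /= -!nsqE; ring.
have e1 : eta^* * eta = 1 by rewrite mulrC nsqE eta1.
have P (a b : R) : (a + b)%:C = a%:C + b%:C by rewrite rmorphD.
have M (a b : R) : (a * b)%:C = a%:C * b%:C by rewrite rmorphM.
move: (- (1 + 2 * al)) (2 + al) (al - 1) => a b c.
rewrite !P !(M _ (nsq _ * nsq _)) !E -[RHS]mul1r -e1.
move: (a%:C) (b%:C) (c%:C) => {}a {}b {}c.
move: (z t o0 0) (z t o1 0) (z t o2 0) => x y w.
move: (x^*) (y^*) (w^*) (eta^*) => x' y' w' e'.
by ring.
Qed.

Lemma flow_Im_cubic (z : R -> 'cV[R[i]]_3) (s t : R) : is_flowA al eta z ->
  Im (cubic (z t)) = Im (cubic (z s)).
Proof.
move=> H; apply: (@is_derive0_const _ (fun t => Im (cubic (z t)))) => r _.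
by have [_] := flow_cubic r H.
Qed.

End GramIdentities.

(** * Special Legendrian orbit surfaces and the standard profiles *)

Section OrbitSurfaces.
Local Open Scope ring_scope.
Context {R : realType}.
Implicit Types (al th : R) (eta : R[i]) (w : 'cV[R[i]]_3).

Definition phase th : R[i] := - 'i%C * cexp (- th).

Lemma nsq_phase th : nsq (phase th) = 1.
Proof. by rewrite nsqM nsq_cexp mulr1 /nsq /= oppr0 expr0n add0r sqrrN expr1n. Qed.

Lemma phase_unit th : cexp th * ('i%C * phase th) = 1.
Proof.
rewrite /phase cexpN -[RHS](cexpJ th).
have -> : 'i%C * (- 'i%C * (cexp th)^*) = - ('i%C ^+ 2) * (cexp th)^* by ring.
by rewrite sqr_i opprK mul1r.
Qed.

Lemma du_orbit al eta z p v : is_flowA al eta z ->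
  du (orbit_surf al z) p v =
  (v.1)%:C *: torus_gen al (orbit_surf al z p) + (v.2)%:C *: crossA al eta (orbit_surf al z p).
Proof.
by move=> H; apply: du_vder; apply: vder_orbit => //; [exact: is_derive_fst|exact: is_derive_snd].
Qed.

Lemma rdot_frame al eta w (a b c d : R) : nsq eta = 1 -> S5 w -> moment al w = 0 ->
  rdot (a%:C *: torus_gen al w + b%:C *: crossA al eta w)
       (c%:C *: torus_gen al w + d%:C *: crossA al eta w) =
  (a * c + b * d) * energy al w.
Proof.
move=> e1 h1 h2.
rewrite rdotDl !rdotDr !rdotZl !rdotZr rdot_gen_gen rdot_cross_cross // rdot_gen_cross.
by rewrite rdotC rdot_gen_cross; ring.
Qed.

Lemma orbit_special_legendrian th al z : is_flowA al (phase th) z ->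
  (forall t, [/\ S5 (z t), moment al (z t) = 0 & 0 < energy al (z t)]) ->
  special_legendrian th (orbit_surf al z).
Proof.
move=> H Hz; have e1 := nsq_phase th.
have S p : S5 (orbit_surf al z p) by have [h _ _] := Hz p.2; exact: S5_rot.
have M p : moment al (orbit_surf al z p) = 0.
  by have [_ h _] := Hz p.2; rewrite /orbit_surf moment_rot.
have E p : 0 < energy al (orbit_surf al z p).
  by have [_ _ h] := Hz p.2; rewrite /orbit_surf energy_rot.
split; first split => //.
- by apply: orbit_smooth => k j; exact: flow_cCk H k j.
- move=> p [a b]; rewrite (du_orbit _ _ H) /= => h0.
  have : rdot (a%:C *: torus_gen al (orbit_surf al z p) +
    b%:C *: crossA al (phase th) (orbit_surf al z p)) (a%:C *: torus_gen al (orbit_surf al z p) +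
    b%:C *: crossA al (phase th) (orbit_surf al z p)) = 0.
    by rewrite h0 rdotE !mxE /= !mul0r !addr0.
  rewrite rdot_frame // => /eqP; rewrite mulf_eq0 (gt_eqF (E p)) orbF -!expr2.
  by rewrite paddr_eq0 ?sqr_ge0 // !sqrf_eq0 => /andP[/eqP -> /eqP ->].
move=> p v w; rewrite /alphaN alphaE !(du_orbit _ _ H) det3_antisym det3_frame //.
rewrite -!rmorphM -rmorphB.
set r := v.1 * w.2 - _; set e := energy _ _.
rewrite (_ : _ * _ = (cexp th * ('i%C * phase th)) * (r * e)%:C); last first.
  by rewrite [in RHS]rmorphM /=; ring.
have G (a b c d : R) := rdot_frame a b c d (nsq_phase th) (S p) (M p).
rewrite phase_unit mul1r /volume_form /induced_metric !(du_orbit _ _ H) !G -/e -/r.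
rewrite (_ : _ - _ = e ^+ 2); last by rewrite /=; ring.
rewrite sqrtr_sqr gtr0_norm; last exact: E.
exact: mulrC.
Qed.

(* With it, [- base_height J +i* J] has norm [Jmax], which is the modulus of
   [z1 z2 z3] when all the [z_j] have modulus [1 / sqrt 3]. *)
Definition base_height (J : R) : R := Num.sqrt (27^-1 - J ^+ 2).

(** The three initial phases enter only through their product, hence a predicate and not a chosen
    curve. The nonpositive real part of [cubic] selects one of the two values with the given modulus
    and imaginary part. *)
Definition is_standard al J eta z : Prop :=
  [/\ is_flowA al eta z,
      [/\ nsq (z 0 o0 0) = 3^-1, nsq (z 0 o1 0) = 3^-1 & nsq (z 0 o2 0) = 3^-1] &
      cubic eta (z 0) = - base_height J +i* J].

Lemma Jmax_sq : (Jmax : R) ^+ 2 = 27^-1.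
Proof.
rewrite /Jmax exprVn exprMn sqr_sqrtr ?ler0n //; congr (_^-1); by ring.
Qed.

Lemma in_range_J (J : R) : 0 <= J <= Jmax -> 0 <= J /\ J ^+ 2 <= 27^-1.
Proof.
move=> /andP[J0 J1]; split => //; rewrite -Jmax_sq.
by rewrite ler_pXn2r ?nnegrE //; apply: le_trans J1.
Qed.

Lemma base_height_sq J : 0 <= J <= Jmax -> base_height J ^+ 2 = 27^-1 - J ^+ 2.
Proof. by move=> /in_range_J[_ h]; rewrite sqr_sqrtr // subr_ge0. Qed.

Lemma start_S5 w : [/\ nsq (w o0 0) = 3^-1, nsq (w o1 0) = 3^-1 & nsq (w o2 0) = 3^-1] ->
  S5 w.
Proof. by move=> [h0 h1 h2]; apply/S5E; rewrite h0 h1 h2; field. Qed.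

Lemma start_moment al w :
  [/\ nsq (w o0 0) = 3^-1, nsq (w o1 0) = 3^-1 & nsq (w o2 0) = 3^-1] ->
  moment al w = 0.
Proof. by move=> [h0 h1 h2]; rewrite /moment h0 h1 h2; ring. Qed.

Lemma standard_exists al J eta : nsq eta = 1 -> 0 <= J <= Jmax ->
  exists z, is_standard al J eta z.
Proof.
move=> e1 hJ; have hY := base_height_sq hJ.
pose r : R := Num.sqrt 3^-1.
have r2 : r ^+ 2 = 3^-1 by rewrite sqr_sqrtr // invr_ge0.
have r0 : r != 0 by rewrite sqrtr_eq0 -ltNge invr_gt0.
(* The third coordinate carries the whole phase: [r ^ 3 * om] has to be [eta] times the prescribed
   value of [cubic]. *)
pose om : R[i] := eta * (- base_height J +i* J) * ((r ^+ 3)^-1)%:C.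
have om1 : nsq om = 1.
  rewrite /om !nsqM e1 mul1r nsqR {1}/nsq /= sqrrN hY subrK exprVn.
  by rewrite -exprM mulnC exprM r2; field.
pose z0 := vec3 r%:C r%:C (r%:C * om).
have hz0 : [/\ nsq (z0 o0 0) = 3^-1, nsq (z0 o1 0) = 3^-1 & nsq (z0 o2 0) = 3^-1].
  by rewrite /z0 !v3E nsqM om1 mulr1 !nsqR r2.
have [z Hz zE] := flow_exists eta (crossA_sum0 al) (start_S5 hz0).
exists z; split; rewrite ?zE //.
rewrite /cubic /z0 !v3E /om.
have -> : eta^* * (r%:C * r%:C * (r%:C * (eta * (- base_height J +i* J) * ((r ^+ 3)^-1)%:C)))
  = (eta * eta^*) * (- base_height J +i* J) * (r ^+ 3 * (r ^+ 3)^-1)%:C.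
  by rewrite rmorphM /= rmorphXn; ring.
by rewrite nsqE e1 mul1r divff ?expf_neq0 // mulr1.
Qed.

(** Zero energy forces [z_1 = z_3 = 0], a point where the field vanishes; by uniqueness the curve
    would be constant there, against its value at time [0]. *)
Lemma flow_energy_gt0 al eta z t : 0 <= al <= 1 -> nsq eta = 1 -> is_flowA al eta z ->
  [/\ nsq (z 0 o0 0) = 3^-1, nsq (z 0 o1 0) = 3^-1 & nsq (z 0 o2 0) = 3^-1] ->
  0 < energy al (z t).
Proof.
move=> /andP[a0 a1] e1 H h0.
have [n0 n1 n2] := And3 (nsq_ge0 (z t o0 0)) (nsq_ge0 (z t o1 0)) (nsq_ge0 (z t o2 0)).
have p1 : 0 <= al ^+ 2 * nsq (z t o1 0) by rewrite mulr_ge0 // sqr_ge0.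
have p2 : 0 <= (1 + al) ^+ 2 * nsq (z t o2 0) by rewrite mulr_ge0 // sqr_ge0.
rewrite lt_neqAle; apply/andP; split; last by rewrite /energy; lra.
apply/eqP => E0.
have z0 : z t o0 0 = 0 by apply: nsq_eq0; move: E0; rewrite /energy; lra.
have z2 : z t o2 0 = 0.
  apply: nsq_eq0; have : (1 + al) ^+ 2 * nsq (z t o2 0) = 0.
    by move: E0; rewrite /energy; lra.
  move/eqP; rewrite mulf_eq0 => /orP[|/eqP //].
  by rewrite sqrf_eq0 => /eqP; lra.
have Hc : is_flowA al eta (fun _ => z t).
  move=> s; have -> : crossfield eta (- (1 + 2 * al)) (2 + al) (al - 1) (z t) = 0.
    by apply: vec3P; rewrite /crossfield !v3E mxE ?z0 ?z2 ?(mul0r, mulr0) rmorph0 mulr0.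
  by move=> j; rewrite mxE; exact: cder_cst.
have St : S5 (z t) by apply: (flow_S5 (crossA_sum0 al) H (start_S5 h0)).
have := flow_unique (crossA_sum0 al) H Hc St (erefl _) 0.
case: h0 => h00 _ _ E; move: h00; rewrite E z0 /nsq /= !expr0n addr0 => /esym/eqP.
by rewrite invr_eq0 pnatr_eq0.
Qed.

Lemma orbit_invariant al z : invariant_under (one_param_subgroup (genA al)) (orbit_surf al z).
Proof.
move=> g [s _ <-].
have Sh (c : R) : smooth (fun p : R * R => (p.1 + c, p.2)).
  move=> k; apply: Ck_pair; last exact: Ck_snd.
  by apply: Ck_add; [exact: Ck_fst|exact: Ck_cst].
exists (fun p => (p.1 + s, p.2)).
  split; first exact: Sh.
  exists (fun p => (p.1 - s, p.2)); split; first exact: Sh.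
  - by case=> a b /=; rewrite addrK.
  - by case=> a b /=; rewrite subrK.
by move=> p; rewrite expmx_genA /orbit_surf /= addrC torus_rotD.
Qed.

End OrbitSurfaces.

(** * Distinctness *)

Section SecondFundamentalForm.
Local Open Scope ring_scope.
Context {R : realType}.
Variables (al : R) (eta : R[i]).
Hypothesis eta1 : nsq eta = 1.
Hypothesis al0 : 0 <= al.
Implicit Types (w : 'cV[R[i]]_3).

Local Notation A := (torus_gen al).
Local Notation F := (crossA al eta).

(** The weights [a_j] are the roots of [X^3 - gen_quad X + gen_det], and [gen_disc] is up to sign
    the product of their differences. *)
Definition gen_disc : R := (al - 1) * (2 * al + 1) * (al + 2).
Definition gen_quad : R := 1 + al + al ^+ 2.
Definition gen_det : R := al * (1 + al).

Lemma rdot_gen_skew x y : rdot (A x) y = - rdot x (A y).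
Proof.
rewrite !rdotH /torus_gen !v3E !(conjMc, conj_i, conj_real) -ReNc; congr Re.
by ring.
Qed.

Lemma rdot_gen2_self w : rdot (A (A w)) w = - energy al w.
Proof. by rewrite rdot_gen_skew rdot_gen_gen. Qed.

Lemma rdot_gen2_gen w : rdot (A (A w)) (A w) = 0.
Proof. by rewrite rdotC rdot_self_gen. Qed.

Lemma rdot_gen2_cross w : rdot (A (A w)) (F w) = - (gen_disc * Re (cubic eta w)).
Proof.
rewrite -mulNr -ReZ rdotH /crossA /crossfield /torus_gen /cubic !v3E.
rewrite !conjMc !conjKc !conj_real; congr (Re _).
have i2 := mulii; have -> : (- gen_disc)%:C =
    ('i%C * 'i%C) * (- (1 + 2 * al) + al ^+ 2 * (2 + al) + (-1 - al) ^+ 2 * (al - 1))%:C.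
  by rewrite i2 mulN1r -rmorphN /gen_disc; congr (_%:C); ring.
have P (a b : R) : (a + b)%:C = a%:C + b%:C by rewrite rmorphD.
have M (a b : R) : (a * b)%:C = a%:C * b%:C by rewrite rmorphM.
rewrite !expr2; move: (- (1 + 2 * al)) (2 + al) (al - 1) (-1 - al) => c0 c1 c2 a2.
rewrite !P !M; move: ('i%C) (w o0 0) (w o1 0) (w o2 0) (eta^*) => i x y z e.
by ring.
Qed.

Lemma rdot_gencross_self w : rdot (A (F w)) w = 0.
Proof. by rewrite rdot_gen_skew rdotC rdot_gen_cross oppr0. Qed.

Lemma rdot_gencross_gen w : rdot (A (F w)) (A w) = gen_disc * Re (cubic eta w).
Proof. by rewrite rdot_gen_skew rdotC rdot_gen2_cross opprK. Qed.

Lemma rdot_gencross_cross w : rdot (A (F w)) (F w) = 0.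
Proof. by rewrite rdotC rdot_self_gen. Qed.

(** The product is a multiple of the sum of the [a_j^3 c_j]. Since [a_j^3] is a combination of [a_j]
    and [1], and [c] is orthogonal to both vectors, this sum is zero. *)
Lemma rdot_gen2_gencross w : rdot (A (A w)) (A (F w)) = 0.
Proof.
rewrite rdotH /crossA /crossfield /torus_gen !v3E.
rewrite !conjMc !conjKc !conj_real conj_i.
have P (a b : R) : (a + b)%:C = a%:C + b%:C by rewrite rmorphD.
have M (a b : R) : (a * b)%:C = a%:C * b%:C by rewrite rmorphM.
have : 0%:C = (- (1 + 2 * al) + al * al * al * (2 + al) +
  (-1 - al) * (-1 - al) * (-1 - al) * (al - 1))%:C :> R[i] by congr (_%:C); ring.
move: (- (1 + 2 * al)) (2 + al) (al - 1) (-1 - al) => c0 c1 c2 a2.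
rewrite !P !M; move: ('i%C) (w o0 0) (w o1 0) (w o2 0) (eta^*) => i x y z e h.
rewrite (_ : _ + _ = - (i * i * i * e * x * y * z) *
  (c0%:C + al%:C * al%:C * al%:C * c1%:C + a2%:C * a2%:C * a2%:C * c2%:C)).
  by rewrite -h mulr0.
by ring.
Qed.

(** The cubic equation of the weights reduces higher moments to [energy], [moment] and the norm; the
    same holds for the third power below. *)
Lemma rdot_gen2_gen2 w : moment al w = 0 ->
  rdot (A (A w)) (A (A w)) = gen_quad * energy al w.
Proof.
move=> h; rewrite rdot_nsq /torus_gen !v3E !nsqM nsq_i !nsqR.
have -> : gen_quad * energy al w = gen_quad * energy al w - gen_det * moment al w.
  by rewrite h mulr0 subr0.
by rewrite /gen_quad /gen_det /energy /moment; move: (nsq _) (nsq _) (nsq _) => *; ring.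
Qed.

Lemma rdot_gen3_gen3 w : S5 w -> moment al w = 0 ->
  rdot (A (A (A w))) (A (A (A w))) = gen_quad ^+ 2 * energy al w + gen_det ^+ 2.
Proof.
move=> /S5E h1 h; rewrite rdot_nsq /torus_gen !v3E !nsqM nsq_i !nsqR.
have -> : gen_quad ^+ 2 * energy al w + gen_det ^+ 2 =
    gen_quad ^+ 2 * energy al w - 2 * gen_quad * gen_det * moment al w +
    gen_det ^+ 2 * (nsq (w o0 0) + nsq (w o1 0) + nsq (w o2 0)).
  by rewrite h h1 mulr0 subr0 mulr1.
by rewrite /gen_quad /gen_det /energy /moment; move: (nsq _) (nsq _) (nsq _) => *; ring.
Qed.

(** The two linear conditions on the [|w_j|^2] leave the line through [(1/3, 1/3, 1/3)] directed by
    the coefficients [c]. Identities in [w] become polynomial identities in [g]. *)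
Lemma moment_line w : S5 w -> moment al w = 0 -> exists g,
  [/\ nsq (w o0 0) = 3^-1 - (1 + 2 * al) * g, nsq (w o1 0) = 3^-1 + (2 + al) * g
    & nsq (w o2 0) = 3^-1 + (al - 1) * g].
Proof.
move=> /S5E; rewrite /moment; move: (nsq _) (nsq _) (nsq _) => n2 n1 n0 h1 h2.
have a0 := al0; have a1' : 0 < 1 + al by lra.
have a2' : 0 < 1 + 2 * al by lra.
have a1 : 1 + al != 0 by rewrite gt_eqF.
have a2 : 1 + 2 * al != 0 by rewrite gt_eqF.
have E2 : n2 = 1 - n0 - n1 by lra.
have E : (2 + al) * n0 + (1 + 2 * al) * n1 = 1 + al.
  by move: h2; rewrite E2 => h2; rewrite -[RHS]addr0 -h2; ring.
exists ((n1 - n0) / (3 * (1 + al))).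
have n1E : n1 = (1 + al - (2 + al) * n0) / (1 + 2 * al).
  by rewrite -E; field.
by rewrite E2 n1E; split; field; rewrite a1 a2.
Qed.

Lemma rdot_gencross_gencross w : S5 w -> moment al w = 0 ->
  rdot (A (F w)) (A (F w)) = gen_quad * energy al w - energy al w ^+ 2.
Proof.
move=> h1 h2; have [g [n0 n1 n2]] := moment_line h1 h2.
rewrite rdot_nsq /crossA /crossfield /torus_gen !v3E !nsqM nsq_i !nsqJ !nsqM !nsqR eta1.
by rewrite /energy /gen_quad n0 n1 n2; field.
Qed.

Lemma nsq_cubic w : nsq (cubic eta w) = nsq (w o0 0) * nsq (w o1 0) * nsq (w o2 0).
Proof. by rewrite /cubic !nsqM nsqJ eta1 mul1r. Qed.

(** Along the flow the energy has derivative [2 gen_disc Re cubic], so this is a first-order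
    equation for it, with cubic right-hand side and conserved constant. *)
Lemma energy_equation w : S5 w -> moment al w = 0 ->
  gen_quad * energy al w ^+ 2 - energy al w ^+ 3 -
    (gen_disc * Re (cubic eta w)) ^+ 2 =
  gen_det ^+ 2 + (gen_disc * Im (cubic eta w)) ^+ 2.
Proof.
move=> h1 h2; have [g [n0 n1 n2]] := moment_line h1 h2.
have := nsq_cubic w; rewrite {1}/nsq => h.
rewrite exprMn (_ : Re _ ^+ 2 = nsq (w o0 0) * nsq (w o1 0) * nsq (w o2 0)
  - Im (cubic eta w) ^+ 2); last by rewrite -h addrK.
rewrite /energy n0 n1 n2 /gen_quad /gen_disc /gen_det.
by move: (Im _) => y; field.
Qed.

Lemma vder_gen (V : normedModType R) (p v : V) f d : vder p v f d ->
  vder p v (fun q => A (f q)) (A d).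
Proof.
by move=> H; apply: vder_vec3; apply: cderZ; exact: H.
Qed.

(* The last term says that [w] satisfies [w_ss + w_tt = - 2 E w]. *)
Lemma vder_cross (V : normedModType R) (p v : V) (f : V -> 'cV[R[i]]_3) (a b : R) :
  S5 (f p) -> moment al (f p) = 0 ->
  vder p v f (a%:C *: A (f p) + b%:C *: F (f p)) ->
  vder p v (fun q => F (f q)) (a%:C *: A (F (f p)) -
    b%:C *: (A (A (f p)) + (2 * energy al (f p))%:C *: f p)).
Proof.
move=> h1 h2 H; have [g [n0 n1 n2]] := moment_line h1 h2.
have e1 : eta * eta^* = 1 by rewrite nsqE eta1.
(* Differentiating [F] along [F] multiplies [w_j] by [c_j] times a combination of the other two
   [|w_k|^2]; on the line above this factor is [a_j^2 - 2 E]. *)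
have [k0 k1 k2] : [/\ - (1 + 2 * al) * ((al - 1) * nsq (f p o1 0) + (2 + al) * nsq (f p o2 0)) =
      1 - 2 * energy al (f p),
    (2 + al) * (- (1 + 2 * al) * nsq (f p o2 0) + (al - 1) * nsq (f p o0 0)) =
      al * al - 2 * energy al (f p) &
    (al - 1) * ((2 + al) * nsq (f p o0 0) - (1 + 2 * al) * nsq (f p o1 0)) =
      (-1 - al) * (-1 - al) - 2 * energy al (f p)].
  by rewrite /energy n0 n1 n2; split; field.
have P (x y : R) : (x + y)%:C = x%:C + y%:C by rewrite rmorphD.
have N (x : R) : (- x)%:C = - x%:C by rewrite rmorphN.
have M (x y : R) : (x * y)%:C = x%:C * y%:C by rewrite rmorphM.
have i2 := mulii (R := R).
clear n0 n1 n2.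
move: (nsqE (f p o0 0)) (nsqE (f p o1 0)) (nsqE (f p o2 0)) k0 k1 k2.
move: (nsq (f p o0 0)) (nsq (f p o1 0)) (nsq (f p o2 0)) (energy al (f p)).
move=> m0 m1 m2 E N0 N1 N2.
move=> /(congr1 (real_complex R)) k0 /(congr1 (real_complex R)) k1 /(congr1 (real_complex R)) k2.
have O : 1%:C = 1 :> R[i] by [].
move: k0 k1 k2; rewrite !(P, N, M, O) -N0 -N1 -N2 => k0 k1 k2.
apply: vder_eq; last first.
  apply: vder_vec3; apply: cderZ; apply: cderJ; apply: cderM; exact: H.
apply: vec3P; rewrite !v3E !mxE /crossA /crossfield /torus_gen ?v3E;
rewrite ?(conjMc, conjDc, conjKc, conj_real, conj_i) !(P, N, M, O) /=;
apply/eqP; rewrite -subr_eq0; apply/eqP;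
move: k0 k1 k2 e1 i2; clear;
move: (f p o0 0) (f p o1 0) (f p o2 0) => x y z;
move: (x^*) (y^*) (z^*) (eta^*) => x' y' z' e';
move: (a%:C) (b%:C) (al%:C) (E%:C) ('i%C) => {}a {}b l {}E i;
move=> k0 k1 k2 e1 i2.
- set K := - (1 + (1 + 1) * l) * ((l - 1) * (y * y') + (1 + 1 + l) * (z * z')) in k0.
  transitivity (b * x * ((eta * e' - 1) * K + (K - (1 - (1 + 1) * E)) + (i * i - -1))).
    by rewrite /K; ring.
  by rewrite e1 k0 i2; ring.
- set K := (1 + 1 + l) * _ in k1.
  transitivity (b * y * ((eta * e' - 1) * K + (K - (l * l - (1 + 1) * E)) + l * l * (i * i - -1))).
    by rewrite /K; ring.
  by rewrite e1 k1 i2; ring.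
- set K := (l - 1) * _ in k2.
  transitivity (b * z * ((eta * e' - 1) * K + (K - ((- 1 - l) * (- 1 - l) - (1 + 1) * E)) +
     (- 1 - l) * (- 1 - l) * (i * i - -1))).
    by rewrite /K; ring.
  by rewrite e1 k2 i2; ring.
Qed.

End SecondFundamentalForm.

(** * Isometries of the sphere as real linear maps *)

Section SphereIsometries.
Local Open Scope ring_scope.
Context {R : realType}.
Implicit Types (x y w : 'cV[R[i]]_3) (g : 'cV[R[i]]_3 -> 'cV[R[i]]_3).

Lemma rdot_S5_bound x y : S5 x -> S5 y -> -1 <= rdot x y <= 1.
Proof.
move=> hx hy; have := rdot_ge0 (x + y); have := rdot_ge0 (x - y).
rewrite !rdotDl !rdotDr !rdotNl !rdotNr (rdotC y x) hx hy => h1 h2.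
by apply/andP; split; lra.
Qed.

Lemma isometry_S5_S5 g x : isometry_S5 g -> S5 x -> S5 (g x).
Proof.
move=> [gi _] hx; suff : (g @` S5) (g x) by rewrite gi.
by exists x.
Qed.

Lemma isometry_rdot g x y : isometry_S5 g -> S5 x -> S5 y ->
  rdot (g x) (g y) = rdot x y.
Proof.
move=> ig hx hy; have [_ /(_ x y hx hy)] := ig; rewrite /S5dist => h.
rewrite -(acosK (rdot_S5_bound hx hy)) -h acosK //.
by apply: rdot_S5_bound; exact: isometry_S5_S5.
Qed.

Definition rbasis (i : 'I_3 * bool) : 'cV[R[i]]_3 :=
  \col_j (if j == i.1 then (if i.2 then 'i%C else 1) else 0).

Lemma sum_rbasis (A : nmodType) (F : 'I_3 * bool -> A) : \sum_i F i =
  F (o0, true) + F (o0, false) + (F (o1, true) + F (o1, false)) +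
  (F (o2, true) + F (o2, false)).
Proof.
transitivity (\sum_(j : 'I_3) \sum_(b : bool) F (j, b)).
  by rewrite pair_bigA; apply: eq_bigr => -[].
by rewrite sum3 !big_bool.
Qed.

Lemma rdot_rbasis x i : rdot x (rbasis i) = if i.2 then Im (x i.1 0) else Re (x i.1 0).
Proof.
case: i => j b; move: j; apply: ord3P; case: b; rewrite rdotE !mxE /=; ring.
Qed.

Lemma S5_rbasis i : S5 (rbasis i).
Proof.
rewrite /S5 /= rdot_rbasis; case: i => j b; move: j; apply: ord3P;
by case: b; rewrite mxE.
Qed.

Lemma rbasis_decomp x : x = \sum_i (rdot x (rbasis i))%:C *: rbasis i.
Proof.
apply: vec3P; rewrite summxE sum_rbasis !mxE !rdot_rbasis /= !mulr0 ?addr0 ?add0r;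
by apply: ceq; rewrite !cpartE /=; ring.
Qed.

Lemma rdot_suml (I : Type) (r : seq I) (f : I -> 'cV[R[i]]_3) y :
  rdot (\sum_(i <- r) f i) y = \sum_(i <- r) rdot (f i) y.
Proof.
elim: r => [|i r IH]; last by rewrite !big_cons rdotDl IH.
by rewrite !big_nil rdotE !mxE /= !mul0r !addr0.
Qed.

(** The real linear map with the values of [g] on an orthonormal basis of [R^6]. Unlike [g], it can
    be applied to derivatives. *)
Definition lin_ext g x : 'cV[R[i]]_3 := \sum_i (rdot x (rbasis i))%:C *: g (rbasis i).

Lemma rdot_lin_ext g x y : isometry_S5 g -> S5 y -> rdot (lin_ext g x) (g y) = rdot x y.
Proof.
move=> ig hy; rewrite /lin_ext rdot_suml [in RHS](rbasis_decomp x) rdot_suml.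
apply: eq_bigr => i _; rewrite !rdotZl (isometry_rdot ig) //; exact: S5_rbasis.
Qed.

Lemma rdot_lin_ext2 g x y : isometry_S5 g -> rdot (lin_ext g x) (lin_ext g y) = rdot x y.
Proof.
move=> ig; rewrite rdotC [X in rdot X _]/lin_ext rdot_suml [in RHS](rbasis_decomp y).
rewrite [in RHS]rdotC rdot_suml.
by apply: eq_bigr => i _; rewrite !rdotZl (rdotC (g _)) rdot_lin_ext ?(rdotC x) //; exact: S5_rbasis.
Qed.

Lemma isometry_lin_ext g x : isometry_S5 g -> S5 x -> g x = lin_ext g x.
Proof.
move=> ig hx; apply/eqP; rewrite -subr_eq0; apply/eqP/rdot_eq0.
rewrite rdotDl !rdotDr !rdotNl !rdotNr rdot_lin_ext2 // (rdotC (g x)) rdot_lin_ext //.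
by rewrite isometry_rdot //; ring.
Qed.

Lemma vder_cst (V : normedModType R) (p v : V) c : vder p v (fun _ => c) 0.
Proof. by move=> j; apply: cder_eq (cder_cst p v (c j 0)); rewrite mxE. Qed.

Lemma vder_sum (V : normedModType R) (p v : V) (I : Type) (r : seq I)
    (f : I -> V -> 'cV[R[i]]_3) d :
  (forall i, vder p v (f i) (d i)) ->
  vder p v (fun q => \sum_(i <- r) f i q) (\sum_(i <- r) d i).
Proof.
move=> H; elim: r => [|i r IH].
  rewrite big_nil; apply: vder_ext (vder_cst p v 0) => q.
  by rewrite big_nil.
rewrite big_cons; apply: vder_ext (vderD (H i) IH) => q.
by rewrite big_cons.
Qed.

Lemma vder_lin_ext (V : normedModType R) (p v : V) f d g : vder p v f d ->
  vder p v (fun q => lin_ext g (f q)) (lin_ext g d).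
Proof.
move=> H; apply: vder_sum => i.
have c0 := vder_cst p v (g (rbasis i)).
have D : is_derive p v (fun q => rdot (f q) (rbasis i)) (rdot d (rbasis i)).
  have b0 := vder_cst p v (rbasis i).
  apply: is_derive_ext (vder_rdot H b0) => //.
  by rewrite [X in X + _](_ : _ = 0) ?add0r // rdotE !mxE /= !mulr0 !addr0.
by apply: vder_eq (vder_scale D c0); rewrite scaler0 add0r.
Qed.

End SphereIsometries.

Section MapsIntoPlane.
Local Open Scope ring_scope.
Context {R : realType} {V : normedModType R}.

Lemma Ck_components k (f : V -> R * R) : is_Ck k f ->
  is_Ck k (fun q => (f q).1) /\ is_Ck k (fun q => (f q).2).
Proof.
have cont j (g : V -> R * R) : is_Ck j g ->
    continuous (fun q => (g q).1) /\ continuous (fun q => (g q).2).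
  move=> H; split=> x; have c := Ck_continuous H (x := x).
    exact: (continuous_comp c (@cvg_fst _ _ _ _ _)).
  exact: (continuous_comp c (@cvg_snd _ _ _ _ _)).
elim: k f => [|k IH] f Hf; first by have [] := cont _ _ Hf.
have [c1 c2] := cont _ _ Hf.
have key v x : is_derive x v (fun q => (f q).1) ('D_v f x).1 /\
               is_derive x v (fun q => (f q).2) ('D_v f x).2.
  have [_ /(_ v)[/(_ x) df _]] := Hf.
  have cv : (fun h : R => h^-1 *: ((f \o shift x) (h *: v) - f x)) @ 0^' --> 'D_v f x by [].
  have F1 : (fst : R * R -> R) @ ('D_v f x) --> ('D_v f x).1 by exact: cvg_fst.
  have F2 : (snd : R * R -> R) @ ('D_v f x) --> ('D_v f x).2 by exact: cvg_snd.
  split.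
    have c : (fun h : R => h^-1 *: (((fun q => (f q).1) \o shift x) (h *: v) - (f x).1)) @ 0^'
      --> ('D_v f x).1 by exact: (cvg_comp _ _ cv F1).
    by split; [apply/cvg_ex; eexists; exact: c|exact: cvg_lim].
  have c : (fun h : R => h^-1 *: (((fun q => (f q).2) \o shift x) (h *: v) - (f x).2)) @ 0^'
      --> ('D_v f x).2 by exact: (cvg_comp _ _ cv F2).
  by split; [apply/cvg_ex; eexists; exact: c|exact: cvg_lim].
have cd v : is_Ck k ('D_v f) by have [_ /(_ v)[]] := Hf.
split; apply: CkS_derive => // v.
  exists (fun x => ('D_v f x).1); first by have [] := IH _ (cd v).
  by move=> x; have [] := key v x.
exists (fun x => ('D_v f x).2); first by have [] := IH _ (cd v).
by move=> x; have [] := key v x.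
Qed.

End MapsIntoPlane.

(** * Recovering the parameters from the geometry of the surface *)

Section Rigidity.
Local Open Scope ring_scope.
Context {R : realType}.

(* [E] times the squared norm of the normal part of [u_ss]. *)
Definition second_form_norm (al J : R) : R := gen_det al ^+ 2 + (gen_disc al * J) ^+ 2.

Lemma torus_genD (al : R) (x y : 'cV[R[i]]_3) : torus_gen al (x + y) = torus_gen al x + torus_gen al y.
Proof. by apply: vec3P; rewrite /torus_gen !mxE /= ?mxE; ring. Qed.

Lemma torus_genZ (al : R) (c : R[i]) (x : 'cV[R[i]]_3) : torus_gen al (c *: x) = c *: torus_gen al x.
Proof. by apply: vec3P; rewrite /torus_gen !mxE /= ?mxE; ring. Qed.

Lemma rdot_comb (k x y : 'cV[R[i]]_3) (a b : R) :
  rdot k (a%:C *: x + b%:C *: y) = a * rdot k x + b * rdot k y.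
Proof. by rewrite rdotDr !rdotZr. Qed.

(** The matrix with rows [(a1, b1)] and [(a2, b2)] is [sqrt r] times an orthogonal one. The second
    row is the first turned by a right angle and scaled by [D / r]. *)
Lemma frame_change (r a1 b1 a2 b2 x y : R) : 0 < r -> a1 * a1 + b1 * b1 = r ->
  a2 * a2 + b2 * b2 = r -> a1 * a2 + b1 * b2 = 0 ->
  (a1 * x + b1 * y) ^+ 2 + (a2 * x + b2 * y) ^+ 2 = r * (x ^+ 2 + y ^+ 2).
Proof.
move=> r0 h1 h2 h3; have r1 : r != 0 by rewrite gt_eqF.
pose D := a1 * b2 - a2 * b1.
have ea : r * a2 = - (b1 * D).
  transitivity (a1 * (a1 * a2 + b1 * b2) - b1 * D); first by rewrite -h1 /D; ring.
  by rewrite h3; ring.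
have eb : r * b2 = a1 * D.
  transitivity (b1 * (a1 * a2 + b1 * b2) + a1 * D); first by rewrite -h1 /D; ring.
  by rewrite h3; ring.
have D2 : D ^+ 2 = r ^+ 2.
  transitivity ((a1 * a1 + b1 * b1) * (a2 * a2 + b2 * b2) - (a1 * a2 + b1 * b2) ^+ 2).
    by rewrite /D; ring.
  by rewrite h1 h2 h3; ring.
apply: (mulfI (expf_neq0 2 r1)).
transitivity (r ^+ 2 * (a1 * x + b1 * y) ^+ 2 + (r * a2 * x + r * b2 * y) ^+ 2); first by ring.
rewrite ea eb.
transitivity (r ^+ 2 * (a1 * x + b1 * y) ^+ 2 + D ^+ 2 * (a1 * y - b1 * x) ^+ 2); first by ring.
by rewrite D2 -h1; ring.
Qed.

(** The left-hand side is the squared norm of the part of [h] orthogonal to [w], [A] and [F], so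
    [n], [t1] and [t2] drop out; the corresponding parts of [A2] and [AF] are orthogonal and equally
    long. *)
Lemma normal_part_gram (w A F A2 AF : 'cV[R[i]]_3) (E m q k l n t1 t2 : R) : E != 0 ->
  [/\ rdot A2 w = - E, rdot A2 A = 0, rdot A2 F = - m, rdot A2 AF = 0 & rdot A2 A2 = q * E] ->
  [/\ rdot AF w = 0, rdot AF A = m, rdot AF F = 0 & rdot AF AF = q * E - E ^+ 2] ->
  [/\ rdot w w = 1, rdot w A = 0 & rdot w F = 0] ->
  [/\ rdot A A = E, rdot A F = 0 & rdot F F = E] ->
  let h := k%:C *: A2 + l%:C *: AF + n%:C *: w + t1%:C *: A + t2%:C *: F in
  rdot h h - rdot h w ^+ 2 - (rdot h A ^+ 2 + rdot h F ^+ 2) / E =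
  (k ^+ 2 + l ^+ 2) * (q * E ^+ 2 - E ^+ 3 - m ^+ 2) / E.
Proof.
move=> E1 [g1 g2 g3 g4 g5] [g6 g7 g8 g9] [g10 g11 g12] [g13 g14 g15] h.
have hX X : rdot h X = k * rdot A2 X + l * rdot AF X + n * rdot w X + t1 * rdot A X +
    t2 * rdot F X by rewrite /h !rdotDl !rdotZl.
have ew : rdot h w = - (k * E) + n.
  by rewrite hX g1 g6 g10 (rdotC A) g11 (rdotC F) g12; ring.
have eA : rdot h A = l * m + t1 * E.
  by rewrite hX g2 g7 g11 g13 (rdotC F) g14; ring.
have eF : rdot h F = - (k * m) + t2 * E.
  by rewrite hX g3 g8 g12 g14 g15; ring.
have eA2 : rdot h A2 = k * (q * E) - n * E - t2 * m.
  rewrite hX g5 (rdotC AF) g4 (rdotC w) g1 (rdotC A) g2 (rdotC F) g3; ring.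
have eAF : rdot h AF = l * (q * E - E ^+ 2) + t1 * m.
  rewrite hX g4 g9 (rdotC w) g6 (rdotC A) g7 (rdotC F) g8; ring.
have ehh : rdot h h = k * rdot h A2 + l * rdot h AF + n * rdot h w + t1 * rdot h A +
    t2 * rdot h F.
  by rewrite {2}/h !rdotDr !rdotZr.
by rewrite ehh eA2 eAF ew eA eF; field.
Qed.

Lemma normal_part (al : R) eta w (k l n t1 t2 : R) (h : 'cV[R[i]]_3) :
  nsq eta = 1 -> 0 <= al -> S5 w -> moment al w = 0 -> 0 < energy al w ->
  h = k%:C *: torus_gen al (torus_gen al w) + l%:C *: torus_gen al (crossA al eta w) +
      n%:C *: w + t1%:C *: torus_gen al w + t2%:C *: crossA al eta w ->
  rdot h h - rdot h w ^+ 2 -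
    (rdot h (torus_gen al w) ^+ 2 + rdot h (crossA al eta w) ^+ 2) / energy al w =
  (k ^+ 2 + l ^+ 2) * second_form_norm al (Im (cubic eta w)) / energy al w.
Proof.
move=> e1 a0 h1 h2 E0 ->.
have E1 : energy al w != 0 by rewrite gt_eqF.
have := energy_equation e1 a0 h1 h2; rewrite -/(second_form_norm _ _) => <-.
apply: normal_part_gram => //; split => //.
- exact: rdot_gen2_self.
- exact: rdot_gen2_gen.
- exact: rdot_gen2_cross.
- exact: rdot_gen2_gencross.
- exact: rdot_gen2_gen2.
- exact: rdot_gencross_self.
- exact: rdot_gencross_gen.
- exact: rdot_gencross_cross.
- exact: rdot_gencross_gencross.
- exact: rdot_self_gen.
- exact: rdot_self_cross.
- exact: rdot_gen_gen.
- exact: rdot_gen_cross.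
- exact: rdot_cross_cross.
Qed.

Variables (al J al' J' : R) (eta : R[i]).
Hypotheses (al01 : 0 <= al <= 1) (al01' : 0 <= al' <= 1).
Hypothesis eta1 : nsq eta = 1.
Variables (z z' : R -> 'cV[R[i]]_3).
Hypotheses (std : is_standard al J eta z) (std' : is_standard al' J' eta z').
Variables (g : 'cV[R[i]]_3 -> 'cV[R[i]]_3) (phi : R * R -> R * R).
Hypotheses (ig : isometry_S5 g) (sphi : smooth phi).
Hypothesis V_eq : forall p, orbit_surf al' z' p = g (orbit_surf al z (phi p)).

Let s p := (phi p).1.
Let t p := (phi p).2.
Let W p := orbit_surf al z (phi p).
Let V p := orbit_surf al' z' p.
Let e1 : R * R := (1, 0).
Let e2 : R * R := (0, 1).

Let Ds (v p : R * R) := 'D_v s p.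
Let Dt (v p : R * R) := 'D_v t p.

Let s_derive v p : is_derive p v s (Ds v p).
Proof.
have [h _] := Ck_components (sphi 1).
by have [] := CkS_inv v h.
Qed.

Let t_derive v p : is_derive p v t (Dt v p).
Proof.
have [_ h] := Ck_components (sphi 1).
by have [] := CkS_inv v h.
Qed.

Let Ds_derive u v p : is_derive p u (Ds v) ('D_u (Ds v) p).
Proof.
have [h _] := Ck_components (sphi 2).
by have [_ h'] := CkS_inv v h; have [] := CkS_inv u h'.
Qed.

Let Dt_derive u v p : is_derive p u (Dt v) ('D_u (Dt v) p).
Proof.
have [_ h] := Ck_components (sphi 2).
by have [_ h'] := CkS_inv v h; have [] := CkS_inv u h'.
Qed.

Lemma standard_facts a j y (p : R * R) : 0 <= a <= 1 -> is_standard a j eta y ->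
  [/\ S5 (orbit_surf a y p), moment a (orbit_surf a y p) = 0,
      0 < energy a (orbit_surf a y p) & Im (cubic eta (orbit_surf a y p)) = j].
Proof.
move=> a01 [H h0 hc]; split.
- by apply: S5_rot; apply: (flow_S5 (crossA_sum0 a) H (start_S5 h0)).
- by rewrite /orbit_surf moment_rot (flow_moment 0 _ H) start_moment.
- rewrite /orbit_surf energy_rot; exact: flow_energy_gt0 H h0.
- by rewrite /orbit_surf cubic_rot (flow_Im_cubic eta1 0 _ H) hc.
Qed.

Let WP p := standard_facts (phi p) al01 std.
Let VP p := standard_facts p al01' std'.

Let vder_W v p : vder p v W
  ((Ds v p)%:C *: torus_gen al (W p) + (Dt v p)%:C *: crossA al eta (W p)).
Proof. by case: std => H _ _; apply: vder_orbit H (s_derive v p) (t_derive v p). Qed.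

Let vder_V v p : vder p v V
  ((v.1)%:C *: torus_gen al' (V p) + (v.2)%:C *: crossA al' eta (V p)).
Proof. by case: std' => H _ _; apply: vder_orbit H (is_derive_fst p v) (is_derive_snd p v). Qed.

Let V_lin p : V p = lin_ext g (W p).
Proof. by rewrite -isometry_lin_ext //; have [] := WP p. Qed.

Let frame_eq v p : (v.1)%:C *: torus_gen al' (V p) + (v.2)%:C *: crossA al' eta (V p) =
  lin_ext g ((Ds v p)%:C *: torus_gen al (W p) + (Dt v p)%:C *: crossA al eta (W p)).
Proof.
apply: (vder_unique (vder_V v p)); apply: vder_ext (vder_lin_ext g (vder_W v p)) => q.
by rewrite V_lin.
Qed.

Lemma pullback_metric u v p :
  (u.1 * v.1 + u.2 * v.2) * energy al' (V p) =
  (Ds u p * Ds v p + Dt u p * Dt v p) * energy al (W p).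
Proof.
have [h1 h2 _ _] := VP p; have [k1 k2 _ _] := WP p.
by rewrite -(rdot_frame _ _ _ _ eta1 h1 h2) !frame_eq rdot_lin_ext2 // rdot_frame.
Qed.

(** Both induced metrics are conformal to the flat one, so [phi] is conformal between flat planes,
    with this factor on squared lengths. *)
Definition scale p : R := energy al' (V p) / energy al (W p).

Lemma scale_gt0 p : 0 < scale p.
Proof. by have [_ _ h _] := VP p; have [_ _ k _] := WP p; rewrite divr_gt0. Qed.

Lemma energy_scale p : energy al' (V p) = scale p * energy al (W p).
Proof. by have [_ _ k _] := WP p; rewrite divfK // gt_eqF. Qed.

Lemma conformal_frame p :
  [/\ Ds e1 p * Ds e1 p + Dt e1 p * Dt e1 p = scale p,
      Ds e2 p * Ds e2 p + Dt e2 p * Dt e2 p = scale p &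
      Ds e1 p * Ds e2 p + Dt e1 p * Dt e2 p = 0].
Proof.
have [_ _ k _] := WP p; have k0 : energy al (W p) != 0 by rewrite gt_eqF.
split; apply: (mulIf k0); rewrite -pullback_metric ?mul0r ?energy_scale /=; ring.
Qed.

Let e1_comb (x y : 'cV[R[i]]_3) : (e1.1)%:C *: x + (e1.2)%:C *: y = x.
Proof. by rewrite (_ : (e1.1)%:C = 1) // (_ : (e1.2)%:C = 0) // scale1r scale0r addr0. Qed.

Let e2_comb (x y : 'cV[R[i]]_3) : (e2.1)%:C *: x + (e2.2)%:C *: y = y.
Proof. by rewrite (_ : (e2.1)%:C = 0) // (_ : (e2.2)%:C = 1) // scale1r scale0r add0r. Qed.

Let A2_eq p : torus_gen al' (torus_gen al' (V p)) = lin_ext g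
  ((Ds e1 p)%:C *: torus_gen al ((Ds e1 p)%:C *: torus_gen al (W p) +
      (Dt e1 p)%:C *: crossA al eta (W p)) + ('D_e1 (Ds e1) p)%:C *: torus_gen al (W p) +
   ((Dt e1 p)%:C *: ((Ds e1 p)%:C *: torus_gen al (crossA al eta (W p)) -
      (Dt e1 p)%:C *: (torus_gen al (torus_gen al (W p)) + (2 * energy al (W p))%:C *: W p)) +
    ('D_e1 (Dt e1) p)%:C *: crossA al eta (W p))).
Proof.
have [k1 k2 k3 _] := WP p.
have H1 : vder p e1 (fun q => torus_gen al' (V q)) (torus_gen al' (torus_gen al' (V p))).
  have := vder_gen al' (vder_V e1 p).
  by rewrite e1_comb.
apply: (vder_unique H1).
have a0 : 0 <= al by case/andP: al01.
have HF := vder_cross (f := W) eta1 a0 k1 k2 (vder_W e1 p).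
apply: vder_ext (vder_lin_ext g (vderD
  (vder_scale (Ds_derive e1 e1 p) (vder_gen al (vder_W e1 p)))
  (vder_scale (Dt_derive e1 e1 p) HF))) => q.
by rewrite -frame_eq e1_comb.
Qed.

(** With [N] and [N'] the two constants, the normal part of [V_ss] has squared norm [N' / E']. In
    the frame of [W] its coefficients are [a^2 - b^2] and [2 a b] with [a^2 + b^2 = r], so it is
    also [r^2 N / E]; finally [E' = r E]. *)
Lemma scale_cubed p : second_form_norm al' J' = scale p ^+ 3 * second_form_norm al J.
Proof.
have [h1 h2 h3 h4] := VP p; have [k1 k2 k3 k4] := WP p.
have a0 : 0 <= al by case/andP: al01.
have a0' : 0 <= al' by case/andP: al01'.
have [c1 c2 c3] := conformal_frame p.
have r0 := scale_gt0 p.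
set h := torus_gen al' (torus_gen al' (V p)).
have hN : h = (1%:C) *: torus_gen al' (torus_gen al' (V p)) +
   (0%:C) *: torus_gen al' (crossA al' eta (V p)) + (0%:C) *: V p +
   (0%:C) *: torus_gen al' (V p) + (0%:C) *: crossA al' eta (V p).
  by rewrite scale1r !scale0r !addr0.
have N1 := normal_part eta1 a0' h1 h2 h3 hN.
move: (A2_eq p); set k := (X in lin_ext g X) => hk.
have kN : k = (Ds e1 p ^+ 2 - Dt e1 p ^+ 2)%:C *: torus_gen al (torus_gen al (W p)) +
   (2 * Ds e1 p * Dt e1 p)%:C *: torus_gen al (crossA al eta (W p)) +
   (- (2 * Dt e1 p ^+ 2 * energy al (W p)))%:C *: W p +
   ('D_e1 (Ds e1) p)%:C *: torus_gen al (W p) +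
   ('D_e1 (Dt e1) p)%:C *: crossA al eta (W p).
  rewrite /k torus_genD !torus_genZ.
  have P (x y : R) : (x + y)%:C = x%:C + y%:C by rewrite rmorphD.
  have N (x : R) : (- x)%:C = - x%:C by rewrite rmorphN.
  have M (x y : R) : (x * y)%:C = x%:C * y%:C by rewrite rmorphM.
  rewrite !expr2; move: (Ds e1 p) (Dt e1 p) ('D_e1 (Ds e1) p) ('D_e1 (Dt e1) p) => a b c d.
  move: (energy al (W p)) => E; move: (torus_gen al (torus_gen al (W p))) => A2.
  move: (torus_gen al (crossA al eta (W p))) => AF; move: (torus_gen al (W p)) => A.
  move: (crossA al eta (W p)) (W p) => F w.
  by apply/matrixP => i j; rewrite !mxE !(P, N, M); ring.
have N2 := normal_part eta1 a0 k1 k2 k3 kN.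
have f1 := frame_eq e1 p; have f2 := frame_eq e2 p.
rewrite e1_comb in f1; rewrite e2_comb in f2.
have hk' : h = lin_ext g k := hk.
have eh1 : rdot h h = rdot k k by rewrite hk' rdot_lin_ext2.
have eh2 : rdot h (V p) = rdot k (W p) by rewrite hk' V_lin rdot_lin_ext2.
have eh3 := congr1 (rdot h) f1; rewrite [in RHS]hk' rdot_lin_ext2 // rdot_comb in eh3.
have eh4 := congr1 (rdot h) f2; rewrite [in RHS]hk' rdot_lin_ext2 // rdot_comb in eh4.
move: N1; rewrite -/(V p) eh1 eh2 eh3 eh4.
have E0 : energy al (W p) != 0 by rewrite gt_eqF.
have r1 : scale p != 0 by rewrite gt_eqF.
have eE := energy_scale p; move: N2; rewrite -/(W p) h4 k4 -/(V p) eE.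
move: (rdot k k) (rdot k (W p)) (rdot k (torus_gen al (W p))) (rdot k (crossA al eta (W p))).
move: (energy al (W p)) E0 (second_form_norm al J) (second_form_norm al' J') => E E0 N N'.
move: (scale p) r0 r1 c1 c2 c3 => r r0 r1 c1 c2 c3 kk kw x y N2.
rewrite (frame_change _ _ r0 c1 c2 c3) expr1n expr0n addr0 mul1r.
rewrite (_ : r * _ / (r * E) = (x ^+ 2 + y ^+ 2) / E); last by field; rewrite r1 E0.
rewrite N2 (_ : (_ - _) ^+ 2 + _ ^+ 2 = r ^+ 2); last by rewrite -c1; ring.
move=> /(congr1 (fun x => x * (r * E))).
rewrite (_ : r ^+ 2 * _ / _ * _ = r ^+ 3 * N); last by field.
by move=> ->; field; rewrite r1 E0.
Qed.

Let L (p0 : R * R) (x : R) : R * R := (p0.1 + x, p0.2).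

Let is_derive_L p0 (x : R) (f : R * R -> R) d : is_derive (L p0 x) e1 f d ->
  is_derive x 1 (fun y => f (L p0 y)) d.
Proof.
move=> /is_derive_line H.
have S : is_derive x 1 (fun y : R => y - x) 1 by exact: is_derive_shift.
have H' : is_derive (x - x) 1 (fun t : R => f (t *: e1 + L p0 x)) d by rewrite subrr.
apply: is_derive_ext (is_derive_comp1 (h := fun y : R => y - x) S H'); last by rewrite mulr1.
move=> y; congr f; rewrite /L /e1; congr pair => /=.
  by rewrite -[(y - x) *: 1]/((y - x) * 1); ring.
by rewrite -[(y - x) *: 0]/((y - x) * 0); ring.
Qed.

Let vder_L p0 (x : R) (f : R * R -> 'cV[R[i]]_3) d : vder (L p0 x) e1 f d ->
  vder x 1 (fun y => f (L p0 y)) d.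
Proof. by move=> H j; have [h1 h2] := H j; split; exact: is_derive_L. Qed.

(** The rotation preserves the energy of [V], which therefore depends on the second parameter alone;
    constant [scale] carries this over to [W]. *)
Lemma energy_along_line p0 (x : R) : (forall p, scale p = scale p0) ->
  energy al (W (L p0 x)) = energy al (W p0).
Proof.
move=> sc; apply: (mulfI (x := scale p0)); first by rewrite gt_eqF // scale_gt0.
by rewrite -{1}(sc (L p0 x)) -!energy_scale /V /orbit_surf !energy_rot.
Qed.

Lemma energy_derivative v p : is_derive p v (fun q => energy al (W q))
  (2 * (Dt v p * (gen_disc al * Re (cubic eta (W p))))).
Proof.
have H := vder_gen al (vder_W v p).
apply: is_derive_ext (vder_rdot H H); first by move=> q; rewrite rdot_gen_gen.
rewrite (rdotC _ (torus_gen al (W p))) torus_genD !torus_genZ rdot_comb.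
rewrite !(rdotC (torus_gen al (W p))) rdot_gen2_gen rdot_gencross_gen.
by ring.
Qed.

Lemma transverse_derivative0 p0 (x : R) : (forall p, scale p = scale p0) ->
  gen_disc al * Re (cubic eta (W p0)) != 0 -> Dt e1 (L p0 x) = 0.
Proof.
move=> sc P0; have [k1 k2 k3 k4] := WP (L p0 x); have [l1 l2 l3 l4] := WP p0.
have a0 : 0 <= al by case/andP: al01.
have E1 := energy_equation eta1 a0 k1 k2; have E2 := energy_equation eta1 a0 l1 l2.
have P2 : (gen_disc al * Re (cubic eta (W (L p0 x)))) ^+ 2 =
    (gen_disc al * Re (cubic eta (W p0))) ^+ 2.
  move: E1 E2; rewrite k4 l4 -/(W (L p0 x)) -/(W p0) energy_along_line //.
  by move=> E1 E2; lra.
have D0 : is_derive x 1 (fun y => energy al (W (L p0 y))) 0.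
  rewrite (_ : (fun y => _) = fun y => energy al (W p0)); first exact: is_derive_cst.
  by apply/funext => y; exact: energy_along_line.
have := is_derive_unique (is_derive_L (energy_derivative e1 (L p0 x))) D0.
have N : gen_disc al * Re (cubic eta (W (L p0 x))) != 0 by rewrite -sqrf_eq0 P2 sqrf_eq0.
have n2 : (2 : R) != 0 by rewrite pnatr_eq0.
by move=> e; apply: (mulIf N); apply: (mulfI n2); rewrite e mul0r mulr0.
Qed.

(** Along the line [phi] moves only the first parameter, at constant speed [a] with [a^2 = r]. The
    squared norms of the second and third derivatives are thus multiplied by [r^2] and [r^3], and
    [energy] by [r]; comparing gives the two relations. *)
Lemma jets_along_line p0 : (forall p, scale p = scale p0) ->
  gen_disc al * Re (cubic eta (W p0)) != 0 ->
  gen_quad al' = scale p0 * gen_quad al /\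
  gen_det al' ^+ 2 = scale p0 ^+ 3 * gen_det al ^+ 2.
Proof.
move=> sc P0; set r := scale p0; have r0 : 0 < r by exact: scale_gt0.
pose Wc x := W (L p0 x); pose Vc x := V (L p0 x).
pose a x := Ds e1 (L p0 x).
have a2 x : a x * a x = r.
  have [c1 _ _] := conformal_frame (L p0 x).
  by move: c1; rewrite transverse_derivative0 // mulr0 addr0 sc.
have an x : a x != 0.
  by apply/eqP => h; move: (a2 x); rewrite h mul0r => e; rewrite -e ltxx in r0.
(* The square of [a] is the constant [r], and [a] does not vanish. *)
have Da (x : R) : is_derive x 1 a 0.
  have D := is_derive_L (Ds_derive e1 e1 (L p0 x)).
  have D2 := is_deriveMf D D.
  have D3 : is_derive x 1 (fun y => Ds e1 (L p0 y) * Ds e1 (L p0 y)) 0.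
    rewrite (_ : (fun y => _) = fun y => r); first exact: is_derive_cst.
    by apply/funext => y; exact: a2.
  have := is_derive_unique D2 D3; rewrite -mulrDr => /eqP.
  rewrite mulf_eq0 (negbTE (an x)) /= -mulr2n mulrn_eq0 /= => /eqP e.
  by move: D; rewrite e.
have DW (x : R) : vder x 1 Wc ((a x)%:C *: torus_gen al (Wc x)).
  apply: vder_eq (vder_L (vder_W e1 (L p0 x))).
  by rewrite transverse_derivative0 // (_ : 0%:C = 0) // scale0r addr0.
have DV (x : R) : vder x 1 Vc (torus_gen al' (Vc x)).
  by apply: vder_eq (vder_L (vder_V e1 (L p0 x))); rewrite e1_comb.
have J1 x : torus_gen al' (Vc x) = lin_ext g ((a x)%:C *: torus_gen al (Wc x)).
  have := frame_eq e1 (L p0 x); rewrite e1_comb => ->.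
  by rewrite transverse_derivative0 // (_ : 0%:C = 0) // scale0r addr0.
have J2 x : torus_gen al' (torus_gen al' (Vc x)) =
    lin_ext g (r%:C *: torus_gen al (torus_gen al (Wc x))).
  apply: (vder_unique (vder_gen al' (DV x))).
  apply: vder_ext (vder_eq _ (vder_lin_ext g (vder_scale (Da x) (vder_gen al (DW x))))).
    by move=> y; rewrite J1.
  by rewrite (_ : 0%:C = 0) // scale0r addr0 torus_genZ scalerA -rmorphM /= a2.
have J3 x : torus_gen al' (torus_gen al' (torus_gen al' (Vc x))) =
    lin_ext g (r%:C *: ((a x)%:C *: torus_gen al (torus_gen al (torus_gen al (Wc x))))).
  apply: (vder_unique (vder_gen al' (vder_gen al' (DV x)))).
  have cr : is_derive x 1 (fun _ : R => r) 0 by exact: is_derive_cst.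
  apply: vder_ext (vder_eq _ (vder_lin_ext g (vder_scale cr (vder_gen al (vder_gen al (DW x)))))).
    by move=> y; rewrite J2.
  by rewrite (_ : 0%:C = 0) // scale0r addr0 !torus_genZ.
have [h1 h2 h3 _] := VP (L p0 0); have [k1 k2 k3 _] := WP (L p0 0).
have E1 : energy al' (Vc 0) = r * energy al (Wc 0) by rewrite /Vc energy_scale sc.
have := rdot_gen2_gen2 h2; rewrite -/(V _) -/(Vc 0) J2 rdot_lin_ext2 // rdotZl rdotZr.
rewrite (rdot_gen2_gen2 k2) -/(W _) -/(Wc 0) E1 => e2'.
have := rdot_gen3_gen3 h1 h2; rewrite -/(V _) -/(Vc 0) J3 rdot_lin_ext2 // !rdotZl !rdotZr.
rewrite (rdot_gen3_gen3 k1 k2) -/(W _) -/(Wc 0) E1 => e3'.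
have E0 : energy al (Wc 0) != 0 by rewrite gt_eqF.
have rn : r != 0 by rewrite gt_eqF.
have Q : gen_quad al' = r * gen_quad al.
  apply: (mulfI (mulf_neq0 rn E0)); rewrite [LHS]mulrC -e2'; by ring.
split=> //; apply: (@addrI _ ((r * gen_quad al) ^+ 2 * (r * energy al (Wc 0)))).
rewrite -Q -e3' Q; have := a2 0; move: (a 0) => b b2.
transitivity (r * (r * (b * b)) * (gen_quad al ^+ 2 * energy al (Wc 0) + gen_det al ^+ 2)).
  by ring.
by rewrite b2; ring.
Qed.

(** The point [p0] is taken over the base point, where [Re cubic] is [- base_height J], nonzero for
    [J] below [Jmax]; with [al] different from [1] the energy is not critical there. *)
Lemma parameters_eq (p0 : R * R) : phi p0 = (0, 0) -> al != 1 -> 0 <= J -> J ^+ 2 < 27^-1 ->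
  0 <= J' -> al = al' /\ J = J'.
Proof.
move=> hp al1 J0 Jm J0'; case/andP: (al01) => a0 a1; case/andP: (al01') => a0' a1'.
have sfn0 (a j : R) : 0 <= a -> second_form_norm a j = 0 -> a = 0 /\ j = 0.
  move=> ha /eqP; rewrite paddr_eq0 ?sqr_ge0 // !sqrf_eq0 /gen_det mulf_eq0.
  have -> : (1 + a == 0) = false by apply/negbTE; rewrite gt_eqF //; lra.
  rewrite orbF => /andP[/eqP -> h]; split => //.
  move: h; rewrite /gen_disc mulf_eq0 => /orP[/eqP h|/eqP //].
  have /eqP : (2 : R) = 0 by lra.
  by rewrite pnatr_eq0.
(* When this constant is zero, [scale_cubed] does not control [scale], but both parameter pairs are
   then [(0, 0)]. *)
have [c0|c0] := eqVneq (second_form_norm al J) 0.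
  have c0' : second_form_norm al' J' = 0 by rewrite (scale_cubed p0) c0 mulr0.
  have [-> ->] := sfn0 _ _ a0 c0; by have [-> ->] := sfn0 _ _ a0' c0'.
have sc p : scale p = scale p0.
  have : scale p ^+ 3 = scale p0 ^+ 3.
    by apply: (mulIf c0); rewrite -!scale_cubed.
  move/eqP; rewrite eqrXn2 ?(ltW (scale_gt0 _)) // => /eqP //.
have m0 : gen_disc al != 0.
  rewrite /gen_disc !mulf_neq0 ?subr_eq0 //; rewrite gt_eqF //; lra.
have P0 : gen_disc al * Re (cubic eta (W p0)) != 0.
  rewrite mulf_neq0 // /W hp /orbit_surf cubic_rot; case: std => _ _ -> /=.
  by rewrite oppr_eq0 sqrtr_eq0 -ltNge subr_gt0.
have [hq hd] := jets_along_line sc P0.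
have r0 := scale_gt0 p0; move: (scale p0) r0 hq hd (scale_cubed p0) => r r0 hq hd hc.
have qd (a : R) : gen_quad a = 1 + gen_det a by rewrite /gen_quad /gen_det; ring.
have db (a : R) : 0 <= a <= 1 -> 0 <= gen_det a <= 2.
  by move=> /andP[? ?]; rewrite /gen_det; apply/andP; split; nra.
have /andP[x0 x2] := db _ al01; have /andP[y0 y2] := db _ al01'.
have dE : gen_det al' = gen_det al.
  move: hq hd; rewrite !qd; move: (gen_det al) (gen_det al') x0 x2 y0 y2 => x y x0 x2 y0 y2 hq hd.
  (* Eliminating [r] gives [x^2 (1 + y)^3 = y^2 (1 + x)^3]. On [[0, 2]^2] one has
     [x^2 y^2 <= 4 x y <= 3 x y + x + y], and equality in the second factor again forces [x = y]. *)
  have h : (x - y) * (x + y + 3 * x * y - x ^+ 2 * y ^+ 2) = 0.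
    transitivity (x ^+ 2 * (1 + y) ^+ 3 - y ^+ 2 * (1 + x) ^+ 3); first by ring.
    by rewrite hq hd; ring.
  move/eqP: h; rewrite mulf_eq0 => /orP[|/eqP h]; first by rewrite subr_eq0 => /eqP.
  have t1 : 0 <= x * y by rewrite mulr_ge0.
  have t2 : x * y <= 4 by nra.
  have t3 : x ^+ 2 * y ^+ 2 <= 4 * (x * y) by rewrite -exprMn expr2 ler_wpM2r.
  have t4 : x * y <= 2 * x by nra.
  have t5 : x * y <= 2 * y by nra.
  have t6 : x * y = x + y by lra.
  have t7 : x * y = 2 * x by lra.
  have t8 : x * y = 2 * y by lra.
  by lra.
have aE : al = al'.
  move: dE; rewrite /gen_det => h.
  have : (al - al') * (1 + al + al') = 0.
    by rewrite -[RHS](subrr (al' * (1 + al'))) [X in _ = X - _]h; ring.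
  move/eqP; rewrite mulf_eq0 subr_eq0 => /orP[/eqP //|/eqP]; lra.
have r1 : r = 1.
  have q0 : gen_quad al != 0 by rewrite gt_eqF // qd; lra.
  by apply: (mulIf q0); rewrite -hq -aE mul1r.
split=> //; move: hc; rewrite r1 expr1n mul1r -aE /second_form_norm => /addrI.
move: m0; move: (gen_disc al) => m m0; rewrite !exprMn => h.
have /eqP : J' ^+ 2 = J ^+ 2 := mulfI (expf_neq0 2 m0) h.
by rewrite eqrXn2 // => /eqP.
Qed.

End Rigidity.

(** * Clifford tori *)

Section CliffordTori.
Local Open Scope ring_scope.
Context {R : realType}.
Implicit Types (al J : R) (eta : R[i]) (w : 'cV[R[i]]_3).

Lemma rdot_isometry (g h : 'cV[R[i]]_3 -> 'cV[R[i]]_3) :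
  (forall x y, rdot (g x) (g y) = rdot x y) -> cancel h g -> isometry_S5 g.
Proof.
move=> H K; split; last by move=> x y _ _; rewrite /S5dist H.
apply/seteqP; split => [_ [x hx <-]|y hy]; first by rewrite /S5 /= H.
by exists (h y); rewrite ?K // /S5 /= -H K.
Qed.

Lemma cexp_2pi (a : R) : cexp (a + 2 * pi) = cexp a.
Proof.
rewrite cexpD (_ : cexp (2 * pi) = 1) ?mulr1 //.
by apply: ceq; rewrite /= (mulrC 2) mulr_natr ?cos2pi ?sin2pi.
Qed.

Lemma norm_sq_third (x : R[i]) : (`|x| ^+ 2 = 3%:R^-1) <-> nsq x = 3^-1.
Proof.
rewrite nsq_normE -rmorphXn sqr_sqrtr ?nsq_ge0 //.
rewrite (_ : 3%:R^-1 = (3^-1 : R)%:C); last by rewrite fmorphV rmorph_nat.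
by split=> [/complexI|->].
Qed.

Definition torus_param w (l0 l1 m0 m1 : R) (p : R * R) : 'cV[R[i]]_3 :=
  vec3 (w o0 0 * cexp (l0 * p.1 + m0 * p.2)) (w o1 0 * cexp (l1 * p.1 + m1 * p.2))
       (w o2 0 * cexp (- (l0 * p.1 + m0 * p.2) - (l1 * p.1 + m1 * p.2))).

(** The first two phases are independent linear forms of the parameters, so they take all pairs of
    values, and the preimages of [(2 pi, 0)] and [(0, 2 pi)] are periods. The three phases add up to
    zero, which fixes the sum of the arguments; [h] undoes [g] along the surface and transfers the
    periods to [u]. *)
Lemma torus_param_clifford u g h w (l0 l1 m0 m1 : R) :
  [/\ nsq (w o0 0) = 3^-1, nsq (w o1 0) = 3^-1 & nsq (w o2 0) = 3^-1] ->
  l0 * m1 - l1 * m0 != 0 -> isometry_S5 g ->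
  (forall p, g (u p) = torus_param w l0 l1 m0 m1 p) -> (forall p, h (g (u p)) = u p) ->
  describes_clifford_torus u.
Proof.
move=> [n0 n1 n2] d0 gi gu hg; set D := _ - _ in d0.
have solve (x y : R) : exists2 p : R * R, l0 * p.1 + m0 * p.2 = x /\ l1 * p.1 + m1 * p.2 = y &
    p = ((x * m1 - y * m0) / D, (l0 * y - l1 * x) / D).
  by eexists; [|reflexivity]; split=> /=; move: d0; rewrite /D => d0; field.
split.
  have [a [a0 a1] aE] := solve (2 * pi) 0; have [b [b0 b1] bE] := solve 0 (2 * pi).
  exists a, b; split.
    have -> : a.1 * b.2 - a.2 * b.1 = (2 * pi) ^+ 2 / D.
      by rewrite aE bE /=; move: d0; rewrite /D => d0; field.
    by rewrite mulf_neq0 ?invr_eq0 // expf_neq0 // mulf_neq0 ?pnatr_eq0 // gt_eqF ?pi_gt0.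
  have inj p q : torus_param w l0 l1 m0 m1 p = torus_param w l0 l1 m0 m1 q -> u p = u q.
    by rewrite -2!gu => e; rewrite -(hg p) e hg.
  move=> p; split; apply: inj; rewrite /torus_param /= !mulrDr.
    rewrite (_ : l0 * p.1 + _ + _ = l0 * p.1 + m0 * p.2 + 2 * pi); last by rewrite -a0; ring.
    rewrite (_ : l1 * p.1 + _ + _ = l1 * p.1 + m1 * p.2); last by rewrite -[RHS]addr0 -a1; ring.
    set x := l0 * _ + _; set y := l1 * _ + _.
    rewrite cexp_2pi -(cexp_2pi (- (x + _) - y)); congr (vec3 _ _ (_ * cexp _)); by ring.
  rewrite (_ : l0 * p.1 + _ + _ = l0 * p.1 + m0 * p.2); last by rewrite -[RHS]addr0 -b0; ring.
  rewrite (_ : l1 * p.1 + _ + _ = l1 * p.1 + m1 * p.2 + 2 * pi); last by rewrite -b1; ring.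
  set x := l0 * _ + _; set y := l1 * _ + _.
  rewrite cexp_2pi -(cexp_2pi (- x - (y + _))); congr (vec3 _ _ (_ * cexp _)); by ring.
pose r : R := Num.sqrt 3^-1.
have r2 : r ^+ 2 = 3^-1 by rewrite sqr_sqrtr // invr_ge0.
have r0 : r != 0 by rewrite sqrtr_eq0 -ltNge invr_gt0.
have polar (x : R[i]) : nsq x = 3^-1 -> exists a, x = r%:C * cexp a.
  move=> nx; have [a e] : exists a, r^-1%:C * x = cexp a.
    by apply: nsq1_cexp; rewrite nsqM nsqR exprVn r2 nx invrK mulfV ?pnatr_eq0.
  by exists a; rewrite -e mulrA -rmorphM divff // mul1r.
have [a0 w0] := polar _ n0; have [a1 w1] := polar _ n1; have [a2 w2] := polar _ n2.
have nrm (x : R[i]) : nsq x = 3^-1 -> `|x| = r%:C by move=> nx; rewrite nsq_normE nx.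
have nr (a : R) : nsq (r%:C * cexp a) = 3^-1 by rewrite nsqM nsqR nsq_cexp r2 mulr1.
exists g, (a0 + a1 + a2); split=> //; apply/seteqP; split=> [_ [_ [p _ <-] <-]|z [hn [a [hz ha]]]].
  rewrite gu /torus_param; set x := l0 * _ + _; set y := l1 * _ + _.
  rewrite w0 w1 w2 -!mulrA -!cexpD; split.
    by move=> j; apply/norm_sq_third; move: j; apply: ord3P; rewrite v3E.
  exists (fun j => [:: a0 + x; a1 + y; a2 + (- x - y)]`_j); split.
    by apply: ord3P; rewrite v3E nrm.
  by rewrite sum3 /=; ring.
have {}hz j : z j 0 = r%:C * cexp (a j) by rewrite hz nrm //; apply/norm_sq_third.
rewrite sum3 in ha.
have [p [p0 p1] _] := solve (a o0 - a0) (a o1 - a1).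
exists (u p); first by exists p.
rewrite gu /torus_param p0 p1 w0 w1 w2 -!mulrA -!cexpD; apply: vec3P; rewrite v3E hz.
- by congr (_ * cexp _); ring.
- by congr (_ * cexp _); ring.
- by congr (_ * cexp _); lra.
Qed.

Lemma standard_eq al J eta z y : nsq eta = 1 -> is_standard al J eta z -> is_flowA al eta y ->
  y 0 = z 0 -> forall t, z t = y t.
Proof.
move=> e1 [Hz hz _] Hy E; apply: (flow_unique (crossA_sum0 al) Hz Hy (start_S5 hz)).
by rewrite E.
Qed.

(** Here [cubic] starts at [i Jmax], and rotating each coordinate at the constant speed [k c_j]
    solves the equation. *)
Lemma clifford_Jmax al J eta z : 0 <= al <= 1 -> J = Jmax -> nsq eta = 1 -> is_standard al J eta z ->
  describes_clifford_torus (orbit_surf al z).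
Proof.
move=> hal -> e1 H; have [_ hz hc] := H.
have h0 : base_height Jmax = 0 :> R by rewrite /base_height Jmax_sq subrr sqrtr0.
rewrite h0 oppr0 in hc.
pose c : 'I_3 -> R := fun j => [:: - (1 + 2 * al); 2 + al; al - 1]`_j.
(* Multiplying [eta conj(z_j z_l)] by [3 |z_i|^2 = 1] produces the conjugate of
   [z_1 z_2 z_3 = eta i Jmax], hence the factor [- 3 i Jmax] in front of [z_i]. *)
pose k : R := - 3 * Jmax.
pose y (t : R) := \col_j (z 0 j 0 * cexp (k * c j * t)) : 'cV[R[i]]_3.
have W : z 0 o0 0 * z 0 o1 0 * z 0 o2 0 = eta * (0 +i* Jmax).
  by rewrite -hc /cubic mulrA nsqE e1 mul1r.
have Wc : z 0 o0 0 * z 0 o1 0 * z 0 o2 0 = eta * ('i%C * Jmax%:C).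
  by rewrite W; congr (_ * _); apply: ceq; rewrite !cpartE /=; ring.
have key (i j l : 'I_3) : z 0 i 0 * z 0 j 0 * z 0 l 0 = z 0 o0 0 * z 0 o1 0 * z 0 o2 0 ->
  nsq (z 0 i 0) = 3^-1 ->  eta * (z 0 j 0 * z 0 l 0)^* = 'i%C * k%:C * z 0 i 0.
  rewrite Wc => h ni.
  have Jc : (z 0 i 0 * z 0 j 0 * z 0 l 0)^* = - 'i%C * Jmax%:C * eta^*.
    by rewrite h !conjMc conj_i conj_real; ring.
  have n3 : z 0 i 0 * (z 0 i 0)^* * 3%:C = 1.
    by rewrite nsqE ni -rmorphM mulVf ?pnatr_eq0.
  transitivity (eta * ((z 0 i 0 * (z 0 i 0)^* * 3%:C) * (z 0 j 0 * z 0 l 0)^*)).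
    by rewrite n3 mul1r.
  transitivity (eta * (3%:C * z 0 i 0 * (z 0 i 0 * z 0 j 0 * z 0 l 0)^*)).
    by rewrite !conjMc; ring.
  rewrite Jc /k rmorphM rmorphN.
  transitivity ((eta * eta^*) * (- 'i%C * 3%:C * Jmax%:C * z 0 i 0)); first by ring.
  by rewrite nsqE e1 mul1r; ring.
have [n0 n1 n2] := hz.
have Hy : is_flowA al eta y.
  move=> t j; rewrite /y; under eq_fun do rewrite mxE.
  apply: cder_eq (cderZ _ (cder_cexp (is_deriveZf (k * c j) (is_derive_id t 1)))).
  have cJ (i m : 'I_3) (x x' : R[i]) : c i + c m + c j = 0 ->
    (x * cexp (k * c i * t) * (x' * cexp (k * c m * t)))^* = (x * x')^* * cexp (k * c j * t).
    move=> e; rewrite mulrACA -cexpD [LHS]conjMc -cexpN; congr (_ * cexp _).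
    by rewrite -mulrDl -mulrDr -mulNr; congr (_ * t); rewrite -mulrN; congr (k * _); lra.
  move: j cJ; apply: ord3P => cJ; rewrite /crossfield v3E !mxE cJ; try by rewrite /c /=; ring.
  - transitivity ((c o0)%:C * (eta * (z 0 o1 0 * z 0 o2 0)^*) * cexp (k * c o0 * t)); last first.
      by rewrite -[- (1 + 2 * al)]/(c o0); ring.
    by rewrite (key o0) //; ring.
  - transitivity ((c o1)%:C * (eta * (z 0 o2 0 * z 0 o0 0)^*) * cexp (k * c o1 * t)); last first.
      by rewrite -[2 + al]/(c o1); ring.
    by rewrite (key o1) //; ring.
  - transitivity ((c o2)%:C * (eta * (z 0 o0 0 * z 0 o1 0)^*) * cexp (k * c o2 * t)); last first.
      by rewrite -[al - 1]/(c o2); ring.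
    by rewrite (key o2) //; ring.
have zy : forall t, z t = y t.
  apply: standard_eq e1 H Hy _; apply/matrixP => j l; rewrite [l]ord1 mxE mulr0 cexp0.
  by rewrite mulr1.
apply: (@torus_param_clifford _ id id (z 0) 1 al (k * c o0) (k * c o1)) => //.
- rewrite mul1r mulrCA -mulrBr mulf_neq0 //.
    by rewrite mulf_neq0 ?oppr_eq0 ?pnatr_eq0 // -sqrf_eq0 Jmax_sq invr_eq0 pnatr_eq0.
  by rewrite /c /= gt_eqF //; case/andP: hal => *; nra.
- exact: (@rdot_isometry id id).
- move=> p; rewrite /orbit_surf zy; apply: vec3P; rewrite !v3E !mxE mulrCA -cexpD.
  + by congr (_ * cexp _); ring.
  + by congr (_ * cexp _); ring.
  + by congr (_ * cexp _); rewrite /c /=; ring.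
Qed.
Lemma su2_isometry (a b : R[i]) : nsq a + nsq b = 1 ->
  let g (w : 'cV[R[i]]_3) := vec3 (a^* * w o0 0 + b^* * w o1 0) (a * w o1 0 - b * w o0 0) (w o2 0) in
  let h (w : 'cV[R[i]]_3) := vec3 (a * w o0 0 - b^* * w o1 0) (b * w o0 0 + a^* * w o1 0) (w o2 0) in
  [/\ isometry_S5 g, cancel g h & cancel h g].
Proof.
move=> ab g h; have abC : a * a^* + b * b^* = 1 by rewrite !nsqE -rmorphD ab.
have gh : cancel h g.
  move=> w; apply: vec3P; rewrite /g /h !v3E //.
    by rewrite -[RHS]mul1r -abC; ring.
  by rewrite -[RHS]mul1r -abC; ring.
have hg : cancel g h.
  move=> w; apply: vec3P; rewrite /g /h !v3E //.
    by rewrite -[RHS]mul1r -abC; ring.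
  by rewrite -[RHS]mul1r -abC; ring.
split=> //; apply: rdot_isometry gh => x y.
rewrite !rdotH /g !v3E !(conjMc, conjDc, conjNc, conjKc).
congr (Re (_ + _)); rewrite -[RHS]mul1r -abC; by ring.
Qed.

(** The third coordinate is constant and the equation is linear in [(z_1, conj z_2)], with
    frequencies [om] and [- om], where [om^2 = 9 |z_3|^2 = 3]. For [al = 1] the rotation multiplies
    the first two coordinates by the same phase, so it commutes with SU(2), which can be used to
    separate the frequencies. *)
Lemma clifford_alpha1 J eta z : nsq eta = 1 -> is_standard 1 J eta z ->
  describes_clifford_torus (orbit_surf 1 z).
Proof.
move=> e1 H; have [_ hz _] := H; have [n0 n1 n2] := hz.
pose om : R := Num.sqrt 3; have om2 : om ^+ 2 = 3 by rewrite sqr_sqrtr.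
pose n := 'i%C * om%:C * eta * (z 0 o2 0)^*.
have nn : n * n^* = 1.
  by rewrite nsqE /n !nsqM nsqJ nsq_i nsqR e1 n2 om2 mul1r mulr1 divff ?pnatr_eq0.
have om2C : om%:C * om%:C = 3 :> R[i] by rewrite -rmorphM -expr2 om2 rmorph_nat.
have kE : 3 * eta * (z 0 o2 0)^* = - 'i%C * om%:C * n.
  rewrite /n -om2C; transitivity (- ('i%C * 'i%C) * (om%:C * om%:C * eta * (z 0 o2 0)^*)).
    by rewrite mulii opprK mul1r.
  by ring.
have half : (2^-1 : R[i]) + 2^-1 = 1 by field.
(* [A0] and [A1] are the coefficients of frequency [om] in the first two coordinates; the equation
   then determines those of frequency [- om], and [om A0], [om A1] define the element of SU(2). *)
pose A0 := 2^-1 * (z 0 o0 0 + n * (z 0 o1 0)^*).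
pose A1 := 2^-1 * (z 0 o1 0 - n * (z 0 o0 0)^*).
have c2 : (2^-1 : R[i])^* = 2^-1 by rewrite fmorphV rmorph_nat.
have A0J : A0^* = 2^-1 * ((z 0 o0 0)^* + n^* * z 0 o1 0).
  by rewrite /A0 conjMc conjDc conjMc c2 conjKc.
have A1J : A1^* = 2^-1 * ((z 0 o1 0)^* - n^* * z 0 o0 0).
  by rewrite /A1 conjMc conjDc conjNc conjMc c2 conjKc.
have AA : A0 * A0^* + A1 * A1^* = 3^-1.
  rewrite A0J A1J /A0 /A1.
  transitivity (2^-1 * 2^-1 * (1 + n * n^*) * (z 0 o0 0 * (z 0 o0 0)^* + z 0 o1 0 * (z 0 o1 0)^*)).
    by ring.
  rewrite nn !nsqE n0 n1 fmorphV rmorph_nat.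
  transitivity ((2^-1 + 2^-1) * (2^-1 + 2^-1) * 3^-1 : R[i]); first by ring.
  by rewrite half !mul1r.
pose y (t : R) := vec3 (A0 * cexp (om * t) - n * A1^* * cexp (- om * t))
  (A1 * cexp (om * t) + n * A0^* * cexp (- om * t)) (z 0 o2 0).
have ce (t : R) : (cexp (- om * t))^* = cexp (om * t) by rewrite -cexpN mulNr opprK.
have ce' (t : R) : (cexp (om * t))^* = cexp (- om * t) by rewrite -cexpN mulNr.
have Hy : is_flowA 1 eta y.
  rewrite /y; clear -kE nn ce ce'; clearbody A0 A1 n => t; apply: vder_eq; last first.
    apply: vder_vec3; last exact: cder_cst.
      apply: cderD (cderZ _ (cder_cexp (is_deriveZf om (is_derive_id t 1)))) _.
      apply: cderN; apply: cderZ (cder_cexp (is_deriveZf (- om) (is_derive_id t 1))).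
    apply: cderD (cderZ _ (cder_cexp (is_deriveZf om (is_derive_id t 1)))) _.
    by apply: cderZ (cder_cexp (is_deriveZf (- om) (is_derive_id t 1))).
  rewrite !mulr1 /crossfield /=; apply: vec3P; rewrite !v3E.
  - rewrite !(conjMc, conjDc, conjNc, conjKc) /= ce ce'.
    transitivity (- (3 * eta * (z 0 o2 0)^*) * (A1^* * cexp (- om * t) + n^* * A0 * cexp (om * t))).
      rewrite kE -[X in A0 * X]mul1r -nn; ring.
    by ring.
  - rewrite !(conjMc, conjDc, conjNc, conjKc) /= ce ce'.
    transitivity (3 * eta * (z 0 o2 0)^* * (A0^* * cexp (- om * t) - n^* * A1 * cexp (om * t))).
      rewrite kE -[X in A1 * X]mul1r -nn; ring.
    by ring.
  - by rewrite subrr mulr0 mul0r.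
have yz : y 0 = z 0.
  apply: vec3P; rewrite /y !v3E ?mulr0 ?cexp0 ?mulr1 //.
    transitivity (2^-1 * (z 0 o0 0 + n * n^* * z 0 o0 0)); first by rewrite A1J /A0; ring.
    by rewrite nn mul1r mulrDr -mulrDl half mul1r.
  transitivity (2^-1 * (z 0 o1 0 + n * n^* * z 0 o1 0)); first by rewrite A0J /A1; ring.
  by rewrite nn mul1r mulrDr -mulrDl half mul1r.
have zy := standard_eq e1 H Hy yz.
have ab : nsq (om%:C * A0) + nsq (om%:C * A1) = 1.
  move: AA; rewrite !(nsqM om%:C) -mulrDr nsqR om2 !nsqE; move: (nsq A0) (nsq A1) => a b h.
  have -> : a + b = 3^-1.
    apply: (@complexI R); rewrite [RHS]fmorphV rmorph_nat -h; exact: rmorphD.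
  by rewrite divff ?pnatr_eq0.
have [gi gh _] := su2_isometry ab.
have D3 : (om / 3)%:C = om%:C * (A0 * A0^* + A1 * A1^*).
  by rewrite AA [LHS]rmorphM /= fmorphV rmorph_nat.
have cJ (x : R[i]) : (om%:C * x)^* = om%:C * x^* by rewrite conjMc conj_real.
have om3 : (om / 3) ^+ 2 = 3^-1 by rewrite exprMn om2; field.
apply: (@torus_param_clifford _ _ _ (vec3 (om / 3)%:C ((om / 3)%:C * n) (z 0 o2 0)) 1 1 om (- om)
  _ _ gi).
- rewrite !v3E nsqM nsqR om3 n2; split=> //.
  by rewrite (_ : nsq n = 1) ?mulr1 //; apply: (@complexI R); rewrite -nsqE nn.
- by rewrite !mul1r -opprD oppr_eq0 -mulr2n mulrn_eq0 /= sqrtr_eq0 -ltNge ltr0n.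
- move=> p; rewrite /orbit_surf zy /torus_rot /y /torus_param; apply: vec3P; rewrite !v3E.
  + by rewrite D3 !cJ !mul1r cexpD; ring.
  + by rewrite D3 !mul1r cexpD; ring.
  + by rewrite mulrC; congr (_ * cexp _); ring.
- by move=> p; exact: gh.
Qed.

End CliffordTori.

(** * Classification *)

Section Matching.
Local Open Scope ring_scope.
Context {R : realType}.
Implicit Types (al J : R) (eta : R[i]) (w : 'cV[R[i]]_3).

Definition balanced w : Prop :=
  [/\ nsq (w o0 0) = 3^-1, nsq (w o1 0) = 3^-1 & nsq (w o2 0) = 3^-1].

Definition phase_rot (d0 d1 d2 : R[i]) w : 'cV[R[i]]_3 :=
  vec3 (d0 * w o0 0) (d1 * w o1 0) (d2 * w o2 0).

Definition conj_vec w : 'cV[R[i]]_3 := vec3 (w o0 0)^* (w o1 0)^* (w o2 0)^*.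

Lemma unitK (d : R[i]) : nsq d = 1 -> d * d^* = 1.
Proof. by move=> h; rewrite nsqE h. Qed.

Lemma phase_rotK d0 d1 d2 : nsq d0 = 1 -> nsq d1 = 1 -> nsq d2 = 1 ->
  cancel (phase_rot d0 d1 d2) (phase_rot d0^* d1^* d2^*).
Proof.
move=> /unitK h0 /unitK h1 /unitK h2 w; apply: vec3P; rewrite /phase_rot !v3E mulrA mulrC.
- by rewrite [_^* * _]mulrC h0 mulr1.
- by rewrite [_^* * _]mulrC h1 mulr1.
- by rewrite [_^* * _]mulrC h2 mulr1.
Qed.

Lemma rdot_phase_rot d0 d1 d2 x y : nsq d0 = 1 -> nsq d1 = 1 -> nsq d2 = 1 ->
  rdot (phase_rot d0 d1 d2 x) (phase_rot d0 d1 d2 y) = rdot x y.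
Proof.
move=> n0 n1 n2; rewrite !rdotH /phase_rot !v3E !conjMc; congr Re.
have [h0 h1 h2] := And3 (unitK n0) (unitK n1) (unitK n2).
rewrite -[x o0 0 * _]mul1r -[x o1 0 * _]mul1r -[x o2 0 * _]mul1r -{1}h0 -{1}h1 -h2.
by ring.
Qed.

Lemma isometry_phase_rot d0 d1 d2 : nsq d0 = 1 -> nsq d1 = 1 -> nsq d2 = 1 ->
  isometry_S5 (phase_rot d0 d1 d2).
Proof.
move=> n0 n1 n2; apply: (@rdot_isometry _ _ (phase_rot d0^* d1^* d2^*)) => [x y|].
  exact: rdot_phase_rot.
by rewrite -{2}[d0]conjKc -{2}[d1]conjKc -{2}[d2]conjKc; apply: phase_rotK; rewrite nsqJ.
Qed.

Lemma conj_vecK : involutive conj_vec.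
Proof. by move=> w; apply: vec3P; rewrite /conj_vec !v3E conjKc. Qed.

Lemma isometry_conj_vec : isometry_S5 conj_vec.
Proof.
apply: rdot_isometry conj_vecK => x y.
by rewrite !rdotE /conj_vec !v3E !cpartE; ring.
Qed.

Lemma isometry_comp g h : isometry_S5 g -> isometry_S5 h ->
  @isometry_S5 R (fun w => g (h w)).
Proof.
move=> gi hi; have [g1 g2] := gi; have [h1 h2] := hi; split.
  by transitivity (g @` (h @` S5)); [rewrite image_comp|rewrite h1].
move=> x y hx hy; rewrite g2 ?h2 //; exact: isometry_S5_S5.
Qed.

Lemma torus_rot_phase al s d0 d1 d2 w :
  torus_rot al s (phase_rot d0 d1 d2 w) = phase_rot d0 d1 d2 (torus_rot al s w).
Proof. by apply: vec3P; rewrite /phase_rot !v3E mulrCA. Qed.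

Lemma torus_rot_conj al s w :
  torus_rot al s (conj_vec w) = conj_vec (torus_rot al (- s) w).
Proof. by apply: vec3P; rewrite /conj_vec !v3E conjMc ?mulrN cexpN conjKc. Qed.

(** Changes of time, conjugation and diagonal unitary matrices, treated in turn here and below, act
    on the equation through [eta] alone. *)
Lemma flow_affine al eta (x : R -> 'cV[R[i]]_3) (e r0 : R) : is_flowA al eta x ->
  is_flowA al (e%:C * eta) (fun r => x (r0 + e * r)).
Proof.
move=> H r j.
have D : is_derive r 1 (fun r : R => r0 + e * r) e.
  apply: is_derive_ext (is_deriveDf (is_derive_cst r0 r 1) (is_deriveZf e (is_derive_id r 1))) => //.
  by rewrite mulr1 add0r.
apply: cder_eq (cder_comp (f := fun t => x t j 0) D (H (r0 + e * r) j)).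
by move: j; apply: ord3P; rewrite /crossfield !v3E; ring.
Qed.

Lemma flow_conj al eta x : is_flowA al eta x -> is_flowA al eta^* (fun r => conj_vec (x r)).
Proof.
move=> H r; apply: vder_eq; last by apply: vder_vec3; exact: (cderJ (H r _)).
by rewrite /crossfield; apply: vec3P; rewrite /conj_vec !v3E !conjMc conj_real.
Qed.

Lemma flow_phase al eta d0 d1 d2 x : nsq d0 = 1 -> nsq d1 = 1 -> nsq d2 = 1 ->
  is_flowA al eta x -> is_flowA al (eta * (d0 * d1 * d2)) (fun r => phase_rot d0 d1 d2 (x r)).
Proof.
move=> /unitK h0 /unitK h1 /unitK h2 H r.
apply: vder_eq; last by apply: vder_vec3; apply: cderZ; exact: (H r _).
rewrite /crossfield; apply: vec3P; rewrite /phase_rot !v3E !conjMc.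
- transitivity (d0 * (d1 * d1^*) * (d2 * d2^*) *
    (eta * (- (1 + 2 * al))%:C * ((x r o1 0)^* * (x r o2 0)^*))); last by ring.
  by rewrite h1 h2 !mulr1.
- transitivity (d1 * (d2 * d2^*) * (d0 * d0^*) *
    (eta * (2 + al)%:C * ((x r o2 0)^* * (x r o0 0)^*))); last by ring.
  by rewrite h0 h2 !mulr1.
- transitivity (d2 * (d0 * d0^*) * (d1 * d1^*) *
    (eta * (al - 1)%:C * ((x r o0 0)^* * (x r o1 0)^*))); last by ring.
  by rewrite h0 h1 !mulr1.
Qed.

(** The phases are the quotients [z_j / x_j] at time [0], written [3 z_j conj(x_j)]. Equality of the
    two values of [cubic] says that their product carries [eta1] to [eta], and uniqueness
    concludes. *)
Lemma flow_match al eta eta1 x z : nsq eta = 1 -> nsq eta1 = 1 -> is_flowA al eta z ->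
  is_flowA al eta1 x -> balanced (z 0) -> balanced (x 0) ->
  cubic eta (z 0) = cubic eta1 (x 0) ->
  exists d0 d1 d2, [/\ nsq d0 = 1, nsq d1 = 1, nsq d2 = 1 &
    forall r, z r = phase_rot d0 d1 d2 (x r)].
Proof.
move=> e1 e2 Hz Hx bz [x0 x1 x2] hc; have [z0 z1 z2] := bz.
pose d j : R[i] := 3 * (z 0 j 0 * (x 0 j 0)^*).
have nd j : nsq (z 0 j 0) = 3^-1 -> nsq (x 0 j 0) = 3^-1 -> nsq (d j) = 1.
  move=> hz hx; rewrite /d !nsqM nsqJ hz hx (_ : 3 = (3 : R)%:C) ?nsqR; first by field.
  by rewrite rmorph_nat.
have third (y : R[i]) : nsq y = 3^-1 -> 3 * (y * y^*) = 1.
  by move=> h; rewrite nsqE h fmorphV rmorph_nat divff ?pnatr_eq0.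
have dx j : nsq (x 0 j 0) = 3^-1 -> z 0 j 0 = d j * x 0 j 0.
  move=> hx; rewrite -[LHS]mul1r -(third _ hx) /d; ring.
have dE : eta1 * (d o0 * d o1 * d o2) = eta.
  have hx : cubic eta1 (x 0) * (cubic eta1 (x 0))^* * 27 = 1.
    rewrite /cubic !conjMc conjKc.
    transitivity ((eta1 * eta1^*) * (3 * (x 0 o0 0 * (x 0 o0 0)^*)) *
       (3 * (x 0 o1 0 * (x 0 o1 0)^*)) * (3 * (x 0 o2 0 * (x 0 o2 0)^*))); first by ring.
    by rewrite unitK // !third // !mulr1.
  have ez : z 0 o0 0 * z 0 o1 0 * z 0 o2 0 = eta * cubic eta1 (x 0).
    by rewrite -hc /cubic mulrA unitK // mul1r.
  have ex : eta1 * ((x 0 o0 0)^* * (x 0 o1 0)^* * (x 0 o2 0)^*) = (cubic eta1 (x 0))^*.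
    by rewrite /cubic !conjMc conjKc.
  transitivity (27 * (z 0 o0 0 * z 0 o1 0 * z 0 o2 0) *
    (eta1 * ((x 0 o0 0)^* * (x 0 o1 0)^* * (x 0 o2 0)^*))); first by rewrite /d; ring.
  transitivity (eta * (cubic eta1 (x 0) * (cubic eta1 (x 0))^* * 27)); last by rewrite hx mulr1.
  by rewrite ez ex; ring.
exists (d o0), (d o1), (d o2); split; [exact: nd|exact: nd|exact: nd|].
have Hd := flow_phase (nd _ z0 x0) (nd _ z1 x1) (nd _ z2 x2) Hx; rewrite dE in Hd.
apply: (flow_unique (crossA_sum0 al) Hz Hd (start_S5 bz)).
by apply: vec3P; rewrite /phase_rot v3E dx.
Qed.

Lemma signed_parts (k : R[i]) (b : R) : b * b = 1 -> b * Re k = - `|Re k| ->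
  - `|Re k| +i* `|Im k| = if 0 <= b * Im k then b%:C * k else (b%:C * k)^*.
Proof.
move=> bb bR; have b1 : `|b| = 1.
  by apply/eqP; rewrite -(@eqrXn2 _ 2) // real_normK ?num_real // expr1n expr2 bb.
have nI : `|b * Im k| = `|Im k| by rewrite normrM b1 mul1r.
case: ifPn => [h|]; last rewrite -ltNge => h; apply: ceq; rewrite !cpartE /= mul0r ?subr0 ?addr0 ?bR //.
  by rewrite -nI ger0_norm.
by rewrite -nI ltr0_norm.
Qed.

(** [J] is found before [z] is given, since the members of the family are chosen independently of
    the surface to be matched. *)
Lemma match_standard al eta eta1 x r0 : nsq eta = 1 -> nsq eta1 = 1 -> is_flowA al eta1 x ->
  balanced (x r0) -> exists2 J, 0 <= J <= Jmax &
    forall z, is_standard al J eta z -> exists g (a b : R),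
      [/\ isometry_S5 g, a * a = 1, b * b = 1 &
          forall s r, orbit_surf al x (s, r) = g (orbit_surf al z (a * s, b * (r - r0)))].
Proof.
move=> e1 e2 Hx bx; have [x0 x1 x2] := bx.
set ka := cubic eta1 (x r0).
have nk : Re ka ^+ 2 + Im ka ^+ 2 = 27^-1.
  by rewrite -[LHS]/(nsq ka) nsq_cubic // x0 x1 x2; field.
exists `|Im ka|.
  rewrite normr_ge0 -(@ler_pXn2r _ 2) ?nnegrE // ?Jmax_sq ?real_normK ?num_real //.
    by rewrite -nk lerDr sqr_ge0.
  by rewrite invr_ge0 mulr_ge0 ?sqrtr_ge0.
move=> z [Hz bz cz].
have bh : base_height `|Im ka| = `|Re ka|.
  rewrite /base_height real_normK ?num_real // -nk addrK sqrtr_sqr //.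
rewrite bh in cz.
have [b [bb bR]] : exists b : R, b * b = 1 /\ b * Re ka = - `|Re ka|.
  have [h|h] := lerP (Re ka) 0; [exists 1|exists (-1)]; split; rewrite ?mulr1 ?mulrNN ?mul1r ?mulN1r //.
  - by rewrite (ler0_norm h) opprK.
  - by rewrite (gtr0_norm h).
pose x' r := x (r0 + b * r).
have Hx' : is_flowA al (b%:C * eta1) x' := flow_affine b r0 Hx.
have nb : nsq (b%:C * eta1) = 1 by rewrite nsqM nsqR expr2 bb mul1r.
have x'0 : x' 0 = x r0 by rewrite /x' mulr0 addr0.
have bx' : balanced (x' 0) by rewrite x'0.
have ck : cubic (b%:C * eta1) (x' 0) = b%:C * ka.
  by rewrite x'0 /ka /cubic conjMc conj_real; ring.
have xx' r : x r = x' (b * (r - r0)) by rewrite /x' mulrA bb mul1r addrC subrK.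
case h : (0 <= b * Im ka).
  have [d0 [d1 [d2 [n0 n1 n2 zx]]]] : exists d0 d1 d2, [/\ nsq d0 = 1, nsq d1 = 1, nsq d2 = 1 &
      forall r, z r = phase_rot d0 d1 d2 (x' r)].
    by apply: (flow_match e1 nb Hz Hx' bz bx'); rewrite cz ck (signed_parts bb bR) h.
  exists (phase_rot d0^* d1^* d2^*), 1, b; split; rewrite ?mulr1 //.
    by apply: isometry_phase_rot; rewrite nsqJ.
  move=> s r; rewrite /orbit_surf /= mul1r zx torus_rot_phase phase_rotK //.
  by rewrite -xx'.
have Hc := flow_conj Hx'.
have nbc : nsq (b%:C * eta1)^* = 1 by rewrite nsqJ.
have [d0 [d1 [d2 [n0 n1 n2 zx]]]] : exists d0 d1 d2, [/\ nsq d0 = 1, nsq d1 = 1, nsq d2 = 1 &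
    forall r, z r = phase_rot d0 d1 d2 (conj_vec (x' r))].
  apply: (flow_match e1 nbc Hz Hc bz _).
    by have [h0 h1 h2] := bx'; split; rewrite /conj_vec v3E nsqJ.
  have -> : cubic (b%:C * eta1)^* (conj_vec (x' 0)) = (b%:C * ka)^*.
    by rewrite -ck /cubic /conj_vec !v3E !conjMc.
  by rewrite cz (signed_parts bb bR) h.
(* Conjugation reverses the rotation, hence the sign on the parameter [s]. *)
exists (fun w => conj_vec (phase_rot d0^* d1^* d2^* w)), (-1), b.
split; rewrite ?mulrNN ?mulr1 //.
  by apply: (isometry_comp isometry_conj_vec); apply: isometry_phase_rot; rewrite nsqJ.
move=> s r; rewrite /orbit_surf /= mulN1r zx torus_rot_phase phase_rotK //.
by rewrite torus_rot_conj opprK conj_vecK -xx'.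
Qed.

End Matching.

(** * Real functions and diffeomorphisms of the line *)

Section LineMaps.
Local Open Scope ring_scope.
Context {R : realType}.
Implicit Types (f g d : R -> R).

Lemma mvt_line f d a b : (forall t : R, is_derive t 1 f (d t)) -> a < b ->
  exists2 c, a < c < b & f b - f a = d c * (b - a).
Proof.
move=> H ab; have [c] := MVT ab (fun x _ => H x) (continuous_subspaceT (is_derive_continuous H)).
by rewrite in_itv /= => acb e; exists c.
Qed.

Lemma nonzero_pos f a b : continuous f -> (forall t, f t != 0) -> 0 < f a -> 0 < f b.
Proof.
move=> cf f0 fa; rewrite lt_neqAle eq_sym f0 /= leNgt; apply/negP => fb.
have [c _ /eqP] : exists2 c, true & f c = 0.
  have [ab|ab] := leP a b.
    have [|c _ e] := @IVT _ f a b 0 ab (continuous_subspaceT cf); last by exists c.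
    by rewrite ge_min le_max (ltW fb) (ltW fa) orbT.
  have [|c _ e] := @IVT _ f b a 0 (ltW ab) (continuous_subspaceT cf); last by exists c.
  by rewrite ge_min le_max (ltW fb) (ltW fa) orbT.
by rewrite (negbTE (f0 c)).
Qed.

(** The slope [g] is strictly decreasing, so it is nonzero somewhere; the graph lies below the
    tangent there, which reaches zero at [t - f t / g t]. *)
Lemma concave_not_pos f g h : (forall t : R, is_derive t 1 f (g t)) ->
  (forall t : R, is_derive t 1 g (h t)) -> (forall t, h t < 0) -> ~ (forall t, 0 < f t).
Proof.
move=> Hf Hg h0 f0.
have dec a b : a < b -> g b < g a.
  move=> ab; have [c _ e] := mvt_line Hg ab.
  by rewrite -subr_lt0 e nmulr_rlt0 ?subr_gt0.
have [t gt0] : exists t, g t != 0.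
  have [g00|g00] := eqVneq (g 0) 0; last by exists 0.
  by exists 1; have := dec 0 1 ltr01; rewrite g00 lt_neqAle => /andP[].
have [gp|gn] : 0 < g t \/ g t < 0 by move: gt0; rewrite neq_lt => /orP[]; [right|left].
  have ab : t - (f t / g t) < t by rewrite gtrBl divr_gt0.
  have [c /andP[_ ct] e] := mvt_line Hf ab.
  have := f0 (t - f t / g t); have := dec _ _ ct; move: e; rewrite opprB addrCA subrr addr0 => e k.
  have : g t * (f t / g t) <= g c * (f t / g t) by rewrite ler_wpM2r ?divr_ge0 ?ltW.
  by rewrite -e mulrCA divff // mulr1; lra.
have ab : t < t + f t / - g t by rewrite ltrDl divr_gt0 // oppr_gt0.
have [c /andP[tc _] e] := mvt_line Hf ab.
have := f0 (t + f t / - g t); have := dec _ _ tc; move: e; rewrite addrAC subrr add0r => e k.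
have : g c * (f t / - g t) <= g t * (f t / - g t).
  by rewrite ler_wpM2r ?divr_ge0 ?ltW // oppr_gt0.
by rewrite -e invrN mulrN mulrN mulrCA divff // mulr1; lra.
Qed.

Lemma periodic_lower_bound f T : continuous f -> T != 0 -> (forall t, f (t + T) = f t) ->
  (forall t, 0 < f t) -> exists2 e, 0 < e & forall t, e <= f t.
Proof.
move=> cf; wlog T0 : T / 0 < T => [H Tn0 fT fp|_ fT fp].
  have [Tp|Tn] := ltP 0 T; first exact: (H T).
  apply: (H (- T)); rewrite ?oppr_eq0 ?oppr_gt0 //; first by rewrite lt_neqAle Tn0.
  by move=> t; rewrite -[in LHS]fT subrK.
have [c _ fc] := EVT_min (ltW T0) (continuous_subspaceT cf).
exists (f c) => // t.
have per (n : int) s : f (s + n%:~R * T) = f s.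
  have pn (k : nat) s' : f (s' + k%:R * T) = f s'.
    by elim: k => [|k IH]; rewrite ?mul0r ?addr0 // -natr1 mulrDl mul1r addrA fT.
  case: n => k; first exact: pn.
  by rewrite NegzE mulrNz mulNr -(pn k.+1) subrK.
rewrite -(per (- Num.floor (t / T)) t) fc // in_itv /= mulrNz mulNr subr_ge0 lerBlDr.
rewrite -[X in X + _]mul1r -mulrDl -!(ler_pdivlMr _ _ T0) -(ler_pdivrMr _ _ T0).
have /andP[-> h2] := floor_itv (t / T).
by apply: ltW; rewrite addrC; move: h2; rewrite intrD.
Qed.

(** The lower bound on the derivative makes [f] onto; the inverse gains regularity step by step from
    [g' = 1 / d(g)]. *)
Lemma line_diffeo f d : (forall t : R, is_derive t 1 f (d t)) -> (forall k, is_Ck k d) ->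
  (exists2 e, 0 < e & forall t, e <= d t) ->
  exists g, [/\ cancel f g, cancel g f, forall y : R, is_derive y 1 g (d (g y))^-1 &
    forall k, is_Ck k g].
Proof.
move=> Hf Hd [e e0 ed].
have cf := is_derive_continuous Hf.
have grow a b : a <= b -> e * (b - a) <= f b - f a.
  rewrite le_eqVlt => /orP[/eqP ->|ab]; first by rewrite !subrr mulr0.
  by have [c _ ->] := mvt_line Hf ab; rewrite ler_wpM2r // subr_ge0 ltW.
have inj : injective f.
  move=> a b; wlog ab : a b / a <= b => [H E|E].
    by have [ab|/ltW ba] := leP a b; [exact: H|apply/esym/H].
  apply/eqP; rewrite eq_le ab -subr_le0 /=.
  by have := grow _ _ ab; rewrite E subrr pmulr_rle0.
have sur y : exists x, f x = y.
  pose T := `|y - f 0| / e.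
  have T0 : 0 <= T by rewrite divr_ge0 // ltW.
  have eT : e * T = `|y - f 0| by rewrite mulrC divfK ?gt_eqF.
  have h1 : f (- T) <= y.
    have := @grow (- T) 0; rewrite oppr_le0 opprK add0r eT => /(_ T0).
    by have := ler_norm (- (y - f 0)); rewrite normrN; lra.
  have h2 : y <= f T.
    have := @grow 0 T T0; rewrite subr0 eT.
    by have := ler_norm (y - f 0); lra.
  have TT : - T <= T by lra.
  have [|x _ <-] := @IVT _ f (- T) T y TT (continuous_subspaceT cf); last by exists x.
  by rewrite ge_min le_max h1 h2 orbT.
have [g fg] := choice sur.
have gf : cancel f g by move=> x; apply: inj; rewrite fg.
have Hg (y : R) : is_derive y 1 g (d (g y))^-1.
  rewrite -{1}[y]fg; apply: is_derive_inverse => //.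
  - by near=> x; exact: gf.
  - by near=> x; exact: cf.
  - by rewrite gt_eqF // (lt_le_trans e0).
have cg := is_derive_continuous Hg.
exists g; split=> //; elim=> [|k IH]; first by split.
apply: (CkS_derive1 Hg); apply: Ck_inv; last exact: Ck_comp1.
by move=> y; rewrite gt_eqF // (lt_le_trans e0).
Unshelve. all: by end_near.
Qed.

End LineMaps.

Section Balanced.
Local Open Scope ring_scope.
Context {R : realType}.

(* With [nsq x_j = 1/3 + c_j gamma], the function [gamma] satisfies
   [gamma'' = - 6 E gamma], where [E > 0] is the energy. *)
Lemma flow_balanced (al : R) eta x : 0 <= al <= 1 -> nsq eta = 1 -> is_flowA al eta x ->
  S5 (x 0) -> moment al (x 0) = 0 -> (forall t, 0 < energy al (x t)) ->
  exists r, balanced (x r).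
Proof.
move=> /andP[a0 a1] e1 H hS hM E0.
have S t : S5 (x t) := flow_S5 (crossA_sum0 al) H hS t.
have M t : moment al (x t) = 0 by rewrite (flow_moment 0 t H).
have a3 : 1 + 2 * al != 0 by rewrite gt_eqF //; lra.
pose ga t := (3^-1 - nsq (x t o0 0)) / (1 + 2 * al).
have nE t : [/\ nsq (x t o0 0) = 3^-1 - (1 + 2 * al) * ga t,
    nsq (x t o1 0) = 3^-1 + (2 + al) * ga t & nsq (x t o2 0) = 3^-1 + (al - 1) * ga t].
  have [g [h0 h1 h2]] := moment_line a0 (S t) (M t).
  suff -> : ga t = g by [].
  by rewrite /ga h0; field.
have D1 (t : R) : is_derive t 1 ga (2 * Re (cubic eta (x t))).
  have [h0 _ _] := flow_nsq t H.
  have := is_deriveZf ((1 + 2 * al)^-1) (is_deriveDf (is_derive_cst (3^-1 : R) t 1) (is_deriveNf h0)).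
  apply: is_derive_ext => [s|]; first by rewrite /ga mulrC.
  by rewrite add0r mulNr opprK mulKf.
have D2 (t : R) : is_derive t 1 (fun t => 2 * Re (cubic eta (x t))) (- 6 * energy al (x t) * ga t).
  have [h _] := flow_cubic e1 t H; apply: is_derive_ext (is_deriveZf 2 h) => //.
  by rewrite /energy; have [-> -> ->] := nE t; rewrite /=; field.
have [r gr] : exists r, ga r = 0.
  have cg := is_derive_continuous D1.
  apply: contrapT => /forallNP g0.
  have g0' t : ga t != 0 by apply/eqP; exact: g0.
  have [gp|gn] : 0 < ga 0 \/ 0 < - ga 0.
    by move: (g0' 0); rewrite neq_lt oppr_gt0 => /orP[]; [right|left].
  - have gp' t := nonzero_pos t cg g0' gp.
    apply: (concave_not_pos D1 D2 _ gp') => t.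
    by rewrite pmulr_llt0 // nmulr_rlt0 // oppr_lt0.
  - have D1' t := is_deriveNf (D1 t); have D2' t := is_deriveNf (D2 t).
    have gp' t : 0 < - ga t.
      apply: (nonzero_pos (f := fun t => - ga t) (a := 0)) => // s; last by rewrite oppr_eq0.
      exact: is_derive_continuous D1' _.
    apply: (concave_not_pos D1' D2' _ gp') => t.
    by rewrite -mulrN pmulr_llt0 // nmulr_rlt0 // oppr_lt0.
by exists r; have [h0 h1 h2] := nE r; split; rewrite ?h0 ?h1 ?h2 gr ?mulr0 ?addr0 ?subr0.
Qed.

End Balanced.

(** * The equality case of the calibration inequality *)

Section Calibration.
Local Open Scope ring_scope.
Context {R : realType}.
Implicit Types (x v w : 'cV[R[i]]_3) (dl : R[i]).

Definition hdot x v : R[i] :=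
  x o0 0 * (v o0 0)^* + x o1 0 * (v o1 0)^* + x o2 0 * (v o2 0)^*.

(** The vector that represents the real linear form [Re (dl * det3 x v w)] of [w] for the real inner
    product. *)
Definition cross_dual dl x v : 'cV[R[i]]_3 :=
  vec3 (dl * (x o1 0 * v o2 0 - x o2 0 * v o1 0))^*
       (dl * (x o2 0 * v o0 0 - x o0 0 * v o2 0))^*
       (dl * (x o0 0 * v o1 0 - x o1 0 * v o0 0))^*.

Lemma rdot_cross_dual dl x v w : rdot w (cross_dual dl x v) = Re (dl * det3 x v w).
Proof. by rewrite rdotH /cross_dual !v3E !conjKc; congr Re; rewrite /det3; ring. Qed.

Lemma hdot_self x : hdot x x = (rdot x x)%:C.
Proof.
rewrite /hdot !nsqE rdot_nsq; move: (nsq _) (nsq _) (nsq _) => a b c.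
by rewrite !rmorphD.
Qed.

Lemma cross_dual_norm dl x v : nsq dl = 1 ->
  rdot (cross_dual dl x v) (cross_dual dl x v) = rdot x x * rdot v v - nsq (hdot x v).
Proof.
move=> /unitK h; apply: (@complexI R).
have -> : (rdot x x * rdot v v - nsq (hdot x v))%:C =
    hdot x x * hdot v v - hdot x v * (hdot x v)^*.
  by rewrite nsqE !hdot_self; move: (nsq _) => n; rewrite rmorphB rmorphM.
rewrite -hdot_self.
rewrite /hdot /cross_dual !v3E !conjKc !(conjMc, conjDc, conjNc, conjKc).
rewrite -[RHS]mul1r -h; ring.
Qed.

(* Equality in [Re (dl * det3 x v w) = <w, n> <= |w'| |n| <= |w'| |v|], where
   [n = cross_dual dl x v] is orthogonal to [v] and [w'] is the component of [w]
   orthogonal to [v]. *)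
Lemma calibration_equality dl x v w : nsq dl = 1 -> S5 x -> 0 < rdot v v ->
  0 < rdot v v * rdot w w - rdot v w ^+ 2 ->
  Re (dl * det3 x v w) = Num.sqrt (rdot v v * rdot w w - rdot v w ^+ 2) ->
  hdot x v = 0 /\ exists (mu nu : R),
    0 < nu /\ w = mu%:C *: v + nu%:C *: cross_dual dl x v.
Proof.
move=> e1 hx v0 g0; rewrite -rdot_cross_dual => E.
have nn := cross_dual_norm x v e1; rewrite hx mul1r in nn.
have vn : rdot v (cross_dual dl x v) = 0.
  by rewrite rdot_cross_dual /det3 (_ : _ * _ = 0) //; ring.
move: E nn vn; move: (cross_dual dl x v) => n E nn vn.
set G := _ - _ in g0 E; have E2 : rdot w n ^+ 2 = G by rewrite E sqr_sqrtr // ltW.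
set mu := rdot v w / rdot v v; set nu := rdot w n / rdot v v.
pose d := w - (mu%:C *: v + nu%:C *: n).
(* The left-hand side is nonnegative and the right-hand side nonpositive, so both vanish: this gives
   the decomposition of [w] and the Legendrian condition together. *)
have dd : rdot v v ^+ 2 * rdot d d = - (G * nsq (hdot x v)).
  rewrite /d rdotDl !rdotDr !rdotNl !rdotNr !rdotDl !rdotDr !rdotZl !rdotZr.
  rewrite (rdotC n v) (rdotC n w) (rdotC v w) vn nn /mu /nu (rdotC v w) -E2.
  have : rdot w n ^+ 2 = rdot v v * rdot w w - rdot w v ^+ 2 by rewrite E2 /G (rdotC v w).
  move: (rdot v v) v0 (rdot w w) (rdot w v) (rdot w n) (nsq _) => e e0 f g r h re.
  have {}e0 : e != 0 by rewrite gt_eqF.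
  have -> : f = (r ^+ 2 + g ^+ 2) / e by rewrite re subrK mulrC mulKf.
  by field.
have [k0 k1] := And3 (nsq_ge0 (hdot x v)) (rdot_ge0 d) I.
have v2 : 0 < rdot v v ^+ 2 by rewrite exprn_gt0.
have p1 : 0 <= G * nsq (hdot x v) by rewrite mulr_ge0 // ltW.
have p2 : 0 <= rdot v v ^+ 2 * rdot d d by rewrite mulr_ge0 // ltW.
have h0 : G * nsq (hdot x v) = 0 by lra.
have d0 : rdot v v ^+ 2 * rdot d d = 0 by lra.
split.
  by apply: nsq_eq0; move/eqP: h0; rewrite mulf_eq0 gt_eqF //= => /eqP.
exists mu, nu; split; first by rewrite divr_gt0 // E sqrtr_gt0.
apply/eqP; rewrite -subr_eq0; apply/eqP/rdot_eq0.
by move/eqP: d0; rewrite mulf_eq0 gt_eqF //= => /eqP.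
Qed.

End Calibration.

(** * From a calibrated profile to the profile equation *)

Section Reparametrization.
Local Open Scope ring_scope.
Context {R : realType}.
Implicit Types (al : R) (eta : R[i]).

Lemma Ck_rdot (V : normedModType R) k (f g : V -> 'cV[R[i]]_3) :
  (forall j, cCk k (fun q => f q j 0)) -> (forall j, cCk k (fun q => g q j 0)) ->
  is_Ck k (fun q => rdot (f q) (g q)).
Proof.
move=> Hf Hg; under eq_fun do rewrite rdotE.
have D j : is_Ck k (fun q => Re (f q j 0) * Re (g q j 0) + Im (f q j 0) * Im (g q j 0)).
  by have [f1 f2] := Hf j; have [g1 g2] := Hg j; apply: Ck_add; exact: Ck_mul.
by apply: Ck_add => //; exact: Ck_add.
Qed.

Lemma cCk_torus_gen (V : normedModType R) k al (f : V -> 'cV[R[i]]_3) :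
  (forall j, cCk k (fun q => f q j 0)) -> forall j, cCk k (fun q => torus_gen al (f q) j 0).
Proof.
move=> Hf; apply: ord3P; under eq_fun do rewrite v3E;
by apply: cCk_mul => //; exact: cCk_cst.
Qed.

Lemma cCk_crossA (V : normedModType R) k al eta (f : V -> 'cV[R[i]]_3) :
  (forall j, cCk k (fun q => f q j 0)) -> forall j, cCk k (fun q => crossA al eta (f q) j 0).
Proof.
move=> Hf; apply: ord3P; under eq_fun do rewrite v3E;
by apply: cCk_mul; [exact: cCk_cst|apply: cCk_conj; exact: cCk_mul].
Qed.

Lemma vder_rot_comp (V : normedModType R) al (y : R -> 'cV[R[i]]_3) (s h : V -> R) p v ds dh e :
  is_derive p v s ds -> is_derive p v h dh -> vder (h p) 1 y e ->
  vder p v (fun q => torus_rot al (s q) (y (h q)))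
    (ds%:C *: torus_gen al (torus_rot al (s p) (y (h p))) + dh%:C *: torus_rot al (s p) e).
Proof.
move=> Hs Hh Hy.
have Y j : cder p v (fun q => y (h q) j 0) (e j 0 * dh%:C).
  exact: (cder_comp (f := fun t => y t j 0) Hh (Hy j)).
apply: vder_eq; last first.
  apply: vder_vec3.
  - by apply: cderM (Y o0); exact: cder_cexp Hs.
  - by apply: cderM (Y o1); exact: (cder_cexp (is_deriveZf al Hs)).
  - by apply: cderM (Y o2); exact: (cder_cexp (is_deriveZf (-1 - al) Hs)).
by apply: vec3P; rewrite !mxE /= ?rmorphM /=; ring.
Qed.

Lemma rdot_rot al s x y : rdot (torus_rot al s x) (torus_rot al s y) = rdot x y :> R.
Proof. by apply: rdot_phase_rot; rewrite nsq_cexp. Qed.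

Lemma smooth_curve_derivative (y : R -> 'cV[R[i]]_3) : (forall k j, cCk k (fun t => y t j 0)) ->
  exists2 d, (forall t : R, vder t 1 y (d t)) & forall k j, cCk k (fun t => d t j 0).
Proof.
move=> H; exists (fun t => \col_j ('D_1 (fun q => Re (y q j 0)) t +i*
  'D_1 (fun q => Im (y q j 0)) t)).
  move=> t j; rewrite mxE; have [h1 h2] := H 1%N j; split=> /=.
    by have [/(_ t)] := CkS_inv (1 : R) h1.
  by have [/(_ t)] := CkS_inv (1 : R) h2.
move=> k j; under eq_fun do rewrite mxE; have [h1 h2] := H k.+1 j; split=> /=.
  by have [_] := CkS_inv (1 : R) h1.
by have [_] := CkS_inv (1 : R) h2.
Qed.

Lemma smooth_primitive (f : R -> R) : (forall k, is_Ck k f) ->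
  exists2 F, (forall t : R, is_derive t 1 F (f t)) & forall k, is_Ck k F.
Proof.
move=> Hf; have [F HF] := continuous_primitive (Ck_continuous (Hf 0%N)).
exists F => // -[|k]; first by split=> //; exact: is_derive_continuous HF.
exact: CkS_derive1 HF _.
Qed.

(** The primitive of [lam mu] is the rotation to be undone and that of [lam nu] the new time. As [y]
    is periodic up to a rotation, [nu] is periodic, hence bounded below, and the new time is a
    diffeomorphism of the line. *)
Lemma orbit_reparam al eta (lam : R) (y : R -> 'cV[R[i]]_3) (mu nu : R -> R) (T c : R) :
  nsq eta = 1 -> lam != 0 -> (forall k j, cCk k (fun t => y t j 0)) ->
  (forall t, [/\ S5 (y t), moment al (y t) = 0 & 0 < energy al (y t)]) ->
  (forall t : R, vder t 1 y ((lam * mu t)%:C *: torus_gen al (y t) +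
                         (lam * nu t)%:C *: crossA al eta (y t))) ->
  (forall t, 0 < nu t) -> T != 0 -> (forall t, y (t + T) = torus_rot al c (y t)) ->
  exists x (sg ta ti : R -> R), [/\ is_flowA al eta x,
    (forall t, y t = torus_rot al (sg t) (x (ta t))),
    cancel ta ti, cancel ti ta & forall k, [/\ is_Ck k sg, is_Ck k ta & is_Ck k ti]].
Proof.
move=> e1 l0 Hy Hp Hd nu0 T0 yT.
have [d dy dC] := smooth_curve_derivative Hy.
have dE t : d t = (lam * mu t)%:C *: torus_gen al (y t) + (lam * nu t)%:C *: crossA al eta (y t).
  exact: vder_unique (dy t) (Hd t).
pose E t := energy al (y t); have E0 t : lam * E t != 0.
  by have [_ _ h] := Hp t; rewrite mulf_neq0 // gt_eqF.
(* Expressing [nu] and [mu] as inner products of smooth curves yields their smoothness and the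
   periodicity of [nu]. *)
have nuE t : nu t = rdot (crossA al eta (y t)) (d t) / (lam * E t).
  have [h1 h2 _] := Hp t; apply: (mulIf (E0 t)); rewrite divfK // dE rdot_comb.
  by rewrite (rdotC (crossA _ _ _)) rdot_gen_cross rdot_cross_cross // /E; ring.
have muE t : mu t = rdot (torus_gen al (y t)) (d t) / (lam * E t).
  apply: (mulIf (E0 t)); rewrite divfK // dE rdot_comb rdot_gen_gen rdot_gen_cross /E.
  by ring.
have iE k : is_Ck k (fun t => (lam * E t)^-1).
  apply: Ck_inv => //; apply: Ck_scale; rewrite /E.
  by under eq_fun do rewrite -rdot_gen_gen; apply: Ck_rdot => j; exact: cCk_torus_gen.
have nuC k : is_Ck k nu.
  rewrite (funext nuE); apply: Ck_mul => //; apply: Ck_rdot => // j; exact: cCk_crossA.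
have muC k : is_Ck k mu.
  rewrite (funext muE); apply: Ck_mul => //; apply: Ck_rdot => // j; exact: cCk_torus_gen.
have dT t : d (t + T) = torus_rot al c (d t).
  apply: (vder_unique (p := t) (v := 1) (f := fun s : R => y (s + T))).
    move=> j; have D : is_derive t 1 (fun s : R => s + T) 1.
      by apply: is_derive_ext (is_deriveDf (is_derive_id t 1) (is_derive_cst T t 1)); rewrite ?addr0.
    by apply: cder_eq (cder_comp (f := fun t => y t j 0) D (dy (t + T) j)); rewrite mulr1.
  have := vder_rot_comp al (is_derive_cst c t 1) (is_derive_id t 1) (dy t).
  rewrite scale0r add0r scale1r; apply: vder_ext => s; by rewrite yT.
have nuT t : nu (t + T) = nu t.
  rewrite !nuE /E dT !yT energy_rot -[crossA al eta (torus_rot _ _ _)]torus_rot_cross.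
  by rewrite rdot_rot.
have [rh rhD rhC] := smooth_primitive nuC.
have [gi [K1 K2 giD giC]] := line_diffeo rhD nuC (periodic_lower_bound (Ck_continuous (nuC 0%N)) T0 nuT nu0).
have [sg sgD sgC] := smooth_primitive (fun k => Ck_scale lam (muC k)).
pose ti r := gi (lam^-1 * r).
have tiD (r : R) : is_derive r 1 ti (lam * nu (ti r))^-1.
  have := is_derive_comp1 (is_deriveZf lam^-1 (is_derive_id r 1)) (giD (lam^-1 * r)).
  by apply: is_derive_ext => //; rewrite mulr1 invfM mulrC.
exists (fun r => torus_rot al (- sg (ti r)) (y (ti r))), sg, (fun t => lam * rh t), ti.
have tiK t : ti (lam * rh t) = t by rewrite /ti mulKf.
split=> //.
- move=> r; have n0 : lam * nu (ti r) != 0 by rewrite mulf_neq0 // gt_eqF.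
  have D1 := is_deriveNf (is_derive_comp1 (tiD r) (sgD (ti r))).
  have := vder_rot_comp al D1 (tiD r) (dy (ti r)).
  apply: vder_eq; rewrite dE -[RHS]/(crossA al eta _) -torus_rot_cross.
  have rl (a b : R[i]) u v s : torus_rot al s (a *: u + b *: v) =
      a *: torus_rot al s u + b *: torus_rot al s v.
    by apply: vec3P; rewrite !mxE /= ?mxE; ring.
  rewrite rl torus_rot_gen scalerDr !scalerA addrA -scalerDl -!rmorphM -rmorphD.
  by rewrite mulVf // [_^-1 * (_ * mu _)]mulrC addNr rmorph0 rmorph1 scale0r add0r scale1r.
- by move=> t; rewrite tiK -torus_rotD subrr torus_rot0.
- by move=> r; rewrite /ti K2 mulVKf.
- move=> k; split=> //; first exact: Ck_scale.
  apply: (Ck_comp1 (h := fun r => lam^-1 * r)) => //; apply: Ck_scale; exact: Ck_id.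
Qed.

End Reparametrization.

(** * Diagonalisation of skew-Hermitian matrices *)

Section UnitaryMatrices.
Local Open Scope ring_scope.
Local Open Scope sesquilinear_scope.
Context {R : realType}.
Implicit Types (P B : 'M[R[i]]_3) (x y : 'cV[R[i]]_3).

Lemma rdot_unitary P x y : P \is unitarymx -> rdot (P *m x) (P *m y) = rdot x y.
Proof.
move=> HP; have E (v w : 'cV[R[i]]_3) : rdot v w = Re ((w ^t* *m v) 0 0).
  by rewrite /rdot mxE; congr Re; apply: eq_bigr => j _; rewrite !mxE mulrC.
rewrite !E trmx_mul map_mxM -mulmxA [P ^t* *m _]mulmxA.
by have /unitarymxP/mulmx1C -> := HP; rewrite mul1mx.
Qed.

Lemma nsq_det_unitary P : P \is unitarymx -> nsq (\det P) = 1.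
Proof.
move=> /unitarymxP/(congr1 determinant); rewrite det_mulmx det1 det_map_mx det_tr nsqE.
by move=> /complexI.
Qed.

Lemma det3_mulmx P x y z : det3 (P *m x) (P *m y) (P *m z) = \det P * det3 x y z.
Proof.
rewrite -!det3E -det_mulmx; congr (\det _); apply/matrixP => i j; rewrite !mxE.
by move: j; apply: ord3P; rewrite /= mxE; apply: eq_bigr => k _; rewrite mxE.
Qed.

Lemma isometry_unitary P : P \is unitarymx -> isometry_S5 (mulmx P).
Proof.
move=> HP; apply: (@rdot_isometry _ _ (mulmx (P ^t*))) => [x y|x]; first exact: rdot_unitary.
by rewrite mulmxA; have /unitarymxP -> := HP; rewrite mul1mx.
Qed.

Lemma skew_spectral B : skew_hermitian B -> exists P (b : 'I_3 -> R),
  P \is unitarymx /\ P *m B = diag_mx (\row_j ('i%C * (b j)%:C)) *m P.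
Proof.
move=> HB; pose H := - 'i%C *: B.
have hH : H \is hermsymmx.
  apply/is_hermitianmxP; rewrite expr0 scale1r; apply/matrixP => i j.
  by rewrite !mxE HB conjMc conjNc conj_i opprK mulrNN.
have /hermitian_normalmx/orthomx_spectralP HE := hH.
have /mxOverP Hr := hermitian_spectral_diag_real hH.
exists (spectralmx H), (fun j => Re (spectral_diag H 0 j)); split; first exact: spectral_unitarymx.
have -> : B = 'i%C *: H.
  by rewrite scalerA mulrN mulii opprK scale1r.
move: HE Hr (spectral_unit H); move: (spectralmx H) (spectral_diag H) => P sp HE Hr uP.
have -> : P *m ('i%C *: H) = 'i%C *: diag_mx sp *m P.
  by rewrite -scalemxAr HE -!mulmxA mulKVmx // scalemxAl.
congr (_ *m _); apply/matrixP => i j; rewrite !mxE.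
case: eqP => _; last by rewrite !mulr0n mulr0.
rewrite !mulr1n; congr (_ * _); apply: ceq => //=.
have /CrealP/(congr1 (fun c : R[i] => Im c)) := Hr 0 i; rewrite ImJc; lra.
Qed.

Lemma diag_permute (s : {perm 'I_3}) P B (b : 'I_3 -> R) : P \is unitarymx ->
  P *m B = diag_mx (\row_j ('i%C * (b j)%:C)) *m P ->
  row_perm s P \is unitarymx /\
  row_perm s P *m B = diag_mx (\row_j ('i%C * (b (s j))%:C)) *m row_perm s P.
Proof.
move=> HP HB; split.
  rewrite row_permE; refine (mul_unitarymx _ HP); apply/unitarymxP.
  by rewrite tr_perm_mx map_perm_mx -perm_mxM mulgV perm_mx1.
rewrite {1}row_permE -mulmxA HB -row_permE.
by rewrite !mul_diag_mx; apply/matrixP => i j; rewrite !mxE.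
Qed.

Lemma expmx_orbit P B (b : 'I_3 -> R) (s : R) x : P \is unitarymx ->
  P *m B = diag_mx (\row_j ('i%C * (b j)%:C)) *m P ->
  expmx (s%:C *: B) *m x = P ^t* *m phase_rot (cexp (b o0 * s)) (cexp (b o1 * s))
    (cexp (b o2 * s)) (P *m x).
Proof.
move=> /unitarymxP HP HB; have PP := mulmx1C HP.
have -> : B = P ^t* *m diag_mx (\row_j ('i%C * (b j)%:C)) *m P.
  by rewrite -mulmxA -HB mulmxA PP mul1mx.
rewrite expmx_diag_cexp // -!mulmxA; congr (_ *m _).
by apply: vec3P; rewrite /phase_rot !v3E mul_diag_mx !mxE.
Qed.

End UnitaryMatrices.

(** * Normal form of the eigenvalues *)

Section Weights.
Local Open Scope ring_scope.
Context {R : realType}.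
Implicit Types (b : 'I_3 -> R).

Definition normal_weights b := exists (s : {perm 'I_3}) (lam al : R),
  [/\ 0 <= al <= 1, b (s o0) = lam, b (s o1) = lam * al & b (s o2) = lam * (- 1 - al)].

(* The entry of largest absolute value plays the role of [- 1 - al]. *)
Lemma normal_weightsP b : b o0 + b o1 + b o2 = 0 -> normal_weights b.
Proof.
have perm (t : {perm 'I_3}) c : normal_weights (fun j => c (t j)) -> normal_weights c.
  by move=> [s [lam [al H]]]; exists (s * t)%g, lam, al; rewrite !permM.
have base c : c o0 + c o1 + c o2 = 0 -> `|c o1| <= `|c o0| -> `|c o0| <= `|c o2| ->
    normal_weights c.
  move=> c0 h10 h02; exists 1%g, (c o0), (c o1 / c o0); rewrite !perm1.
  (* In this case all three entries vanish, and the quotient [c o1 / c o0] is [0] by convention. *)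
  have [z0|z0] := eqVneq (c o0) 0.
    move: h10; rewrite z0 normr0 normr_le0 => /eqP z1.
    by rewrite invr0 mulr0 !mul0r lexx ler01; split=> //; lra.
  have k0 : 0 < c o0 ^+ 2 by rewrite exprn_even_gt0.
  have sq (u v : R) : `|u| <= `|v| -> u ^+ 2 <= v ^+ 2.
    by rewrite -(@ler_pXn2r _ 2) ?nnegrE // !real_normK ?num_real.
  have q1 := sq _ _ h10; have q2 := sq _ _ h02.
  have e2 : c o2 = - (c o0 + c o1) by lra.
  (* Opposite signs would make [|c o2| = |c o0 + c o1|] smaller than [|c o0|]. *)
  have p0 : 0 <= c o0 * c o1.
    rewrite leNgt; apply/negP => p0.
    move: q2; rewrite e2 sqrrN sqrrD => q2.
    have r1 : - (c o0 * c o1) < c o1 ^+ 2 by lra.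
    have r2 : (c o0 * c o1) ^+ 2 < (c o1 ^+ 2) ^+ 2.
      by rewrite -(sqrrN (c o0 * _)) ltr_pXn2r ?nnegrE ?sqr_ge0 //; lra.
    have : (c o0 * c o1) ^+ 2 >= (c o1 ^+ 2) ^+ 2.
      have -> : (c o0 * c o1) ^+ 2 = c o0 ^+ 2 * c o1 ^+ 2 by ring.
      by rewrite -[X in X <= _]/(c o1 ^+ 2 * c o1 ^+ 2) ler_wpM2r ?sqr_ge0.
    by move/(lt_le_trans r2); rewrite ltxx.
  have alE : c o1 / c o0 = c o0 * c o1 / c o0 ^+ 2 by field.
  split=> //; last 2 first.
  - by rewrite mulrC divfK.
  - by rewrite mulrBr mulrN1 [_ * (_ / _)]mulrC divfK // e2; ring.
  rewrite alE divr_ge0 ?sqr_ge0 //= ler_pdivrMr // mul1r.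
  by have := sqr_ge0 (c o0 - c o1); rewrite sqrrB; lra.
have last c : c o0 + c o1 + c o2 = 0 -> `|c o0| <= `|c o2| -> `|c o1| <= `|c o2| ->
    normal_weights c.
  move=> c0 h02 h12; have [h|h] := leP `|c o1| `|c o0|; first exact: base.
  apply: (perm (tperm o0 o1)); apply: base; rewrite ?tpermL ?tpermR ?tpermD //; last exact: ltW.
  by rewrite -c0; ring.
move=> b0; have [h02|h02] := leP `|b o0| `|b o2|.
  have [h12|h12] := leP `|b o1| `|b o2|; first exact: last.
  apply: (perm (tperm o1 o2)); apply: last; rewrite ?tpermL ?tpermR ?tpermD //; last exact: ltW.
    by rewrite -b0; ring.
  exact: le_trans h02 (ltW h12).
have [h10|h10] := leP `|b o1| `|b o0|.
  apply: (perm (tperm o0 o2)); apply: last; rewrite ?tpermL ?tpermR ?tpermD //; last exact: ltW.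
  by rewrite -b0; ring.
apply: (perm (tperm o1 o2)); apply: last; rewrite ?tpermL ?tpermR ?tpermD //; last 2 first.
- exact: ltW.
- exact: ltW (lt_trans h02 h10).
by rewrite -b0; ring.
Qed.

End Weights.

(** * The profile of a calibrated orbit surface in an eigenbasis *)

Section Profile.
Local Open Scope ring_scope.
Local Open Scope sesquilinear_scope.
Context {R : realType}.
Implicit Types (b : 'I_3 -> R) (w : 'cV[R[i]]_3).

Lemma is_derive_on_line (V : normedModType R) (f : V -> R) (p v : V) (t d : R) :
  is_derive (t *: v + p) v f d -> is_derive t 1 (fun s : R => f (s *: v + p)) d.
Proof.
move=> /is_derive_line H; apply/is_derive_line; apply: is_derive_ext H => // s.
by rewrite /= addrA -scalerDl [s *: 1]mulr1.
Qed.

Lemma Ck_on_line (V : normedModType R) k (f : V -> R) (p v : V) : is_Ck k f ->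
  is_Ck k (fun t : R => f (t *: v + p)).
Proof.
have cont (g : V -> R) : continuous g -> continuous (fun t : R => g (t *: v + p)).
  move=> cg t; apply: (@continuous_comp _ _ _ (fun t : R => t *: v + p) g); last exact: cg.
  by apply: cvgD; [apply: cvgZr_tmp; exact: cvg_id|exact: cvg_cst].
elim: k f => [|k IH] f Hf; first by split=> //; apply: cont; exact: Ck_continuous Hf.
have [H1 H2] := CkS_inv v Hf.
apply: (CkS_derive1 (d := fun t : R => 'D_v f (t *: v + p))); last exact: (IH _ H2).
by move=> t; exact: is_derive_on_line.
Qed.

Definition diag_gen b w : 'cV[R[i]]_3 :=
  vec3 ('i%C * (b o0)%:C * w o0 0) ('i%C * (b o1)%:C * w o1 0) ('i%C * (b o2)%:C * w o2 0).

Definition diag_rot b (s : R) w : 'cV[R[i]]_3 :=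
  phase_rot (cexp (b o0 * s)) (cexp (b o1 * s)) (cexp (b o2 * s)) w.

Lemma rdot_diag_rot b s x y : rdot (diag_rot b s x) (diag_rot b s y) = rdot x y.
Proof. by apply: rdot_phase_rot; rewrite nsq_cexp. Qed.

Lemma diag_rot0 b w : diag_rot b 0 w = w.
Proof. by apply: vec3P; rewrite /diag_rot /phase_rot !v3E mulr0 cexp0 mul1r. Qed.

Lemma diag_gen_rot b s w : diag_gen b (diag_rot b s w) = diag_rot b s (diag_gen b w).
Proof. by apply: vec3P; rewrite /diag_rot /diag_gen /phase_rot !v3E; ring. Qed.

Lemma det3_diag_rot b s x y z : det3 (diag_rot b s x) (diag_rot b s y) (diag_rot b s z) =
  cexp ((b o0 + b o1 + b o2) * s) * det3 x y z.
Proof.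
rewrite (_ : cexp _ = cexp (b o0 * s) * cexp (b o1 * s) * cexp (b o2 * s)).
  by rewrite /det3 /diag_rot /phase_rot !v3E; ring.
by rewrite -!cexpD -!mulrDl.
Qed.

Lemma vder_diag_rot b y d (p v : R * R) : vder p.2 1 y d ->
  vder p v (fun q => diag_rot b q.1 (y q.2))
    (v.1%:C *: diag_gen b (diag_rot b p.1 (y p.2)) + v.2%:C *: diag_rot b p.1 d).
Proof.
move=> Hy.
have Y j : cder p v (fun q => y q.2 j 0) (d j 0 * (v.2)%:C).
  exact: (cder_comp (f := fun t => y t j 0) (is_derive_snd p v) (Hy j)).
apply: vder_eq; last first.
  apply: vder_vec3.
  - by apply: cderM (Y o0); exact: (cder_cexp (is_deriveZf (b o0) (is_derive_fst p v))).
  - by apply: cderM (Y o1); exact: (cder_cexp (is_deriveZf (b o1) (is_derive_fst p v))).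
  - by apply: cderM (Y o2); exact: (cder_cexp (is_deriveZf (b o2) (is_derive_fst p v))).
by apply: vec3P; rewrite !mxE /= ?rmorphM /=; ring.
Qed.

(** Strict Cauchy-Schwarz: [rdot x x] times the Gram determinant is the squared norm of the
    combination [e y - f x], nonzero by independence. *)
Lemma gram_gt0 (x y : 'cV[R[i]]_3) :
  (forall a c : R, a%:C *: x + c%:C *: y = 0 -> a = 0 /\ c = 0) ->
  0 < rdot x x /\ 0 < rdot x x * rdot y y - rdot x y ^+ 2.
Proof.
move=> free.
have x0 : 0 < rdot x x.
  rewrite lt_neqAle rdot_ge0 andbT eq_sym; apply/eqP => /rdot_eq0 x0.
  have h : (1 : R)%:C *: x + (0 : R)%:C *: y = 0 by rewrite x0 scaler0 rmorph0 scale0r addr0.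
  by have [/eqP] := free _ _ h; rewrite oner_eq0.
split=> //; set e := rdot x x in x0 *; set f := rdot x y.
have k : e * (e * rdot y y - f ^+ 2) =
    rdot ((- f)%:C *: x + e%:C *: y) ((- f)%:C *: x + e%:C *: y).
  by rewrite rdotDl !rdotDr !rdotZl !rdotZr (rdotC y x) -/e -/f; ring.
rewrite -(pmulr_rgt0 _ x0) k lt_neqAle rdot_ge0 andbT eq_sym; apply/eqP => /rdot_eq0 h.
by have [_ e0] := free _ _ h; rewrite e0 ltxx in x0.
Qed.

Definition gram (x y : 'cV[R[i]]_3) : R := rdot x x * rdot y y - rdot x y ^+ 2.

Lemma calibrated_profile th B (z : R -> 'cV[R[i]]_3) P b : P \is unitarymx ->
  P *m B = diag_mx (\row_j ('i%C * (b j)%:C)) *m P -> (forall t, S5 (z t)) ->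
  special_legendrian th (fun p => expmx (p.1%:C *: B) *m z p.2) ->
  let y t := P *m z t in exists d (dl : R[i]),
  [/\ forall t : R, vder t 1 y (d t), forall k j, cCk k (fun t => y t j 0), nsq dl = 1 &
  forall s t, [/\ 0 < rdot (diag_gen b (y t)) (diag_gen b (y t)),
    0 < gram (diag_gen b (y t)) (d t) &
    Re (dl * cexp ((b o0 + b o1 + b o2) * s) * det3 (y t) (diag_gen b (y t)) (d t)) =
      Num.sqrt (gram (diag_gen b (y t)) (d t))]].
Proof.
move=> HP HB Sz; set u := fun p => _; move=> [[Su S5u imm] cal] y.
have PP : P *m P ^t* = 1%:M by apply/unitarymxP.
have HQ : P ^t* \is unitarymx by rewrite trmxC_unitary.
have uE p : u p = P ^t* *m diag_rot b p.1 (y p.2) := expmx_orbit p.1 (z p.2) HP HB.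
have Wu p : P *m u p = diag_rot b p.1 (y p.2) by rewrite uE mulmxA PP mul1mx.
(* The regularity of the profile is inherited from that of [u] along the line [s = 0]. *)
have yu t : y t = P *m u (t *: (0, 1) + (0, 0)).
  by rewrite Wu /= scaler0 addr0 diag_rot0 addr0 [t *: 1]mulr1.
have yC k j : cCk k (fun t => y t j 0).
  move/smooth_mapP : Su => Su.
  have ul l : cCk k (fun t : R => u (t *: (0, 1) + (0, 0)) l 0).
    have [h1 h2] := Su k l; split.
      exact: (Ck_on_line (f := fun q => Re (u q l 0))).
    exact: (Ck_on_line (f := fun q => Im (u q l 0))).
  apply: (cCk_ext (f := fun t : R => P j o0 * u (t *: (0, 1) + (0, 0)) o0 0 +
    P j o1 * u (t *: (0, 1) + (0, 0)) o1 0 + P j o2 * u (t *: (0, 1) + (0, 0)) o2 0)).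
    by move=> t; rewrite yu [RHS]mxE sum3.
  by apply: cCk_add; [apply: cCk_add|]; apply: cCk_mul => //; exact: cCk_cst.
have [d dy _] := smooth_curve_derivative yC.
have dU p v : du u p v = P ^t* *m ((v.1)%:C *: diag_rot b p.1 (diag_gen b (y p.2)) +
    (v.2)%:C *: diag_rot b p.1 (d p.2)).
  rewrite -diag_gen_rot; apply: du_vder; apply: (vder_ext (f := fun q => P ^t* *m diag_rot b q.1 (y q.2))).
    by move=> q; rewrite uE.
  by apply: vder_mulmx; apply: vder_diag_rot; exact: dy.
have ds p : du u p (1, 0) = P ^t* *m diag_rot b p.1 (diag_gen b (y p.2)).
  by rewrite dU /= scale0r addr0 scale1r.
have dt p : du u p (0, 1) = P ^t* *m diag_rot b p.1 (d p.2).
  by rewrite dU /= scale0r add0r scale1r.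
exists d, (cexp th * \det (P ^t*)); split=> //.
  by rewrite nsqM nsq_cexp nsq_det_unitary // mulr1.
move=> s t.
have [g1 g2] : 0 < rdot (diag_gen b (y t)) (diag_gen b (y t)) /\
    0 < gram (diag_gen b (y t)) (d t).
  apply: gram_gt0 => a c h; have := imm (0, t) (a, c).
  rewrite dU /= (_ : _ + _ = 0) ?mulmx0; last by rewrite !diag_rot0.
  by case/(_ (erefl _)).
split=> //; have := cal (s, t) (1, 0) (0, 1).
rewrite /alphaN alphaE /volume_form /induced_metric !ds !dt uE /= !det3_mulmx.
rewrite !(rdot_unitary _ _ HQ) !rdot_diag_rot det3_diag_rot mulr1 mulr0 subr0 mulr1 => <-.
by congr Re; ring.
Qed.

(* Take [s = pi / x], which changes the sign of the left-hand side. *)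
Lemma profile_trace0 (x : R) (dl D : R[i]) (r : R) : 0 < r ->
  (forall s : R, Re (dl * cexp (x * s) * D) = r) -> x = 0.
Proof.
move=> r0 H; apply/eqP; apply: contraT => x0.
have := H (pi / x); rewrite mulrCA divff // mulr1.
rewrite (_ : cexp pi = -1); last by apply: ceq; rewrite /= ?cospi ?sinpi ?oppr0.
have := H 0; rewrite mulr0 cexp0 mulr1 mulrN1 mulNr ReNc => ->; lra.
Qed.

End Profile.

Section Classification.
Local Open Scope ring_scope.
Local Open Scope sesquilinear_scope.
Context {R : realType}.
Variables (b : 'I_3 -> R) (lam al : R).
Hypotheses (b0 : b o0 = lam) (b1 : b o1 = lam * al) (b2 : b o2 = lam * (- 1 - al)).
Implicit Types (w : 'cV[R[i]]_3).

Lemma diag_gen_normal w : diag_gen b w = lam%:C *: torus_gen al w.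
Proof.
by apply: vec3P; rewrite [RHS]mxE /diag_gen /torus_gen !v3E ?b0 ?b1 ?b2 ?rmorphM /=; ring.
Qed.

Lemma diag_rot_normal s w : diag_rot b s w = torus_rot al (lam * s) w.
Proof.
apply: vec3P; rewrite /diag_rot /phase_rot !v3E ?b0 ?b1 ?b2 //.
- by congr (cexp _ * _); ring.
- by congr (cexp _ * _); ring.
Qed.

(** Identifies the direction found in the equality case with the field of the profile equation, and
    so determines [eta] from [dl]. *)
Lemma cross_dual_normal dl w :
  cross_dual dl w (diag_gen b w) = lam%:C *: crossA al (- 'i%C * dl^*) w.
Proof.
apply: vec3P; rewrite [RHS]mxE /cross_dual /diag_gen /crossA /crossfield !v3E ?b0 ?b1 ?b2.
all: rewrite !(conjMc, conjDc, conjNc, conj_i, conj_real) ?rmorphM /=; ring.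
Qed.

Lemma hdot_gen_normal w : hdot w (diag_gen b w) = - 'i%C * lam%:C * (moment al w)%:C.
Proof.
rewrite /hdot /diag_gen !v3E b0 b1 b2 /moment.
have -> : (nsq (w o0 0) + al * nsq (w o1 0) + (- 1 - al) * nsq (w o2 0))%:C =
    w o0 0 * (w o0 0)^* + al%:C * (w o1 0 * (w o1 0)^*) +
    (- 1 - al)%:C * (w o2 0 * (w o2 0)^*).
  by rewrite !nsqE; move: (nsq _) (nsq _) (nsq _) => m n k; ring.
by rewrite !(conjMc, conj_i, conj_real) ?rmorphM /=; ring.
Qed.

Lemma profile_normal dl (y d : R -> 'cV[R[i]]_3) : nsq dl = 1 -> (forall t, S5 (y t)) ->
  (forall t, [/\ 0 < rdot (diag_gen b (y t)) (diag_gen b (y t)),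
    0 < gram (diag_gen b (y t)) (d t) &
    Re (dl * det3 (y t) (diag_gen b (y t)) (d t)) = Num.sqrt (gram (diag_gen b (y t)) (d t))]) ->
  lam != 0 /\ (forall t, moment al (y t) = 0 /\ 0 < energy al (y t)) /\
  exists (mu nu : R -> R), (forall t, 0 < nu t) /\
    forall t, d t = (lam * mu t)%:C *: torus_gen al (y t) +
                    (lam * nu t)%:C *: crossA al (- 'i%C * dl^*) (y t).
Proof.
move=> n1 Sy H.
have vE t : rdot (diag_gen b (y t)) (diag_gen b (y t)) = lam ^+ 2 * energy al (y t).
  by rewrite diag_gen_normal rdotZl rdotZr rdot_gen_gen; ring.
have l0 : lam != 0.
  have [+ _ _] := H 0; rewrite vE => h; apply/eqP => l0.
  by move: h; rewrite l0 expr0n mul0r ltxx.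
split=> //.
have C t := let: And3 v g e := H t in calibration_equality n1 (Sy t) v g e.
split.
  move=> t; have [h _] := C t; have [+ _ _] := H t; rewrite vE pmulr_rgt0 ?exprn_even_gt0 // => ->.
  split=> //; move/eqP: h; rewrite hdot_gen_normal mulf_eq0 mulf_eq0 oppr_eq0.
  have i0 : ('i%C : R[i]) != 0.
    by apply/eqP => /(congr1 (fun c : R[i] => Im c)) /= /eqP; rewrite oner_eq0.
  rewrite (negbTE i0) /= => /orP[/eqP/complexI/eqP|/eqP/complexI //].
  by rewrite (negbTE l0).
have [f Hf] := choice (fun t => let: conj _ (ex_intro mu (ex_intro nu h)) := C t in
  ex_intro (fun q : R * R => 0 < q.2 /\ d t = (q.1)%:C *: diag_gen b (y t) +
    (q.2)%:C *: cross_dual dl (y t) (diag_gen b (y t))) (mu, nu) h).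
exists (fun t => (f t).1), (fun t => (f t).2); split=> t; have [f0 fE] := Hf t; first by [].
rewrite fE cross_dual_normal {1}diag_gen_normal !scalerA -!rmorphM.
by congr (_%:C *: _ + _%:C *: _); exact: mulrC.
Qed.

End Classification.

Section TorusClassification.
Local Open Scope ring_scope.
Local Open Scope sesquilinear_scope.

Lemma classification (R : realType) (th : R) (B : 'M[R[i]]_3) (z : R -> 'cV[R[i]]_3) :
  skew_hermitian B -> (forall t, S5 (z t)) ->
  let u := fun p : R * R => expmx (p.1%:C *: B) *m z p.2 in
  special_legendrian th u -> covers_torus u ->
  exists al J, in_range al J /\
    forall w, is_standard al J (phase th) w -> geometrically_same (orbit_surf al w) u.
Proof.
move=> HB Sz u spec cov.
have [P0 [b' [U0 D0]]] := skew_spectral HB.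
(* Only the trace is extracted in this first eigenbasis; the profile is taken anew once the
   eigenvalues have been permuted into normal form. *)
have b'0 : b' o0 + b' o1 + b' o2 = 0.
  have [d0 [dl0 [_ _ _ H0]]] := calibrated_profile U0 D0 Sz spec.
  have [_ g0 _] := H0 0 0; rewrite -sqrtr_gt0 in g0.
  exact: (profile_trace0 g0 (fun s => let: And3 _ _ h := H0 s 0 in h)).
have [s [lam [al [hal b0 b1 b2]]]] := normal_weightsP b'0.
have [UP DP] := diag_permute s U0 D0; move: (row_perm s P0) UP DP => {U0 D0}P UP DP.
pose b j := b' (s j).
have {}b0 : b o0 = lam := b0; have {}b1 : b o1 = lam * al := b1.
have {}b2 : b o2 = lam * (- 1 - al) := b2.
have {}DP : P *m B = diag_mx (\row_j ('i%C * (b j)%:C)) *m P := DP; clearbody b.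
have [d [dl [dy yC n1 H]]] := calibrated_profile UP DP Sz spec.
set y := fun t => P *m z t in dy yC H.
have Sy t : S5 (y t) by rewrite /S5 /= rdot_unitary //; exact: Sz.
pose eta := - 'i%C * dl^*.
have e1 : nsq eta = 1 by rewrite nsqM nsqJ n1 mulr1 /nsq /= oppr0 expr0n add0r sqrrN expr1n.
have [l0 [ME [mu [nu [nu0 dE]]]]] : lam != 0 /\
    (forall t, moment al (y t) = 0 /\ 0 < energy al (y t)) /\
    exists (mu nu : R -> R), (forall t, 0 < nu t) /\
    forall t, d t = (lam * mu t)%:C *: torus_gen al (y t) + (lam * nu t)%:C *: crossA al eta (y t).
  apply: (profile_normal b0 b1 b2 n1 Sy) => t; have := H 0 t.
  by rewrite mulr0 cexp0 mulr1.
have uE p : u p = P ^t* *m torus_rot al (lam * p.1) (y p.2).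
  by rewrite -(diag_rot_normal b0 b1 b2) /u (expmx_orbit p.1 (z p.2) UP DP).
have PP : P *m P ^t* = 1%:M by apply/unitarymxP.
have Pu p : P *m u p = torus_rot al (lam * p.1) (y p.2) by rewrite uE mulmxA PP mul1mx.
(* Two independent periods cannot both have second component zero; the first component of the one
   used becomes a rotation of the profile. *)
have [T [c [T0 yT]]] : exists T c : R, T != 0 /\ forall t, y (t + T) = torus_rot al c (y t).
  have per (a : R * R) : (forall p, u (p + a) = u p) ->
      forall t, y (t + a.2) = torus_rot al (- (lam * a.1)) (y t).
    move=> h t; have := congr1 (mulmx P) (h (0, t)); rewrite !Pu /= add0r mulr0 torus_rot0 => <-.
    by rewrite -torus_rotD addNr torus_rot0.
  have [a [a' [aa h]]] := cov.
  have [a20|a20] := eqVneq a.2 0; last first.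
    by exists a.2, (- (lam * a.1)); split=> //; apply: per => p; have [] := h p.
  have [a'20|a'20] := eqVneq a'.2 0; last first.
    by exists a'.2, (- (lam * a'.1)); split=> //; apply: per => p; have [] := h p.
  by move: aa; rewrite a20 a'20 mulr0 mul0r subrr eqxx.
have Hp t : [/\ S5 (y t), moment al (y t) = 0 & 0 < energy al (y t)] by have [] := ME t.
have Hd (t : R) : vder t 1 y ((lam * mu t)%:C *: torus_gen al (y t) +
    (lam * nu t)%:C *: crossA al eta (y t)) by rewrite -dE; exact: dy.
have [x [sg [ta [ti [Hx yx K1 K2 C]]]]] := orbit_reparam e1 l0 yC Hp Hd nu0 T0 yT.
have {}yx t : y t = torus_rot al (sg t) (x (ta t)) := yx t.
have xE r : y (ti r) = torus_rot al (sg (ti r)) (x r) by rewrite yx K2.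
have xp r : [/\ S5 (x r), moment al (x r) = 0 & 0 < energy al (x r)].
  have [h1 h2 h3] := Hp (ti r); move: h1 h2 h3; rewrite xE moment_rot energy_rot.
  move=> /S5E h1; split=> //; apply/S5E; move: h1.
  by have [-> -> ->] := nsq_rot al (sg (ti r)) (x r).
have [r0 br] : exists r, balanced (x r).
  have [h1 h2 _] := xp 0.
  by apply: (flow_balanced hal e1 Hx h1 h2) => t; have [] := xp t.
have [J HJ M] := match_standard (nsq_phase th) e1 Hx br.
exists al, J; split=> // w Hw; have [g [m [n [gi mm nn gE]]]] := M w Hw.
have uo p : u p = P ^t* *m orbit_surf al x (lam * p.1 + sg p.2, ta p.2).
  by rewrite uE yx /orbit_surf /= torus_rotD.
exists (fun v => P ^t* *m g v), (fun p => (m * (lam * p.1 + sg p.2), n * (ta p.2 - r0))); split.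
- by apply: isometry_comp gi; apply: isometry_unitary; rewrite trmxC_unitary.
- split.
    move=> k; have [h1 h2 _] := C k; apply: Ck_pair; apply: Ck_scale.
      apply: Ck_add; first by apply: Ck_scale; exact: Ck_fst.
      exact: (Ck_comp1 (@Ck_snd R k) h1).
    apply: Ck_sub; last exact: Ck_cst.
    exact: (Ck_comp1 (@Ck_snd R k) h2).
  exists (fun q => (lam^-1 * (m * q.1 - sg (ti (n * q.2 + r0))), ti (n * q.2 + r0))); split.
  + move=> k; have [h1 _ h3] := C k.
    have hq : is_Ck k (fun q : R * R => n * q.2 + r0).
      by apply: Ck_add; [apply: Ck_scale; exact: Ck_snd|exact: Ck_cst].
    have ht := Ck_comp1 hq h3.
    apply: Ck_pair => //; apply: Ck_scale; apply: Ck_sub; first by apply: Ck_scale; exact: Ck_fst.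
    exact: (Ck_comp1 ht h1).
  + by case=> p q /=; rewrite !mulrA nn mul1r subrK K1 mm mul1r addrK mulKf.
  + by case=> p q /=; rewrite K2 mulVKf // subrK addrK !mulrA mm nn !mul1r.
- by move=> p; rewrite uo gE.
Qed.

End TorusClassification.

Theorem theorem4 (R : realType) (theta : R) (htheta : 0 <= theta < 2%:R * pi) :
  exists U : R -> R -> R * R -> 'cV[R[i]]_3,
    (forall a J, in_range a J -> special_legendrian theta (U a J)) /\
    (forall a J, in_range a J ->
       invariant_under (one_param_subgroup (genA a)) (U a J)) /\
    ((forall a J, in_range a J -> a = 1 \/ J = Jmax ->
        describes_clifford_torus (U a J)) /\
     (forall a J a' J', in_range a J -> in_range a' J' ->
        a <> 1 -> J <> Jmax -> (a, J) <> (a', J') ->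
        ~ geometrically_same (U a J) (U a' J'))) /\
    (forall (B : 'M[R[i]]_3) (z : R -> 'cV[R[i]]_3),
       skew_hermitian B -> (forall t, S5 (z t)) ->
       let u := fun p : R * R => expmx (p.1%:C *: B) *m z p.2 in
       special_legendrian theta u -> covers_torus u ->
       exists a J, in_range a J /\ geometrically_same (U a J) u).
Proof.
have e1 := nsq_phase theta.
have ex (q : R * R) : exists z, in_range q.1 q.2 -> is_standard q.1 q.2 (phase theta) z.
  (* Outside the parameter range the curve is a dummy, so that one choice function serves all
     pairs. *)
  have [[_ hJ]|n] := pselect (in_range q.1 q.2); last by exists (fun _ => 0) => /n.
  by have [z Hz] := standard_exists q.1 e1 hJ; exists z.
have [Z HZ] := choice ex.
have std a J : in_range a J -> is_standard a J (phase theta) (Z (a, J)) := HZ (a, J).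
exists (fun a J => orbit_surf a (Z (a, J))); split; last split; last split; first 2 last.
- split.
    move=> a J hr [a1|Jm]; have Hz := std _ _ hr.
      by subst a; exact: clifford_alpha1 e1 Hz.
    by case: hr => ha _; exact: clifford_Jmax ha Jm e1 Hz.
  move=> a J a' J' hr hr' a1 Jm ne [g [phi [ig [sphi [psi [_ _ K]]] E]]]; apply: ne.
  case: (hr) (hr') => ha hJ [ha' hJ'].
  have [J0 J1] := in_range_J hJ; have [J0' _] := in_range_J hJ'.
  have Jlt : J ^+ 2 < 27^-1.
    rewrite lt_neqAle J1 andbT -Jmax_sq eqrXn2 //; first by apply/eqP.
    exact: le_trans J0 (proj2 (andP hJ)).
  (* The inverse [psi] of [phi] supplies the point over the base point, namely [psi (0, 0)]. *)
  have [-> ->] // := parameters_eq ha ha' e1 (std _ _ hr) (std _ _ hr') ig sphi E (K (0, 0))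
    (introN eqP a1) J0 Jlt J0'.
- move=> B z HB Sz u spec cov.
  have [a [J [hr H]]] := classification HB Sz spec cov.
  by exists a, J; split=> //; exact: H (std _ _ hr).
- move=> a J hr; have [Hf h0 Hc] := std _ _ hr; have [ha _] := hr.
  apply: orbit_special_legendrian => // t; split.
  + exact: (flow_S5 (crossA_sum0 a) Hf (start_S5 h0)).
  + by rewrite (flow_moment 0 t Hf) (start_moment _ h0).
  + exact: flow_energy_gt0 ha e1 Hf h0.
- move=> a J _; exact: orbit_invariant.
Qed.
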